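(* ${\rm CLU\#P} = {\rm CL\#P}$.
   Context: Alphabet $\Sigma=\{0,1\}$; NPTM means nondeterministic polynomial-time Turing machine. For a polynomial $p$, an NPTM $M$ is $p$-balanced if on every input $x$ the set of nondeterministic guess sequences of its computation paths is exactly $\{0,1\}^{p(|x|)}$; a computation path is identified with its guess string. $\mathrm{acc}_M(x)$ is the set of accepting paths of $M$ on $x$ and $\#\mathrm{acc}_M(x)=|\mathrm{acc}_M(x)|$. ${\rm FP}_{\rm t}$ is the class of total polynomial-time computable functions. For strings $a,b$ of the same length, $a\prec_{\rm lex} b$ means $b$ is the immediate lexicographic successor of $a$, and $\le_{\rm lex}$ is lexicographic order. ${\rm CLU\#P}$: a total function $f:\Sigma^*\to\mathbb{N}$ is in ${\rm CLU\#P}$ if there exist a polynomial $p$, a $p$-balanced NPTM $M$, functions $b,t\in{\rm FP}_{\rm t}$, and a polynomial-time computable 3-argument predicate $\prec$ such that for every $x$ there is a bijection $h_x:\Sigma^{p(|x|)}\to\Sigma^{p(|x|)}$ with: (1) $|b(x)|=|t(x)|=p(|x|)$; (2) $h_x(b(x))=0^{p(|x|)}$ and $h_x(t(x))=1^{p(|x|)}$; (3) for all $y,z\in\{0,1\}^{p(|x|)}$, $\prec(x,y,z)$ holds iff $h_x(y)\prec_{\rm lex}h_x(z)$; (4) if $f(x)\ne0$ then there are $\ell,u\in\{0,1\}^{p(|x|)}$ with $\mathrm{acc}_M(x)=\{w\in\{0,1\}^{p(|x|)}: h_x(\ell)\le_{\rm lex}h_x(w)\le_{\rm lex}h_x(u)\}$;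 (5) $f(x)=\#\mathrm{acc}_M(x)$. ${\rm CL\#P}$: A total order $A$ on $\Sigma^*$ is length-respecting if $|x|<|y|$ implies $x<_A y$. Write $x\prec_A y$ if $x<_A y$ and no $z$ satisfies $x<_A z<_A y$; $A$ has efficient adjacency checks if the relation $x\prec_A y$ is decidable in polynomial time. For a $p$-balanced NPTM $M$ and input $x$, for paths $y,z$ let $y\sim_{A,M,x}z$ iff ($y\prec_A z$ or $z\prec_A y$) and ($M$ accepts $x$ on $y$ iff $M$ accepts $x$ on $z$); let $\equiv_{A,M,x}$ be its reflexive-symmetric-transitive closure. An $A$-cluster is an equivalence class of $\equiv_{A,M,x}$ consisting of accepting paths, or the empty set. A function $f$ is in ${\rm CL\#P}$ if there are a polynomial $p$, a $p$-balanced NPTM $M$ and a length-respecting total order $A$ with efficient adjacency checks such that for all $x$, $\mathrm{acc}_M(x)$ is an $A$-cluster and $f(x)=\#\mathrm{acc}_M(x)$. *)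

(* Defs.v *)
From HB Require Import structures.
From Stdlib Require Import Relation_Operators.
From mathcomp Require Import all_boot all_order all_algebra.
From mathcomp Require Import boolp classical_sets functions cardinality.

Set Implicit Arguments.
Unset Strict Implicit.
Unset Printing Implicit Defensive.

Local Open Scope classical_set_scope.
Local Open Scope card_scope.

Definition word := seq bool.
Definition words (n : nat) : set word := [set w | size w = n].

(** ** Strings of equal length in lexicographic order *)

Definition lex_le (a b : word) : Prop :=
  ((a : seqlexi bool) <= (b : seqlexi bool))%O.

Definition lex_lt (a b : word) : Prop :=
  ((a : seqlexi bool) < (b : seqlexi bool))%O.

(* [b] is the next string after [a] among the strings of the length of [a]. *)
Definition lex_succ (a b : word) : Prop :=
  [/\ size a = size b, lex_lt a b &
      forall c, size c = size a -> ~ (lex_lt a c /\ lex_lt c b)].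

(** ** Multitape Turing machines with binary guesses *)

(* Tape symbols: [None] is the blank, [Some (inl b)] the bit [b], and
   [Some (inr g)] an extra working symbol. *)
Definition symbol (G : finType) : finType := option (bool + G).

Variant move := Left | Stay | Right.

(* What the control does in a given situation: halt (accepting iff the flag is
   [true]), perform an action, or guess a bit [b] and perform the action of
   index [b].  An action consists of the next state and, for each tape, the
   symbol to write and the head movement. *)
Variant control (Q T G : finType) :=
  | Halt of bool
  | Step of Q * {ffun T -> symbol G * move}
  | Guess of (bool -> Q * {ffun T -> symbol G * move}).
Arguments Halt {Q T G}.

(* A machine with [k] string arguments, the [i]-th being initially on its own
   tape [inl i]; the other tapes are initially blank. *)
Record machine (k : nat) := Machine {
  extra : finType;
  work : finType;
  state : finType;
  start : state;
  out : 'I_k + work;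
  trans : state -> {ffun 'I_k + work -> symbol extra} ->
          control state ('I_k + work)%type extra
}.

(* A two-way infinite tape: the cells left of the head (nearest first), the
   scanned cell and the cells right of the head; all others are blank. *)
Record tape (G : finType) := Tape {
  tleft : seq (symbol G);
  thead : symbol G;
  tright : seq (symbol G)
}.

Section Semantics.
Variables (k : nat) (M : machine k).

Definition put_move (t : tape (extra M)) (a : symbol (extra M) * move) :=
  let: Tape l _ r := t in
  match a.2 with
  | Left => Tape (behead l) (head None l) (a.1 :: r)
  | Stay => Tape l a.1 r
  | Right => Tape (a.1 :: l) (head None r) (behead r)
  end.

Definition word_tape (w : word) : tape (extra M) :=
  let s := [seq Some (inl b) | b <- w] in Tape [::] (head None s) (behead s).

Record config := Config {
  cstate : state M;
  ctapes : 'I_k + work M -> tape (extra M)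
}.

Definition init (args : k.-tuple word) : config :=
  Config (start M)
    (fun i => word_tape (if i is inl j then tnth args j else [::])).

Definition ctrl (c : config) :=
  trans (cstate c) [ffun i => thead (ctapes c i)].

Definition act
    (a : state M * {ffun 'I_k + work M -> symbol (extra M) * move})
    (c : config) : config :=
  Config a.1 (fun i => put_move (ctapes c i) (a.2 i)).

(* [reach c g n d]: from [c], the machine can get to [d] in [n] steps, guessing
   successively the bits of [g]. *)
Inductive reach : config -> word -> nat -> config -> Prop :=
  | reach_refl c : reach c [::] 0 c
  | reach_step c a g n d :
      ctrl c = Step a -> reach (act a c) g n d -> reach c g n.+1 d
  | reach_guess c a b g n d :
      ctrl c = Guess a -> reach (act (a b) c) g n d -> reach c (b :: g) n.+1 d.

(* Guess strings of the complete computations on [args], of the accepting ones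
   among them. *)
Definition paths (args : k.-tuple word) : set word :=
  [set g | exists n d v, reach (init args) g n d /\ ctrl d = Halt v].

Definition acc (args : k.-tuple word) : set word :=
  [set g | exists n d, reach (init args) g n d /\ ctrl d = Halt true].

(* Partial computations are bounded too, so no computation is infinite. *)
Definition poly_time : Prop :=
  exists q : {poly nat}, forall args g n d,
    reach (init args) g n d -> n <= q.[(\sum_(i < k) size (tnth args i))%N]%R.

Definition deterministic : Prop :=
  forall s r a, trans s r <> Guess a :> control _ ('I_k + work M)%type _.

(* The bits from the scanned cell on, up to the first cell not holding a bit. *)
Fixpoint bits (s : seq (symbol (extra M))) : word :=
  if s is Some (inl b) :: s' then b :: bits s' else [::].

Definition tape_word (t : tape (extra M)) : word := bits (thead t :: tright t).

Definition outputs (args : k.-tuple word) (w : word) : Prop :=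
  exists n d v, [/\ reach (init args) [::] n d, ctrl d = Halt v &
    tape_word (ctapes d (out M)) = w].

End Semantics.

(** ** Polynomial-time functions, predicates and nondeterministic machines *)

Definition FPt (f : word -> word) : Prop :=
  exists M : machine 1, [/\ deterministic M, poly_time M &
    forall x, outputs M [tuple x] (f x)].

Definition ptime_decidable (k : nat) (P : k.-tuple word -> Prop) : Prop :=
  exists M : machine k, [/\ deterministic M, poly_time M &
    forall args, P args <-> acc M args [::]].

Definition ptime_pred2 (R : word -> word -> Prop) : Prop :=
  ptime_decidable
    (fun a : 2.-tuple word => R (tnth a (inord 0)) (tnth a (inord 1))).

Definition ptime_pred3 (R : word -> word -> word -> Prop) : Prop :=
  ptime_decidable (fun a : 3.-tuple word =>
    R (tnth a (inord 0)) (tnth a (inord 1)) (tnth a (inord 2))).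

(* The length of the computation paths of [p]-balanced machines on [x]. *)
Definition plen (p : {poly nat}) (x : word) : nat := p.[size x]%R.

Definition balanced_NPTM (p : {poly nat}) (M : machine 1) : Prop :=
  poly_time M /\ forall x, paths M [tuple x] = words (plen p x).

(** ** CLU#P *)

Definition CLUsharpP : set (word -> nat) := [set f |
  exists (p : {poly nat}) (M : machine 1) (b t : word -> word)
         (prec : word -> word -> word -> Prop),
  [/\ balanced_NPTM p M, FPt b, FPt t, ptime_pred3 prec &
  forall x, exists h : word -> word,
    let W := words (plen p x) in
    set_bij W W h /\
    [/\ W (b x) /\ W (t x),
        h (b x) = nseq (plen p x) false /\ h (t x) = nseq (plen p x) true,
        (forall y z, W y -> W z -> (prec x y z <-> lex_succ (h y) (h z))),
        (f x <> 0 -> exists l u, [/\ W l, W u &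
           acc M [tuple x] =
             [set w | [/\ W w, lex_le (h l) (h w) & lex_le (h w) (h u)]]]) &
        acc M [tuple x] #= `I_(f x)]]].

(** ** CL#P *)

Definition total_order (A : rel word) : Prop :=
  [/\ reflexive A, antisymmetric A, transitive A & total A].

Definition order_lt (A : rel word) (x y : word) : Prop := A x y /\ x <> y.

Definition length_respecting (A : rel word) : Prop :=
  forall x y, size x < size y -> order_lt A x y.

Definition adjacent (A : rel word) (x y : word) : Prop :=
  order_lt A x y /\ forall z, ~ (order_lt A x z /\ order_lt A z y).

Definition cluster_step (A : rel word) (M : machine 1) (x : word)
    (y z : word) : Prop :=
  [/\ paths M [tuple x] y, paths M [tuple x] z,
      adjacent A y z \/ adjacent A z y &
      acc M [tuple x] y <-> acc M [tuple x] z].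

Definition cluster_equiv (A : rel word) (M : machine 1) (x : word) :
    word -> word -> Prop :=
  clos_refl_sym_trans word (cluster_step A M x).

Definition cluster (A : rel word) (M : machine 1) (x : word) (C : set word) :
    Prop :=
  C = set0 \/
  exists y, [/\ paths M [tuple x] y, C = [set z | cluster_equiv A M x y z] &
    C `<=` acc M [tuple x]].

Definition CLsharpP : set (word -> nat) := [set f |
  exists (p : {poly nat}) (M : machine 1) (A : rel word),
  [/\ balanced_NPTM p M, total_order A, length_respecting A,
      ptime_pred2 (adjacent A) &
  forall x, cluster A M x (acc M [tuple x]) /\ acc M [tuple x] #= `I_(f x)]].

(* Main.v *)
From HB Require Import structures.
From Stdlib Require Import Relation_Operators.
From mathcomp Require Import all_boot all_order all_algebra.
From mathcomp Require Import boolp classical_sets functions cardinality.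
From mathcomp Require Import zify.
Require Import Defs.

(* CLU#P in CL#P: write a path [y] of [x] as [code x ++ y], with a
   self-delimiting code.  The global order lists the words by length, and words
   of the same length lexicographically, except that [h_x] permutes the block of
   the words [code x ++ y], [size y = p (size x)].  Leaving or entering a block
   happens at [t x] and [b x], which is why adjacency is decidable.

   CL#P in CLU#P: the restriction of the order [A] to the words of length
   [m = p (size x)] has decidable adjacency, but its extremities are unknown.
   They are discovered by guessing: a pair [(a, b)] with [size b = size a + 1] is
   [A]-adjacent iff [a] is the last word of its length and [b] the first one.  So
   the new paths, of length [2 m + 4], are ordered as follows: first junk in
   lexicographic order, ending at a known path, then the only path guessing the
   lower edge, the [A]-chain, the only path guessing the upper edge, and at last
   the path [1...1].  A leading bit makes each of the latter paths lie between
   two junk paths, so that the successor of a junk path is still decidable.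

   All machines are compiled from small while programs, in which a given machine
   can be called as a subroutine, its guesses being read from a tape.  Hence
   polynomial-time functions are closed under composition, acceptance by a
   balanced machine becomes decidable given the path, and conversely a balanced
   machine guesses a word as long as a given polynomial-time function says, and
   then runs a decision procedure. *)

(** CL#P asks for one order on all strings, whereas CLU#P has one order per input but must exhibit
    its extremities. So in the first inclusion the orders of all inputs are glued together: among
    the words of a given length, those sharing the prefix [code x] are consecutive, hence permuting
    them disturbs nothing outside their block. No bound on the complexity of [h_x] is given; the
    computable extremities [b x] and [t x] are what reveals where a block is left or entered.

    In the second inclusion the extremities are missing. An extremal word is certified by its
    neighbour across the change of length; the wrong guesses of such a certificate become junk
    paths, which reject. Jumping over a long run of special paths would be costly to decide.
    Therefore the leading bit is the least significant digit in the order of the junk, and all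
    special paths start with 1, so that at most one path at a time is skipped. The length 2 m + 4
    counts this bit, two tag bits, a word of length m and a word of length m + 1. *)

Set Implicit Arguments.
Unset Strict Implicit.
Unset Printing Implicit Defensive.
Import Order.TTheory GRing.Theory Num.Theory.

Local Open Scope classical_set_scope.
Local Open Scope card_scope.

(** * Tapes *)

Section Tapes.
Variable G : finType.

(** Cells are indexed relative to the head, so that a move is a shift, and tapes that differ only in
    explicit blanks at their ends become equal. *)
Definition rtape := int -> symbol G.
Definition bit (b : bool) : symbol G := Some (inl b).
Definition bitof (s : symbol G) : option bool :=
  if s is Some (inl b) then Some b else None.
Definition blank : rtape := fun _ => None.
Definition dir (m : move) : int :=
  match m with Left => -1 | Stay => 0 | Right => 1 end%R.
Definition shift (d : int) (f : rtape) : rtape := fun z => f (z + d)%R.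
Definition rput (f : rtape) (am : symbol G * move) : rtape :=
  fun z => if (z + dir am.2 == 0)%R then am.1 else f (z + dir am.2)%R.

Definition den (t : tape G) : rtape := fun z =>
  match z with
  | Posz 0 => thead t
  | Posz n.+1 => nth None (tright t) n
  | Negz n => nth None (tleft t) n
  end.

Definition wt (w : word) : rtape := fun z =>
  if z is Posz n then nth None [seq Some (inl b) | b <- w] n else None.

(** Constrains only the cells from the head to the first one that holds no bit, as the output
    convention does: a called machine may leave anything on the rest of its tape. *)
Definition holds (w : word) (f : rtape) : Prop :=
  (forall i, i < size w -> f i = bit (nth false w i)) /\
  bitof (f (size w)) = None.

Lemma wt_bit w (i : nat) : i < size w -> wt w i = bit (nth false w i).
Proof. by move=> h; rewrite /wt (nth_map false). Qed.

Lemma wt_out w (z : int) : (z < 0)%R \/ (Posz (size w) <= z)%R -> wt w z = None.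
Proof.
case: z => // n [|h]; first by lia.
by rewrite /wt nth_default // size_map; lia.
Qed.

Lemma holds_wt w : holds w (wt w).
Proof.
by split=> [i|]; [exact: wt_bit|rewrite wt_out //; right].
Qed.

Lemma wt0 : wt [::] = blank.
Proof. by apply/funext => z; rewrite /wt; case: z => // n; rewrite nth_nil. Qed.

Lemma shift0 f : shift 0 f = f.
Proof. by apply/funext => z; rewrite /shift addr0. Qed.

Lemma shiftD d e f : shift d (shift e f) = shift (d + e)%R f.
Proof. by apply/funext => z; rewrite /shift addrA. Qed.

Lemma rput_self f mv : rput f (f 0%R, mv) = shift (dir mv) f.
Proof. by apply/funext => z; rewrite /rput /shift /=; case: eqP => [->|]. Qed.

Lemma rput_stay f : rput f (f 0%R, Stay) = f.
Proof. by rewrite rput_self shift0. Qed.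

Lemma holds_cons b w f :
  holds (b :: w) f -> f 0%R = bit b /\ holds w (shift 1 f).
Proof.
move=> [h1 h2]; split; first exact: (h1 0).
split=> [i hi|].
  have := h1 i.+1 hi; rewrite /shift /= => <-; congr f; lia.
by rewrite -h2 /shift /=; congr (bitof (f _)); lia.
Qed.

Lemma holds_nil f : holds [::] f -> bitof (f 0%R) = None.
Proof. by case. Qed.

End Tapes.
Arguments bit {G}.
Arguments blank {G}.
Arguments wt {G}.

Lemma den_word_tape k (M : machine k) w : den (word_tape M w) = wt w.
Proof.
apply/funext => -[[|n]|n]; rewrite /word_tape /den /wt /= ?nth0 //.
- by rewrite nth_behead.
- by rewrite nth_nil.
Qed.

Lemma den_put k (M : machine k) t am :
  den (put_move (M := M) t am) = rput (den t) am.
Proof.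
case: t am => l h r [a mv]; apply/funext => z; rewrite /rput /=.
case: mv => /=.
- case: z => [[|[|n]]|n] //=.
  by rewrite nth_behead addn0.
- by rewrite addr0; case: z => [[|n]|n].
- case: z => [n|[|n]] //=.
  + by rewrite addn1; case: n => [|n] /=; rewrite ?nth0 // nth_behead.
  + by rewrite subn1.
Qed.

Lemma thead_den (G : finType) (t : tape G) : thead t = den t 0%R.
Proof. by []. Qed.

Lemma tape_wordP k (M : machine k) t w :
  tape_word (M := M) t = w <-> holds w (den t).
Proof.
case: t => l h r; set s := h :: r.
have -> : tape_word (M := M) (Tape l h r) = bits (M := M) s by [].
have denE (i : nat) : den (Tape l h r) i = nth None s i by case: i.
suff main : forall s, bits (M := M) s = w <->
    (forall i, i < size w -> nth None s i = bit (nth false w i)) /\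
    bitof (nth None s (size w)) = None.
  rewrite main /holds denE; split=> -[h1 h2]; split=> // i hi.
    by rewrite denE h1.
  by rewrite -denE h1.
clear; elim: w => [|b w IH] s /=.
  split=> [|[_]]; first by case: s => [|[[]|]].
  by case: s => [|[[]|]].
split.
  case: s => [|[[c|g]|] s] //= [<- /IH [h1 h2]].
  by split=> // -[|i] //= /h1.
move=> [h1 h2]; have := h1 0 isT.
case: s h1 h2 => [|x s] //= h1 h2 ->; rewrite /bit /=; congr cons.
by apply/IH; split=> // i /(h1 i.+1).
Qed.

(** * While programs and their compilation *)

Lemma reach_cat k (M : machine k) (c d e : config M) g h n m :
  reach c g n d -> reach d h m e -> reach c (g ++ h) (n + m) e.
Proof.
elim=> [//|c' a g' n' d' ca _ IH|c' a b g' n' d' ca _ IH] /IH r.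
  exact: reach_step r.
exact: reach_guess r.
Qed.

(** Guesses are the only source of nondeterminism, so two computations with comparable guess strings
    run in step, and neither can go beyond a halting configuration. Hence one halting run per guess
    string determines all the computations of a machine. *)
Lemma reach_prefix k (M : machine k) (c d : config M) g n v :
  reach c g n d -> ctrl d = Halt v ->
  forall g' n' d', reach c g' n' d' -> prefix g' g || prefix g g' ->
  exists s m, [/\ g = g' ++ s, n = n' + m & reach d' s m d].
Proof.
elim=> [{}c|{}c a {}g {}n {}d ca r IH|{}c a b {}g {}n {}d ca r IH] hv g' n' d'.
- case E: _ _ _ _ / => [c1|c1 a1 g1 n1 d1 ca1 r1|c1 a1 b1 g1 n1 d1 ca1 r1] hp.
  + by exists [::], 0; split=> //; exact: reach_refl.
  + by move: ca1; rewrite -E hv.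
  + by move: ca1; rewrite -E hv.
- case E: _ _ _ _ / => [c1|c1 a1 g1 n1 d1 ca1 r1|c1 a1 b1 g1 n1 d1 ca1 r1] hp.
  + by exists g, n.+1; split=> //; rewrite -E; apply: reach_step r.
  + subst c1; move: ca1 r1; rewrite ca => -[<-] r1.
    have [s [m [-> -> rs]]] := IH hv _ _ _ r1 hp.
    by exists s, m; split.
  + by move: ca1; rewrite -E ca.
- case E: _ _ _ _ / => [c1|c1 a1 g1 n1 d1 ca1 r1|c1 a1 b1 g1 n1 d1 ca1 r1] hp.
  + by exists (b :: g), n.+1; split=> //; rewrite -E; apply: reach_guess r.
  + by move: ca1; rewrite -E ca.
  + subst c1; move: ca1 r1; rewrite ca => -[<-].
    move: hp => /= hp.
    have [eb hp'] : b1 = b /\ prefix g1 g || prefix g g1.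
      by case/orP: hp => /andP [/eqP -> ->]; rewrite ?orbT.
    rewrite eb => r1; have [s [m [-> -> rs]]] := IH hv _ _ _ r1 hp'.
    by exists s, m; split.
Qed.

Section Prog.
Variables T G : finType.

Definition reads := {ffun T -> symbol G}.
Definition acts := {ffun T -> symbol G * move}.

Inductive prog :=
  | Do of (reads -> acts)
  | Ask of (bool -> reads -> acts)
  | Seq of prog & prog
  | While of (reads -> bool) & prog.

Definition mem := T -> rtape G.
Definition rd (m : mem) : reads := [ffun t => m t 0%R].
Definition app (a : acts) (m : mem) : mem := fun t => rput (m t) (a t).
Definition idle (r : reads) : acts := [ffun t => (r t, Stay)].

(* [exec p m g n m']: from the memory [m], the program [p] can terminate with
   memory [m'] after [n] steps, guessing successively the bits of [g]. *)
Inductive exec : prog -> mem -> word -> nat -> mem -> Prop :=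
  | exec_Do a m : exec (Do a) m [::] 1 (app (a (rd m)) m)
  | exec_Ask a b m : exec (Ask a) m [:: b] 1 (app (a b (rd m)) m)
  | exec_Seq p q m g n m1 h k m2 :
      exec p m g n m1 -> exec q m1 h k m2 ->
      exec (Seq p q) m (g ++ h) (n + k) m2
  | exec_WhileF t p m : ~~ t (rd m) -> exec (While t p) m [::] 1 m
  | exec_WhileT (t : reads -> bool) p m g n m1 h k m2 :
      t (rd m) -> exec p m g n m1 -> exec (While t p) m1 h k m2 ->
      exec (While t p) m (g ++ h) (n + k).+1 m2.

(** The control points, which become the states of the compiled machine. The extra point of a loop
    is the evaluation of its test. *)
Fixpoint pos (p : prog) : finType :=
  match p with
  | Do _ | Ask _ => unit
  | Seq p q => (pos p + pos q)%type
  | While _ p => option (pos p)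
  end.

Fixpoint entry (p : prog) : pos p :=
  match p with
  | Do _ | Ask _ => tt
  | Seq p q => inl (entry p)
  | While _ p => None
  end.

Definition pctl (S : Type) := (S * acts + (bool -> S * acts))%type.

Definition pmap (S S' : Type) (f : S -> S') (x : pctl S) : pctl S' :=
  match x with
  | inl (s, a) => inl (f s, a)
  | inr a => inr (fun b => (f (a b).1, (a b).2))
  end.

(* The next position, [None] if the program terminates. *)
Fixpoint ptrans (p : prog) : pos p -> reads -> pctl (option (pos p)) :=
  match p with
  | Do a => fun _ r => inl (None, a r)
  | Ask a => fun _ r => inr (fun b => (None, a b r))
  | Seq p q => fun s r =>
      match s with
      | inl s => pmap (fun s' => Some (oapp inl (inr (entry q)) s')) (ptrans s r)
      | inr s => pmap (omap inr) (ptrans s r)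
      end
  | While t p => fun s r =>
      match s with
      | None => inl (if t r then Some (Some (entry p)) else None, idle r)
      | Some s => pmap (fun s' => Some s') (ptrans s r)
      end
  end.

Fixpoint noask (p : prog) : bool :=
  match p with
  | Do _ => true
  | Ask _ => false
  | Seq p q => noask p && noask q
  | While _ p => noask p
  end.

Lemma noask_ptrans p (s : pos p) r a : noask p -> ptrans s r <> inr a.
Proof.
elim: p s a => [f|f|p IHp q IHq|t p IHp] //= [s|s] a.
- move=> /andP [hp _]; case E: (ptrans s r) => [[]|f] //.
  by case: (IHp _ _ hp E).
- move=> /andP [_ hq]; case E: (ptrans s r) => [[]|f] //.
  by case: (IHq _ _ hq E).
- move=> hp; case E: (ptrans s r) => [[]|f] //.
  by case: (IHp _ _ hp E).
- by [].
Qed.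

End Prog.

Section Compile.
Variables (k : nat) (M : machine k).
Notation T := ('I_k + work M)%type.
Notation G := (extra M).

(* [M] executes [p], its state being [f s] at the position [s] of [p], and goes
   on in state [e] when [p] terminates. *)
Definition implements (p : prog T G) (f : pos p -> state M) (e : state M) :=
  forall s r, trans (f s) r =
    match ptrans s r with
    | inl (s', a) => Step (oapp f e s', a)
    | inr a => Guess (fun b => (oapp f e (a b).1, (a b).2))
    end :> control _ T G.

Definition denotes (c : config M) (m : mem T G) : Prop :=
  forall t, den (ctapes c t) = m t.

Lemma denotes_rd c m :
  denotes c m -> [ffun i => thead (ctapes c i)] = rd m :> reads _ _.
Proof. by move=> h; apply/ffunP => t; rewrite !ffunE thead_den h. Qed.

Lemma denotes_act c m s a : denotes c m -> denotes (act (s, a) c) (app a m).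
Proof. by move=> h t; rewrite /= den_put h. Qed.

Lemma app_idle (m : mem T G) : app (idle (rd m)) m = m.
Proof. by apply/funext => t; rewrite /app /idle !ffunE rput_stay. Qed.

(** By induction on the execution. The positions of a subprogram implement it once its exit is set
    to the point where control goes next: the entry of [q] in a sequence, the test in a loop. This
    is why [implements] is relative to an embedding and an exit state. *)
Lemma exec_reach p m g n m' : exec p m g n m' ->
  forall (f : pos p -> state M) e, implements f e ->
  forall c, cstate c = f (entry p) -> denotes c m ->
  exists c', [/\ reach c g n c', cstate c' = e & denotes c' m'].
Proof.
elim=> {p m g n m'}.
- move=> a m f e hf c hc hm.
  exists (act (e, a (rd m)) c); split=> //; last exact: denotes_act.
  by apply: reach_step (reach_refl _); rewrite /ctrl hc (denotes_rd hm) hf.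
- move=> a b m f e hf c hc hm.
  exists (act (e, a b (rd m)) c); split=> //; last exact: denotes_act.
  pose a' b := (e, a b (rd m)).
  apply: (@reach_guess _ _ _ a' b) (reach_refl _).
  by rewrite /ctrl hc (denotes_rd hm) hf.
- move=> p q m g n m1 h l m2 _ IHp _ IHq f e hf c hc hm.
  have fp : implements (fun s => f (inl s)) (f (inr (entry q))).
    move=> s r; rewrite hf /=; case: (ptrans s r) => [[[s'|] a]|a] //=.
    by congr Guess; apply/funext => b; case: (a b) => [[]].
  have fq : implements (fun s => f (inr s)) e.
    move=> s r; rewrite hf /=; case: (ptrans s r) => [[[s'|] a]|a] //=.
    by congr Guess; apply/funext => b; case: (a b) => [[]].
  have [c1 [r1 s1 d1]] := IHp _ _ fp c hc hm.
  have [c2 [r2 s2 d2]] := IHq _ _ fq c1 s1 d1.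
  by exists c2; split=> //; exact: reach_cat r1 r2.
- move=> t p m ht f e hf c hc hm.
  exists (act (e, idle (rd m)) c); split=> //.
    apply: reach_step (reach_refl _).
    by rewrite /ctrl hc (denotes_rd hm) hf /= (negbTE ht).
  by have := denotes_act e (idle (rd m)) hm; rewrite app_idle.
- move=> t p m g n m1 h l m2 ht _ IHp _ IHw f e hf c hc hm.
  have fp : implements (fun s => f (Some s)) (f None).
    move=> s r; rewrite hf /=; case: (ptrans s r) => [[[s'|] a]|a] //=.
    by congr Guess; apply/funext => b; case: (a b) => [[]].
  pose c0 := act (f (Some (entry p)), idle (rd m)) c.
  have d0 : denotes c0 m.
    by have := denotes_act (f (Some (entry p))) (idle (rd m)) hm; rewrite app_idle.
  have [c1 [r1 s1 d1]] := IHp _ _ fp c0 erefl d0.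
  have [c2 [r2 s2 d2]] := IHw _ _ hf c1 s1 d1.
  exists c2; split=> //; apply: reach_step (reach_cat r1 r2).
  by rewrite /ctrl hc (denotes_rd hm) hf /= ht.
Qed.

End Compile.

Section Compiled.
Variables (k : nat) (W G : finType).
Notation T := ('I_k + W)%type.
Variables (p : prog T G) (o : T) (v : reads T G -> bool).

Definition compile : machine k :=
  @Machine k G W (option (pos p)) (Some (entry p)) o
    (fun s r => match s with
       | None => Halt (v r)
       | Some s => match ptrans s r with
                   | inl a => Step a
                   | inr a => Guess a
                   end
       end).

Definition minit (args : k.-tuple word) : mem T G :=
  fun t => if t is inl j then wt (tnth args j) else blank.

Lemma denotes_init args : denotes (init compile args) (minit args).
Proof.
case=> [j|w]; rewrite /minit -?wt0; exact: (den_word_tape compile).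
Qed.

Lemma implements_compile : implements (M := compile) (@Some (pos p)) None.
Proof.
move=> s r /=; case: (ptrans s r) => [[[s'|] a]|a] //=.
by congr Guess; apply/funext => b; case: (a b) => [[]].
Qed.

Lemma exec_compile args g n m : exec p (minit args) g n m ->
  exists d, [/\ reach (init compile args) g n d, ctrl d = Halt (v (rd m)) &
    denotes d m].
Proof.
move=> hp.
have [d [r s hd]] :=
  @exec_reach k compile p _ g n m hp _ _ implements_compile
    (init compile args) erefl
    (denotes_init args).
by exists d; split=> //; rewrite /ctrl s (denotes_rd hd).
Qed.

Lemma deterministic_compile : noask p -> deterministic compile.
Proof.
move=> hp [s|] r a //=; case E: (ptrans s r) => [//|f] _.
exact: noask_ptrans hp E.
Qed.

End Compiled.
Arguments minit {k W G} args t.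

(** * Polynomial time *)

Definition insize k (args : k.-tuple word) : nat :=
  \sum_(i < k) size (tnth args i).

Definition pbounded k (N : k.-tuple word -> nat) : Prop :=
  exists q : {poly nat}, forall args, N args <= q.[insize args]%R.

Lemma leq_horner (q : {poly nat}) a b : a <= b -> q.[a]%R <= q.[b]%R.
Proof.
move=> ab; elim/poly_ind: q => [|q c IH]; first by rewrite !horner0.
by rewrite !hornerMXaddC leq_add2r leq_mul.
Qed.

Section PolyBounds.
Variable k : nat.
Implicit Types N : k.-tuple word -> nat.

Lemma pbounded_le N N' :
  pbounded N' -> (forall args, N args <= N' args) -> pbounded N.
Proof. by move=> [q hq] h; exists q => a; exact: leq_trans (h a) (hq a). Qed.

Lemma pbounded_const c : pbounded (fun _ : k.-tuple word => c).
Proof. by exists c%:P%R => a; rewrite hornerC. Qed.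

Lemma pbounded_add N N' :
  pbounded N -> pbounded N' -> pbounded (fun a => N a + N' a).
Proof.
by move=> [q hq] [q' hq']; exists (q + q')%R => a; rewrite hornerD leq_add.
Qed.

Lemma pbounded_mul N N' :
  pbounded N -> pbounded N' -> pbounded (fun a => N a * N' a).
Proof.
by move=> [q hq] [q' hq']; exists (q * q')%R => a; rewrite hornerM leq_mul.
Qed.

Lemma pbounded_horner (q : {poly nat}) N :
  pbounded N -> pbounded (fun a => q.[N a]%R).
Proof.
move=> [r hr]; elim/poly_ind: q => [|q c IH].
  by exists 0%R => a; rewrite !horner0.
have h := pbounded_add (pbounded_mul IH (ex_intro _ r hr)) (pbounded_const c).
by apply: (pbounded_le h) => a; rewrite hornerMXaddC.
Qed.

Lemma pbounded_sum (I : finType) (N : I -> k.-tuple word -> nat) :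
  (forall i, pbounded (N i)) -> pbounded (fun a => \sum_i N i a).
Proof.
move=> h; elim: (index_enum I) => [|i s IH].
  by apply: (pbounded_le (pbounded_const 0)) => a; rewrite big_nil.
by apply: (pbounded_le (pbounded_add (h i) IH)) => a; rewrite big_cons.
Qed.

Lemma pbounded_insize : pbounded (@insize k).
Proof. by exists 'X%R => a; rewrite hornerX. Qed.

Lemma size_insize (args : k.-tuple word) i : size (tnth args i) <= insize args.
Proof. by rewrite /insize (bigD1 i) //= leq_addr. Qed.

Lemma pbounded_size i : pbounded (fun a : k.-tuple word => size (tnth a i)).
Proof. by apply: (pbounded_le pbounded_insize) => a; exact: size_insize. Qed.

End PolyBounds.

Section Time.
Variables (k : nat) (M : machine k).

Lemma reach_halted (c d : config M) g n v :
  ctrl c = Halt v -> reach c g n d -> [/\ g = [::], n = 0 & d = c].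
Proof. by move=> hc r; case: r hc => // [{}c a|{}c a b] *; congruence. Qed.

Definition tsize (t : tape (extra M)) := size (tleft t) + size (tright t).

Lemma tsize_put t am : tsize (put_move (M := M) t am) <= (tsize t).+1.
Proof.
by case: t am => l h r [a []]; rewrite /tsize /= ?size_behead; lia.
Qed.

Lemma reach_tsize (c d : config M) g n : reach c g n d ->
  forall i, tsize (ctapes d i) <= tsize (ctapes c i) + n.
Proof.
elim=> [{}c|{}c a {}g {}n {}d ca r IH|{}c a b {}g {}n {}d ca r IH] i.
- by rewrite addn0.
- by apply: leq_trans (IH i) _; rewrite addnS -addSn leq_add2r tsize_put.
- by apply: leq_trans (IH i) _; rewrite addnS -addSn leq_add2r tsize_put.
Qed.

Lemma tsize_init args i : tsize (ctapes (init M args) i) <= insize args.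
Proof.
rewrite /tsize /= size_behead size_map; case: i => [j|//].
by apply: leq_trans (leq_pred _) _; exact: size_insize.
Qed.

Lemma size_tape_word (t : tape (extra M)) :
  size (tape_word (M := M) t) <= (tsize t).+1.
Proof.
have sb s : size (bits (M := M) s) <= size s.
  by elim: s => [|[[b|g]|] s IH] //=.
by apply: leq_trans (sb _) _; rewrite /tsize /=; lia.
Qed.

Variables (L N : k.-tuple word -> nat).
Hypothesis runs : forall args g, size g = L args ->
  exists n d v, [/\ reach (init M args) g n d, ctrl d = Halt v & n <= N args].

(** Cutting [g], or padding it with 0s, gives a comparable guess string of length [L args]. By
    [reach_prefix], the given computation is an initial part of the halting run on that string. *)
Lemma reach_time args g n d : reach (init M args) g n d ->
  n <= N args /\ forall v, ctrl d = Halt v -> size g = L args.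
Proof.
move=> r; pose g' := take (L args) (g ++ nseq (L args) false).
have sg' : size g' = L args.
  by rewrite size_takel // size_cat size_nseq leq_addl.
have [n' [d' [v [r' hd' hn']]]] := runs sg'.
have hp : prefix g g' || prefix g' g.
  rewrite /g' take_cat; case: ltnP => h; apply/orP.
    by right; exact: prefix_take.
  by left; exact: prefix_prefix.
have [s [m [eg en rs]]] := reach_prefix r' hd' r hp.
split=> [|w hw]; first by rewrite (leq_trans _ hn') // en leq_addr.
have [es _ _] := reach_halted hw rs.
by rewrite -sg' eg es cats0.
Qed.

Lemma runs_poly_time : pbounded N -> poly_time M.
Proof.
move=> [q hq]; exists q => args g n d /reach_time [h _].
exact: leq_trans h (hq args).
Qed.

Lemma runs_paths args : paths M args = words (L args).
Proof.
apply/seteqP; split=> g /=.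
  by move=> [n [d [v [r hd]]]]; have [_ /(_ _ hd)] := reach_time r.
by move=> /runs [n [d [v [r hd _]]]]; exists n, d, v.
Qed.

Lemma runs_acc args g n d v :
  reach (init M args) g n d -> ctrl d = Halt v -> acc M args g <-> v.
Proof.
move=> r hd; split=> [[n' [d' [r' hd']]]|hv]; last by exists n, d; case: v hv hd.
have [|s [m [eg en rs]]] := reach_prefix r hd r'; first by rewrite prefix_refl.
by have [_ _ e] := reach_halted hd' rs; rewrite e hd' in hd; case: hd => <-.
Qed.

End Time.

Definition FP k (F : k.-tuple word -> word) : Prop :=
  exists M : machine k, [/\ deterministic M, poly_time M &
    forall args, outputs M args (F args)].

(** A step enlarges a tape by at most one cell, so the output is no longer than the input and the
    running time together, plus one. *)
Lemma FP_size k (F : k.-tuple word -> word) :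
  FP F -> pbounded (fun a => size (F a)).
Proof.
move=> [M [_ [q hq] hF]].
apply: (pbounded_le (pbounded_add (pbounded_add (pbounded_insize k)
  (pbounded_horner q (pbounded_insize k))) (pbounded_const k 1))) => args.
have [n [d [v [r _ <-]]]] := hF args.
rewrite addn1; apply: leq_trans (size_tape_word _) _.
apply: leq_trans (reach_tsize r _) _; apply: leq_add (hq _ _ _ _ r).
exact: tsize_init.
Qed.

Section ProgRuns.
Variables (k : nat) (W G : finType).
Notation T := ('I_k + W)%type.
Variables (p : prog T G) (o : T) (v : reads T G -> bool).
Variables (N : k.-tuple word -> nat).
Hypothesis pN : pbounded N.

Lemma FP_prog (F : k.-tuple word -> word) : noask p ->
  (forall args, exists n m, [/\ exec p (minit args) [::] n m, n <= N args &
     holds (F args) (m o)]) -> FP F.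
Proof.
move=> hp hF; exists (compile p o v); split.
- exact: deterministic_compile.
- apply: (@runs_poly_time _ _ (fun=> 0) N) => // args g /size0nil ->.
  have [n [m [e hn _]]] := hF args.
  by have [d [r hd _]] := exec_compile o v e; exists n, d, (v (rd m)).
- move=> args; have [n [m [e hn ho]]] := hF args.
  have [d [r hd hm]] := exec_compile o v e; exists n, d, (v (rd m)); split=> //.
  by apply/tape_wordP; rewrite hm.
Qed.

(** Serves decision procedures, with [L] equal to 0, as well as balanced machines, with [L] the
    length of the paths. *)
Lemma NP_prog (L : k.-tuple word -> nat) (P : k.-tuple word -> word -> bool) :
  (forall args g, size g = L args -> exists n m,
    [/\ exec p (minit args) g n m, n <= N args & v (rd m) = P args g]) ->
  exists M : machine k, [/\ poly_time M, (noask p -> deterministic M),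
    (forall args, paths M args = words (L args)) &
    forall args g, size g = L args -> (acc M args g <-> P args g)].
Proof.
move=> hP; exists (compile p o v).
have runs args g : size g = L args -> exists n d v', [/\
    reach (init (compile p o v) args) g n d, ctrl d = Halt v' & n <= N args].
  move=> /hP [n [m [e hn ho]]].
  by have [d [r hd hm]] := exec_compile o v e; exists n, d, (v (rd m)).
split.
- exact: runs_poly_time runs pN.
- exact: deterministic_compile.
- exact: runs_paths runs.
- move=> args g /hP [n [m [e hn ho]]].
  by have [d [r hd hm]] := exec_compile o v e; rewrite -ho; exact: runs_acc r hd.
Qed.

End ProgRuns.

(** * Elementary programs: registers, copying, guessing and rewinding *)

Section Blocks.
Variables T G : finType.
Implicit Types (m : mem T G) (t src dst q : T) (v w : word) (p : prog T G).

Definition upd m t (f : rtape G) : mem T G := fun t' => if t' == t then f else m t'.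

Lemma upd_same m t f : upd m t f t = f.
Proof. by rewrite /upd eqxx. Qed.

Lemma upd_other m t f t' : t' != t -> upd m t f t' = m t'.
Proof. by rewrite /upd => /negbTE ->. Qed.

Lemma upd_id m t f : m t = f -> upd m t f = m.
Proof. by move=> <-; apply/funext => t'; rewrite /upd; case: eqP => [->|]. Qed.

Lemma upd_upd m t f f' : upd (upd m t f) t f' = upd m t f'.
Proof. by apply/funext => t'; rewrite /upd; case: eqP. Qed.

Lemma upd_upd2 m t t' f f' g g' :
  upd (upd (upd (upd m t f) t' f') t g) t' g' = upd (upd m t g) t' g'.
Proof. by apply/funext => s; rewrite /upd; do 2 case: eqP => //. Qed.

Lemma exec_Seq0 p p' m1 m2 m3 n n' :
  exec p m1 [::] n m2 -> exec p' m2 [::] n' m3 ->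
  exec (Seq p p') m1 [::] (n + n') m3.
Proof. exact: exec_Seq. Qed.

Definition on t (am : symbol G * move) (r : reads T G) : acts T G :=
  [ffun t' => if t' == t then am else (r t', Stay)].

Lemma app_on t am m : app (on t am (rd m)) m = upd m t (rput (m t) am).
Proof.
apply/funext => t'; rewrite /app /upd !ffunE.
by case: eqP => [->//|_]; rewrite rput_stay.
Qed.

Definition on2 t am t' am' (r : reads T G) : acts T G :=
  [ffun s => if s == t then am else on t' am' r s].

Lemma app_on2 t t' am am' m : t != t' ->
  app (on2 t am t' am' (rd m)) m =
  upd (upd m t (rput (m t) am)) t' (rput (m t') am').
Proof.
move=> tt'; apply/funext => s; rewrite /app /upd !ffunE.
case: (s =P t) => [->|_]; first by rewrite (negbTE tt').
by case: eqP => [->//|_]; rewrite rput_stay.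
Qed.

Definition Skip : prog T G := Do (@idle T G).

Lemma exec_Skip m : exec Skip m [::] 1 m.
Proof.
have := exec_Do (@idle T G) m; congr exec.
by apply/funext => t; rewrite /app !ffunE rput_stay.
Qed.

Definition Move t mv : prog T G := Do (fun r => on t (r t, mv) r).

Lemma exec_Move t mv m :
  exec (Move t mv) m [::] 1 (upd m t (shift (dir mv) (m t))).
Proof.
have := exec_Do (fun r => on t (r t, mv) r) m; congr exec.
by rewrite app_on ffunE rput_self.
Qed.

(** A tape used as a register: a single cell, overwritten in place. *)
Definition regt (s : symbol G) : rtape G := fun z => if z == 0%R then s else None.

Definition Setreg q s : prog T G := Do (on q (s, Stay)).

Lemma exec_Setreg q s s' m :
  m q = regt s' -> exec (Setreg q s) m [::] 1 (upd m q (regt s)).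
Proof.
move=> mq; have := exec_Do (on q (s, Stay)) m; congr exec.
rewrite app_on; congr upd; apply/funext => z.
by rewrite /rput mq /regt /= addr0; case: eqP.
Qed.

(** The head stands on the first cell behind [v], ready to append. *)
Definition at_end v : rtape G := shift (size v) (wt v).

Lemma at_end_nil : at_end [::] = blank.
Proof. by rewrite /at_end wt0. Qed.

Lemma rput_at_end v b : rput (at_end v) (bit b, Right) = at_end (rcons v b).
Proof.
apply/funext => z; rewrite /rput /at_end /shift /= size_rcons.
rewrite (_ : (z + 1 + size v)%R = (z + (size v).+1)%R); last by lia.
case: eqP => [z0|z0].
  rewrite (_ : (z + (size v).+1)%R = size v); last by lia.
  by rewrite wt_bit ?size_rcons // nth_rcons ltnn eqxx.
case E: (z + (size v).+1)%R => [n|n] //.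
have [h|h] := ltnP n (size v).
  by rewrite !wt_bit ?size_rcons ?nth_rcons ?h //; lia.
by rewrite !wt_out // ?size_rcons; right; lia.
Qed.

Definition isbit (x : symbol G) : bool := bitof x != None.

Definition Xfer src dst : prog T G :=
  While (fun r => isbit (r src))
    (Do (fun r => on2 src (r src, Right) dst (r src, Right) r)).

Lemma exec_Xfer src dst w v m : src != dst ->
  holds w (m src) -> m dst = at_end v ->
  exec (Xfer src dst) m [::] (size w).*2.+1
    (upd (upd m src (shift (size w) (m src))) dst (at_end (v ++ w))).
Proof.
move=> sd; elim: w v m => [|b w IH] v m hs hd.
  rewrite shift0 cats0 (upd_id erefl) (upd_id hd); apply: exec_WhileF.
  by rewrite ffunE /isbit (holds_nil hs).
have [m0 hw] := holds_cons hs.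
pose m1 := upd (upd m src (shift 1 (m src))) dst (at_end (rcons v b)).
have e1 : exec (Do (fun r => on2 src (r src, Right) dst (r src, Right) r))
    m [::] 1 m1.
  have := exec_Do (fun r => on2 src (r src, Right) dst (r src, Right) r) m.
  congr exec; rewrite app_on2 // !ffunE rput_self; congr upd.
  by rewrite m0 hd rput_at_end.
have m1s : m1 src = shift 1 (m src) by rewrite /m1 upd_other // upd_same.
have m1d : m1 dst = at_end (rcons v b) by rewrite /m1 upd_same.
have e2 := IH (rcons v b) m1; rewrite m1s m1d in e2.
have {}e2 := e2 hw erefl.
have ht : isbit (rd m src) by rewrite ffunE m0.
have := @exec_WhileT _ _ _ _ _ _ _ _ _ _ _ ht e1 e2.
congr exec.
rewrite /m1 upd_upd2 -cats1 -catA shiftD.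
by rewrite (_ : (Posz (size w) + 1)%R = size (b :: w)) //=; lia.
Qed.

(** The word on [src] is a clock: one bit is guessed for each of its letters. *)
Definition XferAsk src dst : prog T G :=
  While (fun r => isbit (r src))
    (Ask (fun b r => on2 src (r src, Right) dst (bit b, Right) r)).

Lemma exec_XferAsk src dst w v g m : src != dst ->
  holds w (m src) -> m dst = at_end v -> size g = size w ->
  exec (XferAsk src dst) m g (size w).*2.+1
    (upd (upd m src (shift (size w) (m src))) dst (at_end (v ++ g))).
Proof.
move=> sd; elim: w v g m => [|b w IH] v [|c g] m hs hd //= sg.
  rewrite shift0 cats0 (upd_id erefl) (upd_id hd); apply: exec_WhileF.
  by rewrite ffunE /isbit (holds_nil hs).
have [m0 hw] := holds_cons hs.
pose m1 := upd (upd m src (shift 1 (m src))) dst (at_end (rcons v c)).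
have e1 : exec (Ask (fun b r => on2 src (r src, Right) dst (bit b, Right) r))
    m [:: c] 1 m1.
  have := exec_Ask (fun b r => on2 src (r src, Right) dst (bit b, Right) r) c m.
  congr exec; rewrite app_on2 // !ffunE rput_self; congr upd.
  by rewrite hd rput_at_end.
have m1s : m1 src = shift 1 (m src) by rewrite /m1 upd_other // upd_same.
have m1d : m1 dst = at_end (rcons v c) by rewrite /m1 upd_same.
have e2 := IH (rcons v c) g m1; rewrite m1s m1d in e2.
have {}e2 := e2 hw erefl (succn_inj sg).
have ht : isbit (rd m src) by rewrite ffunE m0.
have := @exec_WhileT _ _ _ _ _ _ _ _ _ _ _ ht e1 e2.
congr exec.
rewrite /m1 upd_upd2 -cats1 -catA shiftD.
by rewrite (_ : (Posz (size w) + 1)%R = size (b :: w)) //=; lia.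
Qed.

(** After writing a word the head is on the blank behind it, where the loop would stop at once;
    hence the initial move to the left. *)
Definition Rew t : prog T G :=
  Seq (Move t Left) (Seq (While (fun r => isbit (r t)) (Move t Left)) (Move t Right)).

Lemma exec_Rew t (i : nat) w m : i <= size w -> m t = shift i (wt w) ->
  exec (Rew t) m [::] (i.*2 + 3) (upd m t (wt w)).
Proof.
move=> hi mt.
(* The position [j - 1] is an integer because the loop ends at -1, on the blank before the word. *)
have loop j : j <= size w -> forall m', m' t = shift (Posz j - 1)%R (wt w) ->
    exec (While (fun r => isbit (r t)) (Move t Left)) m' [::] j.*2.+1
      (upd m' t (shift (-1)%R (wt w))).
  elim: j => [_|j IH hj] m' hm'.
    rewrite upd_id //; apply: exec_WhileF.
    by rewrite ffunE hm' /isbit /shift wt_out //; left.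
  have ht : isbit (rd m' t).
    rewrite ffunE hm' /isbit /shift (_ : (_ + _)%R = Posz j); last by lia.
    by rewrite wt_bit.
  have e1 := exec_Move t Left m'.
  have ed : shift (dir Left) (m' t) = shift (Posz j - 1)%R (wt w).
    by rewrite hm' shiftD (_ : (_ + _)%R = (Posz j - 1)%R) //=; lia.
  rewrite ed in e1.
  have e2 := IH (ltnW hj) _ (upd_same m' t (shift (Posz j - 1)%R (wt w))).
  have := @exec_WhileT _ _ _ _ _ _ _ _ _ _ _ ht e1 e2.
  by rewrite upd_upd doubleS.
have e1 := exec_Move t Left m.
have ed : shift (dir Left) (m t) = shift (Posz i - 1)%R (wt w).
  by rewrite mt shiftD (_ : (_ + _)%R = (Posz i - 1)%R) //=; lia.
rewrite ed in e1.
have e2 := loop i hi _ (upd_same m t (shift (Posz i - 1)%R (wt w))).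
have e3 := exec_Move t Right (upd m t (shift (-1)%R (wt w))).
rewrite upd_upd in e2.
have := exec_Seq0 e1 (exec_Seq0 e2 e3); congr exec; first by lia.
by rewrite upd_upd upd_same shiftD shift0.
Qed.

Definition Copy src dst : prog T G :=
  Seq (Xfer src dst) (Seq (Rew src) (Rew dst)).

Lemma exec_Copy src dst w m : src != dst -> m src = wt w -> m dst = blank ->
  exec (Copy src dst) m [::] (6 * size w + 7) (upd m dst (wt w)).
Proof.
move=> sd ms md.
have hs : holds w (m src) by rewrite ms; exact: holds_wt.
have e1 := exec_Xfer sd hs (etrans md (esym at_end_nil)).
set m1 := upd _ dst _ in e1.
have m1s : m1 src = shift (size w) (wt w).
  by rewrite /m1 upd_other // upd_same ms.
have e2 := exec_Rew (leqnn _) m1s.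
have m2d : upd m1 src (wt w) dst = shift (size w) (wt w).
  by rewrite upd_other 1?eq_sym // /m1 upd_same.
have e3 := exec_Rew (leqnn _) m2d.
have := exec_Seq0 e1 (exec_Seq0 e2 e3); congr exec; first by lia.
by rewrite /m1 upd_upd2 (upd_id ms).
Qed.

End Blocks.

(** * Calling a machine as a subroutine *)

Section Call.
Variables (k : nat) (M : machine k) (T G : finType).
Variables (io : 'I_k + work M -> T) (q w : T).
Variables (eg : extra M -> G) (es : state M -> G).
Hypotheses (io_inj : injective io) (eg_inj : injective eg) (es_inj : injective es).
Hypotheses (io_q : forall i, io i != q) (io_w : forall i, io i != w) (qw : q != w).

Definition enc_sym (s : symbol (extra M)) : symbol G :=
  match s with
  | Some (inl b) => Some (inl b)
  | Some (inr g) => Some (inr (eg g))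
  | None => None
  end.

Definition enc_state (s : state M) : symbol G := Some (inr (es s)).

Definition dec_sym (x : symbol G) : symbol (extra M) :=
  odflt None [pick s | enc_sym s == x].

Definition call_ctl (r : reads T G) : control (state M) ('I_k + work M)%type (extra M) :=
  if [pick s | enc_state s == r q] is Some s
  then trans s [ffun i => dec_sym (r (io i))] else Halt false.

Definition running (r : reads T G) : bool :=
  if call_ctl r is Halt _ then false else true.

Definition accepts (r : reads T G) : bool :=
  if call_ctl r is Halt v then v else false.

Definition fed (x : symbol G) : bool := odflt false (bitof x).

Definition lift_act (gm : symbol G * move)
    (a : state M * {ffun 'I_k + work M -> symbol (extra M) * move})
    (r : reads T G) : acts T G :=
  [ffun t => if t == q then (enc_state a.1, Stay)
     else if t == w then gm
     else if [pick i | io i == t] is Some i then (enc_sym (a.2 i).1, (a.2 i).2)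
     else (r t, Stay)].

(* The state of the simulated machine is kept on the tape [q]; its guesses are
   read from the tape [w], blank cells being taken as (and replaced with) 0. *)
Definition Run : prog T G :=
  While running (Do (fun r =>
    match call_ctl r with
    | Step a => lift_act (r w, Stay) a r
    | Guess a => lift_act (bit (fed (r w)), Right) (a (fed (r w))) r
    | Halt _ => idle r
    end)).

(** Representing a configuration by a function, rather than by a relation, makes each simulated step
    an equation between memories. *)
Definition emem (m0 : mem T G) (c : config M) (f : rtape G) : mem T G :=
  fun t => if t == q then regt (enc_state (cstate c))
    else if t == w then f
    else if [pick i | io i == t] is Some i
         then fun z => enc_sym (den (ctapes c i) z)
    else m0 t.

Lemma enc_sym_inj : injective enc_sym.
Proof. by move=> [[b|g]|] [[c|h]|] //= [] => [->|/eg_inj ->]. Qed.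

Lemma enc_symK : cancel enc_sym dec_sym.
Proof.
move=> s; rewrite /dec_sym; case: pickP => [s' /eqP /enc_sym_inj //|/(_ s)].
by rewrite eqxx.
Qed.

Lemma bitof_enc s : bitof (enc_sym s) = bitof s.
Proof. by case: s => [[]|]. Qed.

Lemma pick_io i : [pick j | io j == io i] = Some i.
Proof.
case: pickP => [j /eqP /io_inj -> //|/(_ i)]; by rewrite eqxx.
Qed.

Lemma emem_io m0 c f i : emem m0 c f (io i) = fun z => enc_sym (den (ctapes c i) z).
Proof. by rewrite /emem (negbTE (io_q i)) (negbTE (io_w i)) pick_io. Qed.

Lemma emem_q m0 c f : emem m0 c f q = regt (enc_state (cstate c)).
Proof. by rewrite /emem eqxx. Qed.

Lemma emem_w m0 c f : emem m0 c f w = f.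
Proof. by rewrite /emem eq_sym (negbTE qw) eqxx. Qed.

Lemma emem_other m0 c f t :
  t != q -> t != w -> (forall i, t != io i) -> emem m0 c f t = m0 t.
Proof.
move=> tq tw h; rewrite /emem (negbTE tq) (negbTE tw).
by case: pickP => [i|//]; rewrite eq_sym (negbTE (h i)).
Qed.

Lemma call_ctl_emem m0 c f : call_ctl (rd (emem m0 c f)) = ctrl c.
Proof.
rewrite /call_ctl ffunE emem_q /regt eqxx.
case: pickP => [s /eqP|/(_ (cstate c))]; last by rewrite eqxx.
rewrite /enc_state => -[/es_inj ->]; rewrite /ctrl; congr trans.
by apply/ffunP => i; rewrite !ffunE emem_io enc_symK thead_den.
Qed.

Lemma app_lift_act m0 c f gm a :
  app (lift_act gm a (rd (emem m0 c f))) (emem m0 c f) =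
  emem m0 (act a c) (rput f gm).
Proof.
apply/funext => t; rewrite /app ffunE.
case: (t =P q) => [->|/eqP tq].
  rewrite !emem_q; apply/funext => z.
  by rewrite /rput /regt /= addr0; case: eqP.
case: (t =P w) => [->|/eqP tw]; first by rewrite !emem_w.
case: pickP => [i /eqP <-|h].
  rewrite !emem_io; apply/funext => z; rewrite /= den_put /rput /=.
  by case: eqP.
rewrite ffunE rput_stay !emem_other // => i; by rewrite eq_sym h.
Qed.

Fixpoint fits (g : word) (f : rtape G) : Prop :=
  if g is b :: g' then fed (f 0%R) = b /\ fits g' (shift 1 f) else True.

(** The tape left behind when the guesses [g] have been read. Each guess being written back, a blank
    tape ends up with one 0 per guess, which makes it possible to measure the length of a path. *)
Fixpoint eat (g : word) (f : rtape G) : rtape G :=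
  if g is b :: g' then eat g' (rput f (bit b, Right)) else f.

Lemma fits_ext g f f' :
  (forall i : nat, f' (Posz i) = f (Posz i)) -> fits g f -> fits g f'.
Proof.
elim: g f f' => [//|b g IH] f f' h /= [h1 h2]; split; first by rewrite h.
apply: IH h2 => i; rewrite /shift (_ : (Posz i + 1)%R = Posz i.+1) //; lia.
Qed.

Lemma exec_Run m0 c g n d v f :
  reach c g n d -> ctrl d = Halt v -> fits g f ->
  exec Run (emem m0 c f) [::] n.*2.+1 (emem m0 d (eat g f)).
Proof.
move=> r; elim: r f => [{}c|{}c a {}g {}n {}d ca r IH|{}c a b {}g {}n {}d ca r IH] f hd hf.
- by apply: exec_WhileF; rewrite /running call_ctl_emem hd.
- rewrite doubleS; apply: (exec_WhileT _ _ (IH f hd hf) (g := [::]) (n := 1)).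
    by rewrite /running call_ctl_emem ca.
  have := exec_Do (fun r => match call_ctl r with
    | Step a => lift_act (r w, Stay) a r
    | Guess a => lift_act (bit (fed (r w)), Right) (a (fed (r w))) r
    | Halt _ => idle r end) (emem m0 c f).
  by rewrite call_ctl_emem ca app_lift_act ffunE emem_w rput_stay.
- move: hf => /= [fb hf].
  have hf' : fits g (rput f (bit b, Right)).
    apply: fits_ext hf => i; rewrite /rput /shift /=.
    by case: eqP => //; lia.
  rewrite doubleS; apply: (exec_WhileT _ _ (IH _ hd hf') (g := [::]) (n := 1)).
    by rewrite /running call_ctl_emem ca.
  have := exec_Do (fun r => match call_ctl r with
    | Step a => lift_act (r w, Stay) a r
    | Guess a => lift_act (bit (fed (r w)), Right) (a (fed (r w))) r
    | Halt _ => idle r end) (emem m0 c f).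
  by rewrite call_ctl_emem ca app_lift_act ffunE emem_w fb.
Qed.

Definition Call : prog T G := Seq (Setreg q (enc_state (start M))) Run.

Definition ready (args : k.-tuple word) (m : mem T G) : Prop :=
  [/\ forall j, m (io (inl j)) = wt (tnth args j),
      forall u, m (io (inr u)) = blank & exists s, m q = regt s].

Lemma exec_Call args g n d v m :
  reach (init M args) g n d -> ctrl d = Halt v ->
  ready args m -> fits g (m w) ->
  exists m', [/\ exec Call m [::] n.*2.+2 m',
    forall x, tape_word (ctapes d (out M)) = x -> holds x (m' (io (out M))),
    accepts (rd m') = v, m' w = eat g (m w) & exists s, m' q = regt s] /\
    forall t, t != q -> t != w -> (forall i, t != io i) -> m' t = m t.
Proof.
move=> r hd [hin hwork [s hq]] hf.
exists (emem m d (eat g (m w))); split; last by move=> t *; rewrite emem_other.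
split.
- have e1 := exec_Setreg (enc_state (start M)) hq.
  have e2 := exec_Run m r hd hf.
  apply: (exec_Seq (g := [::]) (n := 1)) e2; move: e1; congr exec.
  apply/funext => t; rewrite /upd /emem; case: eqP => // _.
  case: (t =P w) => [->//|_]; case: pickP => [i /eqP <-|//].
  apply/funext => z; case: i => [j|u].
    rewrite hin /= den_word_tape /wt; case: z => // i.
    have [h|h] := ltnP i (size (tnth args j)).
      by rewrite !(nth_map false).
    by rewrite !nth_default // size_map.
  by rewrite hwork; case: z => // -[|i] //=; rewrite nth_nil.
- move=> x /tape_wordP [h1 h2]; rewrite emem_io; split=> [i hi|].
    by rewrite h1.
  by rewrite bitof_enc.
- by rewrite /accepts call_ctl_emem hd.
- exact: emem_w.
- by exists (enc_state (cstate d)); rewrite emem_q.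
Qed.

End Call.

(** Without a halting run, a deterministic computation could be prolonged step by step beyond the
    time bound, which applies to partial computations too. *)
Lemma deterministic_halts k (M : machine k) args :
  deterministic M -> poly_time M ->
  exists n d v, reach (init M args) [::] n d /\ ctrl d = Halt v.
Proof.
move=> hM [q hq]; apply: contrapT => hn.
have long n : exists d, reach (init M args) [::] n d.
  elim: n => [|n [d r]]; first by exists (init M args); exact: reach_refl.
  case E: (ctrl d) => [v|a|a].
  - by case: hn; exists n, d, v.
  - exists (act a d).
    by have := reach_cat r (reach_step E (reach_refl _)); rewrite addn1.
  - by case: (hM _ _ _ E).
have [d r] := long q.[insize args]%R.+1.
by have := hq _ _ _ _ r; rewrite ltnn.
Qed.

(** * Decidable predicates as functions with one-bit values *)

Section MachinesInProgs.
Variable k : nat.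

Definition embed_io (A B : Type) (i : 'I_k + A) : 'I_k + (A + B) :=
  match i with inl j => inl j | inr u => inr (inl u) end.

Lemma embed_io_inj A B : injective (@embed_io A B).
Proof. by move=> [j|u] [j'|u'] //= [->]. Qed.

Lemma pbounded_time (q : {poly nat}) :
  pbounded (fun a : k.-tuple word => q.[insize a]%R.*2.+2 + 1).
Proof.
have h := pbounded_horner q (pbounded_insize k).
apply: (pbounded_le (pbounded_add (pbounded_add h h) (pbounded_const k 3))).
by move=> a; lia.
Qed.

(** With the converse [dec_FP], closure under composition has to be proved for functions only. *)
Lemma FP_dec (P : k.-tuple word -> Prop) :
  ptime_decidable P -> FP (fun a => [:: `[< P a >]]).
Proof.
move=> [M [hd ht hP]]; have [pq hq] := ht.
pose W : finType := (work M + 'I_3)%type.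
pose T : finType := ('I_k + W)%type.
pose G : finType := (extra M + state M)%type.
pose io : 'I_k + work M -> T := @embed_io _ _.
pose reg i : T := inr (inr i).
(* [q] keeps the state of [M], [w] is a guess tape from which a deterministic machine reads nothing,
   and [o] receives the verdict. *)
pose q := reg ord0; pose w := reg (Ordinal (isT : 1 < 3)).
pose o := reg (Ordinal (isT : 2 < 3)).
pose eg : extra M -> G := inl; pose es : state M -> G := inr.
pose p := Seq (Call io q w eg es)
  (Do (fun r => on o (bit (accepts io q eg es r), Stay) r)).
have io_reg i j : io i != reg j by case: i.
have io_inj : injective io := @embed_io_inj _ _.
have eg_inj : injective eg by move=> ? ? [].
have es_inj : injective es by move=> ? ? [].
apply: (@FP_prog _ _ _ p o xpredT _ (pbounded_time pq)) => // a.
have [n [d [v [r hdv]]]] := deterministic_halts a hd ht.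
have rdy : ready (M := M) io q a (minit (G := G) a).
  by split=> //; exists None; apply/funext => z; rewrite /regt /blank; case: ifP.
have [m' [[e _ hv _ _] ho]] := exec_Call io_inj eg_inj es_inj
  (fun i => io_reg i _) (fun i => io_reg i _) (isT : q != w) r hdv rdy I.
exists (n.*2.+2 + 1); exists (upd m' o (rput (m' o) (bit v, Stay))); split.
- apply: exec_Seq0 e _.
  have := exec_Do (fun r => on o (bit (accepts io q eg es r), Stay) r) m'.
  by rewrite app_on hv.
- by rewrite leq_add2r !ltnS leq_double; exact: hq r.
- have -> : `[< P a >] = v.
    apply/asboolP/idP; last by case: v hdv {hv} => // hdv _; apply/hP; exists n, d.
    by move/hP => /(runs_acc r hdv).
  rewrite upd_same ho //; last by move=> i; rewrite eq_sym io_reg.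
  split=> [[|//] _|] /=; rewrite /rput /= ?addr0 //.
Qed.

Lemma dec_FP (P : k.-tuple word -> Prop) :
  FP (fun a => [:: `[< P a >]]) -> ptime_decidable P.
Proof.
move=> [M [hd [pq hq] hF]].
pose W : finType := (work M + bool)%type.
pose T : finType := ('I_k + W)%type.
pose G : finType := (extra M + state M)%type.
pose io : 'I_k + work M -> T := @embed_io _ _.
pose reg i : T := inr (inr i).
pose q := reg true; pose w := reg false.
pose eg : extra M -> G := inl; pose es : state M -> G := inr.
have io_reg i j : io i != reg j by case: i.
have io_inj : injective io := @embed_io_inj _ _.
have eg_inj : injective eg by move=> ? ? [].
have es_inj : injective es by move=> ? ? [].
have [] := @NP_prog k W G (Call io q w eg es) w
  (fun r => r (io (out M)) == bit true) _ (pbounded_time pq) (fun=> 0)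
  (fun a _ => `[< P a >]).
  move=> a g /size0nil ->; have [n [d [v [r hdv hw]]]] := hF a.
  have rdy : ready (M := M) io q a (minit (G := G) a).
    by split=> //; exists None; apply/funext => z; rewrite /regt /blank; case: ifP.
  have [m' [[e ho _ _ _] _]] := exec_Call io_inj eg_inj es_inj
    (fun i => io_reg i _) (fun i => io_reg i _) (isT : q != w) r hdv rdy I.
  exists n.*2.+2, m'; split=> //.
    by rewrite addn1 ltnW // !ltnS leq_double; exact: hq r.
  by rewrite ffunE; have [/(_ 0 isT) -> _] := ho _ hw; case: `[< P a >].
move=> N [hN hdet _ hacc]; exists N; split=> //; first exact: hdet.
by move=> a; rewrite hacc //; split=> /asboolP.
Qed.

End MachinesInProgs.

(** * Balanced machines: deciding acceptance, measuring paths *)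

Section Balanced.
Variables (p : {poly nat}) (M : machine 1).
Hypothesis hM : balanced_NPTM p M.

Lemma balanced_run x g : size g = plen p x ->
  exists n d v, reach (init M [tuple x]) g n d /\ ctrl d = Halt v.
Proof.
by move=> hg; have : paths M [tuple x] g by rewrite hM.2.
Qed.

Lemma fits_wt (G : finType) w n j :
  fits (mkseq (fun i => nth false w (j + i)) n)
    (shift (Posz j) (wt w : rtape G)).
Proof.
elim: n j => [//|n IH] j; rewrite /mkseq /= addn0; split.
  rewrite /shift add0r /fed; have [h|h] := ltnP j (size w).
    by rewrite wt_bit.
  by rewrite wt_out ?nth_default //; right; lia.
rewrite shiftD (iotaDl 1 0) -map_comp.
have := IH j.+1; rewrite (_ : (1 + Posz j)%R = Posz j.+1) //; congr fits.
by apply: eq_map => i; rewrite /= addSnnS.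
Qed.

Lemma eat_at_end (G : finType) (g v : word) :
  eat g (at_end G v) = at_end G (v ++ g).
Proof.
elim: g v => [|b g IH] v /=; first by rewrite cats0.
by rewrite rput_at_end IH cat_rcons.
Qed.

(* Reading the guesses from the second argument, padded with 0s or truncated,
   makes the acceptance of a path decidable. *)
Lemma FP_acc : exists2 Q : word -> word -> bool,
  FP (fun a : 2.-tuple word => [:: Q (tnth a (inord 0)) (tnth a (inord 1))]) &
  forall x g, size g = plen p x -> (acc M [tuple x] g <-> Q x g).
Proof.
pose gs x w := mkseq (nth false w) (plen p x).
exists (fun x w => `[< acc M [tuple x] (gs x w) >]); last first.
  by move=> x g hg; rewrite /gs -hg mkseq_nth; split=> /asboolP.
have [[pq hq] _] := hM.
pose W : finType := (work M + unit)%type.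
pose T : finType := ('I_2 + W)%type.
pose G : finType := (extra M + state M)%type.
pose io (i : 'I_1 + work M) : T :=
  match i with inl j => inl (inord 0) | inr u => inr (inl u) end.
pose q : T := inr (inr tt); pose w : T := inl (inord 1).
pose eg : extra M -> G := inl; pose es : state M -> G := inr.
have io_q i : io i != q by case: i.
have io_w i : io i != w.
  by case: i => // j; apply/eqP => -[/(congr1 val)]; rewrite /= !inordK.
have io_inj : injective io 
  by move=> [i|u] [j|v] //=; [rewrite (ord1 i) (ord1 j)|case=> ->].
have eg_inj : injective eg by move=> ? ? [].
have es_inj : injective es by move=> ? ? [].
suff : ptime_decidable (fun a : 2.-tuple word => acc M [tuple tnth a (inord 0)]
    (gs (tnth a (inord 0)) (tnth a (inord 1)))) by move/FP_dec.
have [] := @NP_prog 2 W G (Call io q w eg es) w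
  (accepts io q eg es) _ (pbounded_time _ pq) (fun=> 0)
  (fun a _ => `[< acc M [tuple tnth a (inord 0)]
    (gs (tnth a (inord 0)) (tnth a (inord 1))) >]); last first.
  move=> N [hN hdet _ hacc]; exists N; split=> //; first exact: hdet.
  by move=> a; rewrite hacc //; split=> /asboolP.
move=> a g /size0nil ->; set x := tnth a (inord 0); set u := tnth a (inord 1).
have [n [d [v [r hdv]]]] := balanced_run (size_mkseq (nth false u) (plen p x)).
have rdy : ready (M := M) io q [tuple x] (minit (G := G) a).
  split=> //; first by move=> j; rewrite (ord1 j).
  by exists None; apply/funext => z; rewrite /regt /blank; case: ifP.
have hf : fits (gs x u) (minit (G := G) a w).
  by have := fits_wt G u (plen p x) 0; rewrite shift0.
have [m' [[e _ hv _ _] _]] := exec_Call io_inj eg_inj es_inj io_q io_w isT r hdv rdy hf.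
exists n.*2.+2, m'; split=> //.
  rewrite addn1 ltnW // !ltnS leq_double; apply: leq_trans (hq _ _ _ _ r) _.
  by apply: leq_horner; rewrite big_ord1; exact: size_insize.
rewrite hv; apply/idP/asboolP => [|/(runs_acc r hdv) //].
by case: v hdv {hv} => // hdv _; exists n, d.
Qed.

(** No polynomial is evaluated: [M] itself is run with a blank guess tape. Being balanced, it reads
    exactly [plen p x] guesses there and leaves as many 0s behind. *)
Lemma FP_plen :
  FP (fun a : 1.-tuple word => nseq (plen p (tnth a ord0)) false).
Proof.
have [[pq hq] _] := hM.
pose W : finType := (work M + bool)%type.
pose T : finType := ('I_1 + W)%type.
pose G : finType := (extra M + state M)%type.
pose io : 'I_1 + work M -> T := @embed_io _ _ _.
pose reg i : T := inr (inr i).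
pose q := reg true; pose w := reg false.
pose eg : extra M -> G := inl; pose es : state M -> G := inr.
have io_reg i j : io i != reg j by case: i.
have io_inj : injective io := @embed_io_inj _ _ _.
have eg_inj : injective eg by move=> ? ? [].
have es_inj : injective es by move=> ? ? [].
have pN : pbounded (fun a : 1.-tuple word =>
    (pq.[insize a]%R.*2.+2 + 1) + (p.[insize a]%R + p.[insize a]%R + 3)).
  have h := pbounded_horner p (pbounded_insize 1).
  exact: pbounded_add (pbounded_time 1 pq)
    (pbounded_add (pbounded_add h h) (pbounded_const 1 3)).
apply: (@FP_prog 1 W G (Seq (Call io q w eg es) (Rew G w)) w xpredT _ pN) => //= a.
set x := tnth a ord0.
have ea : [tuple x] = a by apply: eq_from_tnth => i; rewrite (ord1 i).
have [n [d [v [r hdv]]]] := balanced_run (size_nseq (plen p x) false).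
rewrite ea in r.
have rdy : ready (M := M) io q a (minit (G := G) a).
  by split=> //; exists None; apply/funext => z; rewrite /regt /blank; case: ifP.
have hf : fits (nseq (plen p x) false) (minit (G := G) a w).
  rewrite /=; elim: (plen p x) => //= l IH; split=> //.
have [m' [[e _ _ hw _] _]] := exec_Call io_inj eg_inj es_inj
  (fun i => io_reg i _) (fun i => io_reg i _) (isT : q != w) r hdv rdy hf.
rewrite [minit a w]/= -at_end_nil eat_at_end in hw.
have e2 := exec_Rew (leqnn _) hw.
exists (n.*2.+2 + ((plen p x).*2 + 3)).
exists (upd m' w (wt (nseq (plen p x) false))); split.
- by have := exec_Seq0 e e2; rewrite cat0s size_nseq.
- have := hq _ _ _ _ r.
  have : plen p x <= p.[insize a]%R by apply: leq_horner; exact: size_insize.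
  by rewrite -/(insize a); lia.
- by rewrite upd_same; exact: holds_wt.
Qed.

End Balanced.

(** * Balanced machines from decision procedures *)

Lemma regt_blank (G : finType) : regt (None : symbol G) = blank.
Proof. by apply/funext => z; rewrite /regt; case: ifP. Qed.

(** The value of [u] is a clock that fixes the number of guesses. Both called machines may destroy
    their arguments, so each receives its own copy of the input. *)
Lemma FP_balanced (p : {poly nat}) (u : 1.-tuple word -> word)
    (P : word -> word -> bool) :
  FP u -> (forall x, size (u [tuple x]) = plen p x) ->
  FP (fun a : 2.-tuple word => [:: P (tnth a (inord 0)) (tnth a (inord 1))]) ->
  exists2 M : machine 1, balanced_NPTM p M &
    forall x, acc M [tuple x] = [set w | size w = plen p x /\ P x w].
Proof.
move=> [U [_ [pU tU] hU]] su [D [_ [pD tD] hD]].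
pose W : finType := ((('I_1 + work U) + ('I_2 + work D)) + bool)%type.
pose T : finType := ('I_1 + W)%type.
pose G : finType := ((extra U + state U) + (extra D + state D))%type.
pose x0 : T := inl ord0.
pose ioU i : T := inr (inl (inl i)); pose ioD i : T := inr (inl (inr i)).
pose q : T := inr (inr true); pose w : T := inr (inr false).
pose egU (g : extra U) : G := inl (inl g); pose esU (s : state U) : G := inl (inr s).
pose egD (g : extra D) : G := inr (inl g); pose esD (s : state D) : G := inr (inr s).
have injU : injective ioU by move=> ? ? [].
have injD : injective ioD by move=> ? ? [].
have injegU : injective egU by move=> ? ? [].
have injesU : injective esU by move=> ? ? [].
have injegD : injective egD by move=> ? ? [].
have injesD : injective esD by move=> ? ? [].
pose i0 : 'I_2 := inord 0; pose i1 : 'I_2 := inord 1.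
have i01 : i0 != i1 by apply/eqP => /(congr1 val); rewrite /= !inordK.
pose X := ioU (inl ord0); pose Y0 := ioD (inl i0); pose Y1 := ioD (inl i1).
pose prg : prog T G := Seq (Copy G x0 X) (Seq (Copy G x0 Y0)
  (Seq (Call ioU q w egU esU) (Seq (XferAsk G (ioU (out U)) Y1)
  (Seq (Rew G Y1) (Call ioD q w egD esD))))).
(* The summands pay for the two copies, the call of [U], guessing and rewinding, and the call of
   [D]. *)
pose N (a : 1.-tuple word) := (12 * insize a + 14) + (2 * pU.[insize a]%R + 2) +
  (4 * p.[insize a]%R + 4) + (2 * pD.[insize a + p.[insize a]]%R + 2).
have pN : pbounded N.
  have hi := pbounded_insize 1; have hc := pbounded_const 1.
  have hp := pbounded_horner p hi.
  have mc c N' : pbounded N' -> pbounded (fun a : 1.-tuple word => c * N' a).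
    by move=> h; exact: pbounded_mul (hc c) h.
  apply: pbounded_add; last first.
    exact: pbounded_add (mc _ _ (pbounded_horner pD (pbounded_add hi hp))) (hc 2).
  apply: pbounded_add; last exact: pbounded_add (mc _ _ hp) (hc 4).
  apply: pbounded_add (pbounded_add (mc _ _ hi) (hc 14)) _.
  exact: pbounded_add (mc _ _ (pbounded_horner pU hi)) (hc 2).
have [a g hg|M [hM _ hpaths hacc]] := @NP_prog 1 W G prg w
  (fun r => r (ioD (out D)) == bit true) N pN (fun a => plen p (tnth a ord0))
  (fun a g => P (tnth a ord0) g); last first.
  exists M; first by split=> // x; rewrite hpaths.
  move=> x; apply/seteqP; split=> g /=.
    move=> h; have sg : size g = plen p x.
      have : paths M [tuple x] g by case: h => n [d [r hd]]; exists n, d, true.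
      by rewrite hpaths.
    by split=> //; move: h; rewrite hacc.
  by move=> [sg hP]; rewrite hacc.
set x := tnth a ord0 in hg *.
have ea : [tuple x] = a by apply: eq_from_tnth => i; rewrite (ord1 i).
have sx : size x = insize a by rewrite /insize big_ord1.
pose m0 : mem T G := minit a.
have e1 := @exec_Copy T G x0 X x m0 isT erefl erefl.
pose m1 := upd m0 X (wt x).
have e2 := @exec_Copy T G x0 Y0 x m1 isT erefl erefl.
pose m2 := upd m1 Y0 (wt x).
have [nU [dU [vU [rU hdU hoU]]]] := hU a.
have rdyU : ready (M := U) ioU q a m2.
  split=> //; last by exists None; rewrite regt_blank.
  by move=> j; rewrite (ord1 j).
have [m3 [[e3 h3 _ _ [s3 q3]] f3]] := exec_Call injU injegU injesU
  (fun i => isT : ioU i != q) (fun i => isT : ioU i != w) (isT : q != w) rU hdU rdyU I.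
have Y01 : Y0 != Y1 by rewrite /Y0 /Y1.
have m3Y0 : m3 Y0 = wt x by rewrite f3 // /m2 upd_same.
have m3D i : ioD i != Y0 -> m3 (ioD i) = blank.
  by move=> hi; rewrite f3 // /m2 upd_other //; case: i {hi}.
have m3Y1 : m3 Y1 = at_end G [::].
  by rewrite at_end_nil m3D // eq_sym.
have su' : size g = size (u a) by rewrite -ea su -hg.
have e4 := @exec_XferAsk T G (ioU (out U)) Y1 (u a) [::] g m3 isT (h3 _ hoU) m3Y1 su'.
rewrite cat0s in e4; set m4 := upd _ Y1 _ in e4.
have e5 := exec_Rew (leqnn _) (upd_same _ Y1 (at_end G g) : m4 Y1 = _).
set m5 := upd m4 _ _ in e5.
have [nD [dD [vD [rD hdD hoD]]]] := hD [tuple x; g].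
have t0 : tnth [tuple x; g] i0 = x by rewrite (tnth_nth [::]) /= inordK.
have t1 : tnth [tuple x; g] i1 = g by rewrite (tnth_nth [::]) /= inordK.
have m5o t : t != Y1 -> t != ioU (out U) -> m5 t = m3 t.
  by move=> h h'; rewrite /m5 upd_other // /m4 upd_other // upd_other.
have rdyD : ready (M := D) ioD q [tuple x; g] m5.
  split.
  - move=> j; have [->|j1] := eqVneq j i1; first by rewrite t1 /m5 upd_same.
    have -> : j = i0.
      apply/val_inj; rewrite /= inordK //; apply: contraNeq j1 => j0.
      apply/eqP/val_inj; rewrite /= inordK //.
      by case: j j0 => [[|[|]]].
    by rewrite t0 m5o.
  - by move=> v; rewrite m5o // m3D.
  - by exists s3; rewrite m5o.
have [m6 [[e6 h6 _ _ _] _]] := exec_Call injD injegD injesD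
  (fun i => isT : ioD i != q) (fun i => isT : ioD i != w) (isT : q != w) rD hdD rdyD I.
do 2 eexists; split.
- by have := exec_Seq e1 (exec_Seq e2 (exec_Seq e3 (exec_Seq e4 (exec_Seq e5 e6))));
    rewrite !cats0 !cat0s; apply.
- have hu := tU _ _ _ _ rU; have hd := tD _ _ _ _ rD.
  rewrite -!/(insize _) in hu hd.
  have : nD <= pD.[insize a + p.[insize a]]%R.
    apply: leq_trans hd _; apply: leq_horner.
    by rewrite /insize big_ord_recl big_ord1 (tnth_nth [::]) /= hg /plen sx.
  have sg : size g = p.[insize a]%R by rewrite hg /plen sx.
  by rewrite /N -su' sx sg; move: hu; lia.
- rewrite ffunE; have [/(_ 0 isT) -> _] := h6 _ hoD.
  by rewrite t0 t1; case: (P x g).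
Qed.

(** * Composition and transducers *)

Definition seqs (T G : finType) (ps : seq (prog T G)) : prog T G :=
  foldr (@Seq T G) (Skip T G) ps.

Lemma noask_seqs (T G : finType) (ps : seq (prog T G)) :
  noask (seqs ps) = all (@noask T G) ps.
Proof. by elim: ps => //= p ps ->. Qed.

(* [Inv r] describes the memory once the programs of index in [r] are done. *)
Lemma exec_seqs (T G : finType) (I : eqType) (P : I -> prog T G) (t : I -> nat)
    (Inv : seq I -> mem T G -> Prop) :
  (forall i r m, i \notin r -> Inv r m ->
     exists n m', [/\ exec (P i) m [::] n m', n <= t i & Inv (i :: r) m']) ->
  forall s r m, uniq s -> {in s, forall i, i \notin r} -> Inv r m ->
  exists n m', [/\ exec (seqs (map P s)) m [::] n m',
    n <= \sum_(i <- s) t i + 1 & Inv (catrev s r) m'].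
Proof.
move=> step; elim=> [|i s IH] r m /= => [_ _ hm|/andP [iNs us] hs hm].
  by exists 1, m; rewrite big_nil; split=> //; exact: exec_Skip.
have [n [m1 [e hn hm1]]] := step i r m (hs i (mem_head _ _)) hm.
have [|n' [m2 [e' hn' hm2]]] := IH (i :: r) m1 us _ hm1.
  move=> j js; rewrite inE negb_or hs ?andbT; last by rewrite inE js orbT.
  by apply: contraNneq iNs => <-.
exists (n + n'), m2; split=> //; first exact: exec_Seq0 e e'.
by rewrite big_cons; lia.
Qed.

(** Each inner machine has private tapes, collected in a dependent sum, and works on fresh copies of
    the arguments. Its result is moved to an input tape of [D]. Only the state register and the
    guess tape are shared between the calls. *)
Lemma FP_comp k l (F : l.-tuple word -> word) (f : 'I_l -> k.-tuple word -> word) :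
  FP F -> (forall j, FP (f j)) -> FP (fun a => F [tuple f j a | j < l]).
Proof.
move=> [D [dD [pD tD] hD]] hf.
have [U hU] := choice hf.
have dU j : deterministic (U j) by case: (hU j).
have tU j : poly_time (U j) by case: (hU j).
have {hU} oU j : forall a, outputs (U j) a (f j a) by case: (hU j).
have [pU {}tU] := choice tU.
pose TU (j : 'I_l) : finType := ('I_k + work (U j))%type.
pose GU (j : 'I_l) : finType := (extra (U j) + state (U j))%type.
pose W : finType := (({j : 'I_l & TU j} + ('I_l + work D)) + bool)%type.
pose T : finType := ('I_k + W)%type.
pose G : finType := ({j : 'I_l & GU j} + (extra D + state D))%type.
pose ioU j (i : TU j) : T := inr (inl (inl (Tagged TU i))).
pose ioD i : T := inr (inl (inr i)).
pose q : T := inr (inr true); pose w : T := inr (inr false).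
pose egU j (g : extra (U j)) : G := inl (Tagged GU (inl g : GU j)).
pose esU j (s : state (U j)) : G := inl (Tagged GU (inr s : GU j)).
pose egD (g : extra D) : G := inr (inl g); pose esD (s : state D) : G := inr (inr s).
have injU j : injective (@ioU j).
  by move=> x y [] /eqP; rewrite eq_Tagged => /eqP.
have injD : injective ioD by move=> ? ? [].
have injegU j : injective (@egU j).
  by move=> x y [] /eqP; rewrite eq_Tagged => /eqP [].
have injesU j : injective (@esU j).
  by move=> x y [] /eqP; rewrite eq_Tagged => /eqP [].
have injegD : injective egD by move=> ? ? [].
have injesD : injective esD by move=> ? ? [].
have ioUneq j j' i i' : j != j' -> @ioU j i != @ioU j' i'.
  by apply: contraNneq => -[e _]; rewrite e.
pose P1 j (i : 'I_k) := Copy G (inl i : T) (@ioU j (inl i)).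
pose P2 j := Seq (seqs (map (P1 j) (index_enum 'I_k)))
  (Seq (Call (@ioU j) q w (@egU j) (@esU j))
  (Seq (Xfer G (ioU j (out (U j))) (ioD (inl j))) (Rew G (ioD (inl j))))).
pose prg := Seq (seqs (map P2 (index_enum 'I_l))) (Call ioD q w egD esD).
pose t1 (a : k.-tuple word) (i : 'I_k) := 6 * size (tnth a i) + 7.
pose t2 (a : k.-tuple word) j := (\sum_i t1 a i + 1) + (2 * (pU j).[insize a]%R + 2) +
  (2 * size (f j a) + 1) + (2 * size (f j a) + 3).
pose N (a : k.-tuple word) := (\sum_j t2 a j + 1) + (2 * pD.[\sum_j size (f j a)]%R + 2).
have pN : pbounded N.
  have hi := pbounded_insize k; have hc := pbounded_const k.
  have mc c N' : pbounded N' -> pbounded (fun a : k.-tuple word => c * N' a).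
    by move=> h; exact: pbounded_mul (hc c) h.
  have hs j : pbounded (fun a => size (f j a)) by exact: FP_size.
  apply: pbounded_add; last first.
    exact: pbounded_add (mc _ _ (pbounded_horner pD (pbounded_sum hs))) (hc 2).
  apply: pbounded_add (hc 1); apply: pbounded_sum => j.
  apply: pbounded_add; last exact: pbounded_add (mc _ _ (hs j)) (hc 3).
  apply: pbounded_add; last exact: pbounded_add (mc _ _ (hs j)) (hc 1).
  apply: pbounded_add; last first.
    exact: pbounded_add (mc _ _ (pbounded_horner (pU j) hi)) (hc 2).
  apply: pbounded_add (hc 1); apply: pbounded_sum => i.
  exact: pbounded_add (mc _ _ (pbounded_size i)) (hc 7).
apply: (@FP_prog k W G prg (ioD (out D)) xpredT N pN).
  rewrite /= noask_seqs andbT all_map; apply/allP => j _ /=.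
  by rewrite noask_seqs all_map andbT; apply/allP.
move=> a.
pose Inv (r : seq 'I_l) (m : mem T G) :=
  [/\ forall i, m (inl i) = wt (tnth a i),
      forall j i, j \notin r -> m (@ioU j i) = blank,
      forall j, m (ioD (inl j)) = if j \in r then wt (f j a) else blank,
      forall u, m (ioD (inr u)) = blank & exists s, m q = regt s].
have step j r m : j \notin r -> Inv r m ->
     exists n m', [/\ exec (P2 j) m [::] n m', n <= t2 a j & Inv (j :: r) m'].
  move=> jr [h1 h2 h3 h4 h5].
  pose Inv1 (r' : seq 'I_k) m' := forall t, m' t =
    if [pick i in r' | ioU j (inl i) == t] is Some i then wt (tnth a i) else m t.
  have step1 i r' m' : i \notin r' -> Inv1 r' m' -> exists n m'',
      [/\ exec (P1 j i) m' [::] n m'', n <= t1 a i & Inv1 (i :: r') m''].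
    move=> ir' hm'.
    have mi : m' (inl i) = wt (tnth a i).
      by rewrite hm'; case: pickP => [i' /andP [] //|_]; exact: h1.
    have md : m' (ioU j (inl i)) = blank.
      rewrite hm'; case: pickP => [i' /andP [hi' /eqP /injU []]|_]; last exact: h2.
      by move=> e; rewrite e (negbTE ir') in hi'.
    have e := @exec_Copy T G (inl i) (ioU j (inl i)) _ m' isT mi md.
    do 2 eexists; split; first exact: e.
      by [].
    move=> t; rewrite /upd; case: (t =P _) => [->|/eqP tn].
      case: pickP => [i' /andP [_ /eqP /injU [] -> //]|/(_ i)].
      by rewrite mem_head eqxx.
    rewrite hm'; congr (if _ is Some _ then _ else _); apply: eq_pick => i' /=.
    rewrite in_cons; have [->|//] := eqVneq i' i.
    by rewrite eq_sym (negbTE tn) /= !andbF.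
  have [| |n1 [m1 [e1 hn1 hm1]]] := exec_seqs step1 (index_enum_uniq 'I_k) (r := [::]) (m := m).
  - by [].
  - by move=> t; case: pickP.
  have m1o t : (forall i, ioU j (inl i) != t) -> m1 t = m t.
    by move=> ht; rewrite hm1; case: pickP => // i; rewrite (negbTE (ht i)) andbF.
  have m1i i : m1 (ioU j (inl i)) = wt (tnth a i).
    rewrite hm1; case: pickP => [i' /andP [_ /eqP /injU [] -> //]|/(_ i)].
    by rewrite catrevE mem_cat mem_rev mem_index_enum eqxx.
  have [nU [dU' [vU [rU hdU hoU]]]] := oU j a.
  have rdy : ready (M := U j) (@ioU j) q a m1.
    split=> //.
    - move=> u; rewrite m1o ?h2 // => i; by apply/eqP => /injU.
    - by have [s hs] := h5; exists s; rewrite m1o.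
  have [m2 [[e2 ho2 _ _ q2] f2]] := exec_Call (@injU j) (@injegU j) (@injesU j)
    (fun i => isT : ioU j i != q) (fun i => isT : ioU j i != w)
    (isT : q != w) rU hdU rdy I.
  have m2d : m2 (ioD (inl j)) = at_end G [::].
    by rewrite at_end_nil f2 // m1o // h3 (negbTE jr).
  have e3 := @exec_Xfer T G (ioU j (out (U j))) (ioD (inl j)) _ [::] m2 isT (ho2 _ hoU) m2d.
  rewrite cat0s in e3; set m3 := upd _ (ioD _) _ in e3.
  have e4 := exec_Rew (leqnn _) (upd_same _ (ioD (inl j)) (at_end G (f j a)) : m3 _ = _).
  do 2 eexists; split.
  - exact: exec_Seq0 e1 (exec_Seq0 e2 (exec_Seq0 e3 e4)).
  - have h := tU j _ _ _ _ rU; rewrite -!/(insize _) in h.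
    have {}hn1 : n1 <= \sum_i t1 a i + 1 by [].
    by rewrite /t2; move: (\sum_i t1 a i) hn1 => s hn1; lia.
  - rewrite /m3 upd_upd.
    set m4 := upd _ _ _.
    have m4o t : t != ioD (inl j) -> (forall i, t != ioU j i) -> t != q -> t != w ->
        m4 t = m t.
      move=> n1' n2 n3 n4; rewrite /m4 !upd_other // f2 // m1o // => i.
      by rewrite eq_sym.
    split.
    + by move=> i; rewrite m4o.
    + move=> j' i; rewrite inE negb_or => /andP [jj' jr'].
      by rewrite m4o ?h2 // => i'; exact: ioUneq.
    + move=> j'; rewrite inE; have [->|jj'] := eqVneq j' j.
        by rewrite /m4 upd_same.
      by rewrite m4o ?h3 //; apply: contraNneq jj' => /injD [].
    + by move=> u; rewrite m4o.
    + by have [s hs] := q2; exists s; rewrite /m4 !upd_other.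
have [| |n1 [m1 [e1 hn1 [h1 h2 h3 h4 h5]]]] :=
    exec_seqs step (index_enum_uniq 'I_l) (r := [::]) (m := minit a).
- by [].
- by split=> //; exists None; rewrite regt_blank.
pose b := [tuple f j a | j < l].
have [nD [dD' [vD [rD hdD hoD]]]] := hD b.
have rdyD : ready (M := D) ioD q b m1.
  split=> // j; rewrite h3 tnth_mktuple catrevE mem_cat mem_rev mem_index_enum.
  by [].
have [m6 [[e6 h6 _ _ _] _]] := exec_Call injD injegD injesD
  (fun i => isT : ioD i != q) (fun i => isT : ioD i != w) (isT : q != w) rD hdD rdyD I.
exists (n1 + nD.*2.+2), m6; split; first exact: exec_Seq0 e1 e6.
- have h := tD _ _ _ _ rD.
  have eb : (\sum_(i < l) size (tnth b i))%N = \sum_j size (f j a).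
    by apply: eq_bigr => j _; rewrite tnth_mktuple.
  rewrite eb in h.
  have {}hn1 : n1 <= \sum_j t2 a j + 1 by [].
  by rewrite /N; move: (\sum_j t2 a j) (\sum_j size (f j a)) hn1 h => s s' hn1 h; lia.
- exact: h6.
Qed.

(** * Finite transducers reading several words in parallel *)

Section Transducer.
Variables (k : nat) (S : finType) (s0 : S).
Notation letters := {ffun 'I_k -> option bool}.
Variables (delta : S -> letters -> S) (emit : S -> letters -> word).

Definition heads (u : 'I_k -> word) : letters := [ffun i => ohead (u i)].

(** There is one output more than there are letters: with [n] the maximal length, the last one
    reacts to the end of the input. A word that is exhausted earlier shows [None] meanwhile. *)
Fixpoint transduce (n : nat) (s : S) (u : 'I_k -> word) : word :=
  if n is n'.+1
  then emit s (heads u) ++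
       transduce n' (delta s (heads u)) (fun i => behead (u i))
  else emit s (heads u).

Definition maxsize (a : k.-tuple word) : nat := \max_i size (tnth a i).

Let T : finType := ('I_k + bool)%type.
Let q : T := inr true.
Let o : T := inr false.

Let letter (r : reads T S) : letters := [ffun i => bitof (r (inl i))].
Let cur (r : reads T S) : S := if r q is Some (inr s) then s else s0.
Let bound : nat := \max_s \max_l size (emit s l).

(** Writes the letter of index [j] of the current output, if any. Running it for all [j] below
    [bound] handles outputs of any length in constant time. *)
Let output j : prog T S := Do (fun r =>
  let x := emit (cur r) (letter r) in
  if j < size x then on o (bit (nth false x j), Right) r else idle r).

Let outputs : prog T S := seqs (map output (iota 0 bound)).

Let advance : prog T S := Do (fun r =>
  [ffun t => match t with
   | inl i => (r t, Right)
   | inr true => (Some (inr (delta (cur r) (letter r))), Stay)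
   | inr false => (r t, Stay)
   end]).

Let loop : prog T S :=
  While (fun r => [exists i, isbit (r (inl i))]) (Seq outputs advance).

Let prg : prog T S :=
  Seq (Setreg q (Some (inr s0))) (Seq loop (Seq outputs (Rew S o))).

Section Run.
Variable a : k.-tuple word.

Let tm (d : nat) (s : S) (v : word) : mem T S := fun t =>
  match t with
  | inl i => shift (Posz d) (wt (tnth a i))
  | inr true => regt (Some (inr s))
  | inr false => at_end S v
  end.

Let rest d i := drop d (tnth a i).

Let bit_wt w d : bitof (shift (Posz d) (wt w : rtape S) 0%R) = ohead (drop d w).
Proof.
rewrite /shift add0r; have [h|h] := ltnP d (size w).
  by rewrite wt_bit // (drop_nth false h).
by rewrite wt_out ?drop_oversize //; right.
Qed.

Let letter_tm d s v : letter (rd (tm d s v)) = heads (rest d).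
Proof. by apply/ffunP => i; rewrite !ffunE bit_wt. Qed.

Let cur_tm d s v : cur (rd (tm d s v)) = s.
Proof. by rewrite /cur ffunE. Qed.

Let exec_outputs d s v :
  exec outputs (tm d s v) [::] bound.+1 (tm d s (v ++ emit s (heads (rest d)))).
Proof.
set x := emit s (heads (rest d)).
have sx : size x <= bound.
  rewrite /bound; apply: leq_trans (leq_bigmax s).
  exact: (leq_bigmax (F := fun l => size (emit s l))).
suff main n i : exec (seqs (map output (iota i n)))
    (tm d s (v ++ take i x)) [::] n.+1 (tm d s (v ++ take (i + n) x)).
  by have := main bound 0; rewrite take0 cats0 take_oversize.
elim: n i => [|n IH] i /=; first by rewrite addn0; exact: exec_Skip.
rewrite addnS -addSn; apply: (exec_Seq0 (n := 1)) (IH i.+1).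
have := exec_Do (fun r => let x := emit (cur r) (letter r) in
  if i < size x then on o (bit (nth false x i), Right) r else idle r)
  (tm d s (v ++ take i x)).
congr exec; rewrite cur_tm letter_tm -/x /=; case: ltnP => h.
  rewrite app_on /= rput_at_end rcons_cat -take_nth //.
  by apply/funext => -[j|[]].
rewrite take_oversize // take_oversize 1?leqW //.
by apply/funext => t; rewrite /app !ffunE rput_stay.
Qed.

Let exec_advance d s v :
  exec advance (tm d s v) [::] 1 (tm d.+1 (delta s (heads (rest d))) v).
Proof.
have := exec_Do (fun r => [ffun t : T => match t with
   | inl i => (r t, Right)
   | inr true => (Some (inr (delta (cur r) (letter r))), Stay)
   | inr false => (r t, Stay)
   end]) (tm d s v).
congr exec; rewrite cur_tm letter_tm; apply/funext => t.
rewrite /app !ffunE; case: t => [i|[]].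
- by rewrite rput_self shiftD (_ : (_ + _)%R = Posz d.+1).
- by apply/funext => z; rewrite /rput /= addr0 /regt; case: eqP.
- by rewrite rput_stay.
Qed.

Let running_tm d s v :
  [exists i, isbit (rd (tm d s v) (inl i))] = (d < maxsize a).
Proof.
apply/existsP/idP => [[i]|].
  rewrite ffunE /isbit bit_wt => h; apply: leq_trans (leq_bigmax i).
  by rewrite ltnNge; apply: contra h => h; rewrite drop_oversize.
rewrite ltnNge => /negP h; apply: contrapT => hn; apply: h.
apply/bigmax_leqP => i _; rewrite leqNgt; apply/negP => hi; apply: hn; exists i.
by rewrite ffunE /isbit bit_wt (drop_nth false hi).
Qed.

(** The reaction to the end of the input is still pending when the loop stops; the program [outputs]
    placed behind the loop writes it. *)
Let exec_loop n d s v : n + d = maxsize a -> exists s' v',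
  exec loop (tm d s v) [::] (n * (bound + 3)).+1 (tm (n + d) s' v') /\
  v' ++ emit s' (heads (rest (n + d))) = v ++ transduce n s (rest d).
Proof.
elim: n d s v => [|n IH] d s v hn.
  exists s, v; split=> //; apply: exec_WhileF.
  by rewrite running_tm -hn add0n ltnn.
have [|s' [v' [e' h']]] := IH d.+1 (delta s (heads (rest d)))
  (v ++ emit s (heads (rest d))); first by rewrite addnS.
exists s', v'; split.
  have ht : [exists i, isbit (rd (tm d s v) (inl i))].
    by rewrite running_tm -hn; lia.
  have e := exec_Seq0 (exec_outputs d s v) (exec_advance d s _).
  have := @exec_WhileT _ _ _ _ _ _ _ _ _ _ _ ht e e'.
  rewrite (addSnnS n d); congr exec.
  by rewrite mulSn; move: (n * _) => x; lia.
rewrite (addSnnS n d) h' -catA /=; congr (_ ++ (_ ++ transduce _ _ _)).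
by apply/funext => i; rewrite /rest -addn1 addnC -drop_drop drop1.
Qed.

Lemma exec_transduce : exists m, exec prg (minit a) [::]
    (1 + ((maxsize a * (bound + 3)).+1 +
      (bound.+1 + ((size (transduce (maxsize a) s0 (tnth a))).*2 + 3)))) m /\
  m o = wt (transduce (maxsize a) s0 (tnth a)).
Proof.
have e1 : exec (Setreg q (Some (inr s0))) (minit a) [::] 1 (tm 0 s0 [::]).
  have := @exec_Setreg T S q (Some (inr s0)) None (minit a).
  rewrite regt_blank => /(_ erefl); congr exec; apply/funext => -[i|[]] //=.
    by rewrite shift0.
  by rewrite at_end_nil.
have [|s' [v' [e2 h]]] := @exec_loop (maxsize a) 0 s0 [::]; first by rewrite addn0.
have e3 := exec_outputs (maxsize a + 0) s' v'.
rewrite h /= in e3.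
have r0 : rest 0 = tnth a by apply/funext => i; rewrite /rest drop0.
rewrite r0 in e3; set v := transduce _ _ _ in e3 *.
have e4 := @exec_Rew T S o (size v) v _ (leqnn _)
  (erefl : tm (maxsize a + 0) s' v o = _).
exists (upd (tm (maxsize a + 0) s' v) o (wt v)); split; last exact: upd_same.
exact: exec_Seq0 e1 (exec_Seq0 e2 (exec_Seq0 e3 e4)).
Qed.

Lemma size_transduce n s u : size (transduce n s u) <= n.+1 * bound.
Proof.
have hb s' l : size (emit s' l) <= bound.
  rewrite /bound; apply: leq_trans (leq_bigmax s').
  exact: (leq_bigmax (F := fun l => size (emit s' l))).
elim: n s u => [|n IH] s u /=; first by rewrite mul1n.
by rewrite size_cat mulSn leq_add.
Qed.

End Run.

Lemma pbounded_maxsize : pbounded maxsize.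
Proof.
apply: (pbounded_le (pbounded_insize k)) => a.
by apply/bigmax_leqP => i _; exact: size_insize.
Qed.

Lemma FP_transduce : FP (fun a => transduce (maxsize a) s0 (tnth a)).
Proof.
have hm := pbounded_maxsize; have hc := pbounded_const k.
have pN := pbounded_add (pbounded_mul hm (hc (bound + 3)))
  (pbounded_add (pbounded_mul (hc 2) (pbounded_mul (pbounded_add hm (hc 1)) (hc bound)))
    (hc (bound + 6))).
apply: (@FP_prog k bool S prg o xpredT _ pN) => [|a].
  by rewrite /= /outputs noask_seqs all_map !andbT andbb; apply/allP.
have [m [e ho]] := exec_transduce a.
do 2 eexists; split; first exact: e.
  have := size_transduce (maxsize a) s0 (tnth a).
  rewrite addn1; move: (_ * bound) => x; lia.
by rewrite ho; exact: holds_wt.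
Qed.

End Transducer.

(** * Composition of polynomial-time functions *)

Lemma eq_FP k (f g : k.-tuple word -> word) : f =1 g -> FP f -> FP g.
Proof. by move=> /funext ->. Qed.

Definition FP1 (F : word -> word) : Prop :=
  FP (fun a : 1.-tuple word => F (tnth a ord0)).
Definition FP2 (F : word -> word -> word) : Prop :=
  FP (fun a : 2.-tuple word => F (tnth a (inord 0)) (tnth a (inord 1))).

Lemma FPtP F : FPt F <-> FP1 F.
Proof.
split=> -[M [h1 h2 h3]]; exists M; split=> //.
move=> x; suff -> : x = [tuple tnth x ord0] by exact: h3.
by apply: eq_from_tnth => i; rewrite (ord1 i).
Qed.

Section Compositions.
Variable k : nat.
Implicit Types f g h : k.-tuple word -> word.

Lemma FP_comp1 F f : FP1 F -> FP f -> FP (fun a => F (f a)).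
Proof.
move=> hF hf; apply: eq_FP (FP_comp hF (f := fun=> f) (fun=> hf)) => a.
by rewrite tnth_mktuple.
Qed.

Lemma FP_comp2 F f g : FP2 F -> FP f -> FP g -> FP (fun a => F (f a) (g a)).
Proof.
move=> hF hf hg.
have hfg (j : 'I_2) : FP (if val j == 0 then f else g) by case: ifP.
by apply: eq_FP (FP_comp hF hfg) => a; rewrite !tnth_mktuple /= !inordK.
Qed.

Lemma FP_comp3 (F : word -> word -> word -> word) f g h :
  FP (fun a : 3.-tuple word =>
        F (tnth a (inord 0)) (tnth a (inord 1)) (tnth a (inord 2))) ->
  FP f -> FP g -> FP h -> FP (fun a => F (f a) (g a) (h a)).
Proof.
move=> hF hf hg hh.
have hfg (j : 'I_3) :
    FP (if val j == 0 then f else if val j == 1 then g else h).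
  by case: ifP => // _; case: ifP.
by apply: eq_FP (FP_comp hF hfg) => a; rewrite !tnth_mktuple /= !inordK.
Qed.

Lemma FP_tnth (i : 'I_k) : FP (fun a : k.-tuple word => tnth a i).
Proof.
pose e (s : unit) (l : {ffun 'I_k -> option bool}) : word := seq_of_opt (l i).
apply: eq_FP (FP_transduce tt (fun _ _ => tt) e) => a.
suff main n (u : 'I_k -> word) : size (u i) <= n ->
    transduce (fun _ _ => tt) e n tt u = u i.
  by apply: main; apply: (leq_bigmax (F := fun i => size (tnth a i))).
elim: n u => [|n IH] u; rewrite /= /e ffunE.
  by rewrite leqn0 => /nilP ->.
by move=> h; rewrite IH ?size_behead; [case: (u i)|lia].
Qed.

End Compositions.

(** * Transducers and automata on one or two words *)

Section Transducer1.
Variables (S : finType) (delta : S -> bool -> S) (emit : S -> option bool -> word).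

Fixpoint tr1 (s : S) (w : word) : word :=
  if w is b :: w' then emit s (Some b) ++ tr1 (delta s b) w' else emit s None.

Lemma FP_tr1 s k (f : k.-tuple word -> word) : FP f -> FP (fun a => tr1 s (f a)).
Proof.
apply: FP_comp1.
pose d (s : S) (l : {ffun 'I_1 -> option bool}) :=
  if l ord0 is Some b then delta s b else s.
pose e (s : S) (l : {ffun 'I_1 -> option bool}) := emit s (l ord0).
apply: eq_FP (FP_transduce s d e) => a.
rewrite (_ : maxsize a = size (tnth a ord0)); last by rewrite /maxsize big_ord1.
rewrite (_ : tnth a = fun=> tnth a ord0); last by apply/funext => i; rewrite (ord1 i).
elim: (tnth a ord0) s => [|b w IH] s; first by rewrite /= /e ffunE.
by rewrite /= IH /e /d !ffunE.
Qed.

End Transducer1.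

Section Transducer2.
Variables (S : finType) (delta : S -> option bool -> option bool -> S).

Section Emit.
Variable emit : S -> option bool -> option bool -> word.

Fixpoint tr2 (n : nat) (s : S) (u v : word) : word :=
  if n is n'.+1 then emit s (ohead u) (ohead v) ++
    tr2 n' (delta s (ohead u) (ohead v)) (behead u) (behead v)
  else emit s (ohead u) (ohead v).

Lemma FP2_tr2 s : FP2 (fun u v => tr2 (maxn (size u) (size v)) s u v).
Proof.
pose d (s : S) (l : {ffun 'I_2 -> option bool}) := delta s (l (inord 0)) (l (inord 1)).
pose e (s : S) (l : {ffun 'I_2 -> option bool}) := emit s (l (inord 0)) (l (inord 1)).
apply: eq_FP (FP_transduce s d e) => a.
have -> : maxsize a = maxn (size (tnth a (inord 0))) (size (tnth a (inord 1))).
  rewrite /maxsize big_ord_recl big_ord1.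
  congr (maxn (size (tnth a _)) (size (tnth a _))); apply/val_inj;
  by rewrite /= inordK.
move: (maxn _ _) => n.
suff main u : transduce d e n s u = tr2 n s (u (inord 0)) (u (inord 1)) by exact: main.
elim: n s u => [|n IH] s u; first by rewrite /= /e !ffunE.
by rewrite /= IH /e /d !ffunE.
Qed.

End Emit.

Fixpoint run2 (s : S) (u v : word) : S :=
  if u is b :: u' then run2 (delta s (Some b) (ohead v)) u' (behead v)
  else foldl (fun s c => delta s None (Some c)) s v.

Lemma FP2_run2 (ok : S -> bool) s : FP2 (fun u v => [:: ok (run2 s u v)]).
Proof.
pose e s (x y : option bool) := if (x, y) is (None, None) then [:: ok s] else [::].
apply: eq_FP (FP2_tr2 e s) => a; move: (tnth a (inord 0)) (tnth a (inord 1)) => u v.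
elim: u v s => [|b u IH] v s; last first.
  case: v => [|c v]; last by rewrite (_ : maxn _ _ = (maxn (size u) (size v)).+1) ?maxnSS //= IH.
  by have := IH [::]; rewrite !maxn0 /= => ->.
elim: v s => [|c v IH] s //.
by have := IH (delta s None (Some c)); rewrite !max0n /= => ->.
Qed.

End Transducer2.

(** * Conditionals and decidable predicates *)

Definition PD k (P : k.-tuple word -> bool) : Prop := FP (fun a => [:: P a]).

Definition mask (t : option bool -> bool) (c u : word) : word :=
  if t (ohead c) then u else [::].

Lemma FP2_mask t : FP2 (mask t).
Proof.
(* The state records the verdict of [t] on the first letter of [c], as soon as that letter has been
   read. *)
pose d (s : option bool) (x y : option bool) :=
  if s is None then Some (t x) else s.
pose e (s : option bool) (x y : option bool) : word :=
  if odflt (t x) s then seq_of_opt y else [::].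
apply: eq_FP (FP2_tr2 d e None) => a; move: (tnth a (inord 0)) (tnth a (inord 1)) => c u.
have on n c' u' : size u' <= n -> tr2 d e n (Some true) c' u' = u'.
  elim: n c' u' => [|n IH] c' [|b u'] //= h; rewrite ?IH //.
have off n c' u' : tr2 d e n (Some false) c' u' = [::].
  by elim: n c' u' => //= n IH c' u'; rewrite IH.
rewrite /mask; case E: (maxn _ _) => [|n] /=.
  have /nilP -> : size u == 0 by rewrite -leqn0 -E leq_maxr.
  by rewrite /e /=; case: ifP.
have hu : size u <= n.+1 by rewrite -E leq_maxr.
rewrite /d /e /=; case: (t _); rewrite ?off //.
by rewrite on ?size_behead; [case: (u)|lia].
Qed.

Definition merge2 (u v : word) : word :=
  tr2 (fun _ _ _ => tt) (fun _ x y => seq_of_opt (if x is None then y else x))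
    (maxn (size u) (size v)) tt u v.

Lemma merge2s0 u : merge2 u [::] = u.
Proof.
rewrite /merge2 maxn0; elim: u => [|b u IH] //=; by rewrite IH.
Qed.

Lemma merge20s v : merge2 [::] v = v.
Proof.
rewrite /merge2 max0n; elim: v => [|b v IH] //=; by rewrite IH.
Qed.

Section Predicates.
Variable k : nat.
Implicit Types (P Q : k.-tuple word -> bool) (f g : k.-tuple word -> word).

(** Both branches are computed, the wrong one is erased by [mask], and merging with the empty word
    returns the other one. *)
Lemma FP_ifhead t f g h : FP f -> FP g -> FP h ->
  FP (fun a => if t (ohead (f a)) then g a else h a).
Proof.
move=> hf hg hh.
have h1 := FP_comp2 (FP2_mask t) hf hg.
have h2 := FP_comp2 (FP2_mask (fun x => ~~ t x)) hf hh.
apply: eq_FP (FP_comp2 (FP2_tr2 _ _ tt : FP2 merge2) h1 h2) => a.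
by rewrite /mask; case: (t _); rewrite ?merge2s0 ?merge20s.
Qed.

Lemma FP_if P f g : PD P -> FP f -> FP g -> FP (fun a => if P a then f a else g a).
Proof.
move=> hP hf hg; apply: eq_FP (FP_ifhead (fun x => x == Some true) hP hf hg) => a.
by case: (P a).
Qed.

Lemma PD_ext P Q : P =1 Q -> PD P -> PD Q.
Proof. by move=> /funext ->. Qed.

Lemma PD_if P Q R : PD P -> PD Q -> PD R -> PD (fun a => if P a then Q a else R a).
Proof.
move=> hP hQ hR; apply: eq_FP (FP_if hP hQ hR) => a; by case: ifP.
Qed.

Lemma FP_const w f : FP f -> FP (fun _ : k.-tuple word => w).
Proof.
move=> hf.
apply: eq_FP (FP_tr1 (fun (_ : unit) _ => tt)
  (fun _ x => if x is None then w else [::]) tt hf) => a.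
by elim: (f a).
Qed.

Lemma PD_const b f : FP f -> PD (fun _ : k.-tuple word => b).
Proof. exact: FP_const. Qed.

Lemma PD_and P Q : PD P -> PD Q -> PD (fun a => P a && Q a).
Proof.
move=> hP hQ; apply: PD_ext (PD_if hP hQ (PD_const false hP)) => a.
by case: (P a).
Qed.

Lemma PD_or P Q : PD P -> PD Q -> PD (fun a => P a || Q a).
Proof.
move=> hP hQ; apply: PD_ext (PD_if hP (PD_const true hP) hQ) => a.
by case: (P a).
Qed.

Lemma PD_neg P : PD P -> PD (fun a => ~~ P a).
Proof.
move=> hP; apply: PD_ext (PD_if hP (PD_const false hP) (PD_const true hP)) => a.
by case: (P a).
Qed.

Lemma PD_head b f : FP f -> PD (fun a => ohead (f a) == Some b).
Proof.
move=> hf; have h := FP_ifhead (fun x => x == Some b) hf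
  (FP_const [:: true] hf) (FP_const [:: false] hf).
by apply: eq_FP h => a; case: ifP.
Qed.

Lemma FP_behead f : FP f -> FP (fun a => behead (f a)).
Proof.
move=> hf; apply: eq_FP (FP_tr1 (fun (_ : bool) _ => true)
  (fun s x => if s then seq_of_opt x else [::]) false hf) => a.
case: (f a) => //= _; elim=> //= b w IH; by rewrite IH.
Qed.

Lemma FP_drop n f : FP f -> FP (fun a => drop n (f a)).
Proof.
move=> hf; elim: n => [|n IH]; first by apply: eq_FP hf => a; rewrite drop0.
by apply: eq_FP (FP_behead IH) => a; rewrite -drop1 drop_drop add1n.
Qed.

Lemma PD_prefix s f : FP f -> PD (fun a => prefix s (f a)).
Proof.
move=> hf; elim: s f hf => [|b s IH] f hf.
  by apply: PD_ext (PD_const true hf) => a; rewrite prefix0s.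
apply: PD_ext (PD_and (PD_head b hf) (IH _ (FP_behead hf))) => a.
by case: (f a) => [|c w] //=; rewrite [Some c == _]eq_sym.
Qed.

Lemma PD_nseq b f : FP f -> PD (fun a => f a == nseq (size (f a)) b).
Proof.
move=> hf; have h := FP_tr1 (fun s c => s && (c == b))
  (fun s x => if x is None then [:: s] else [::]) true hf.
apply: eq_FP h => a; rewrite -[X in _ = [:: X]]andTb.
elim: (f a) true => [|c w IH] s /=; first by rewrite andbT.
by rewrite IH eqseq_cons andbA.
Qed.

Lemma PD_eq f g : FP f -> FP g -> PD (fun a => f a == g a).
Proof.
move=> hf hg; have h := FP_comp2 (FP2_run2 (fun s x y => s && (x == y)) id true) hf hg.
apply: eq_FP h => a; congr cons; rewrite -[RHS]andTb.
elim: (f a) (g a) true => [|b u IH] v s /=.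
  elim: v s => [|c v IH] s /=; first by rewrite andbT.
  by rewrite IH !andbF.
case: v => [|c v] /=; rewrite IH /= ?andbF //.
by rewrite eqseq_cons andbA.
Qed.

Lemma PD_eqsize f g : FP f -> FP g -> PD (fun a => size (f a) == size (g a)).
Proof.
move=> hf hg.
have h := FP_comp2 (FP2_run2 (fun s x y => s && (isSome x == isSome y)) id true) hf hg.
apply: eq_FP h => a; congr cons; rewrite -[RHS]andTb.
elim: (f a) (g a) true => [|b u IH] v s /=.
  elim: v s => [|c v IH] s /=; first by rewrite andbT.
  by rewrite IH !andbF.
case: v => [|c v] /=; rewrite IH /= ?andbF ?andbT //.
Qed.

End Predicates.

(** * Words as binary numbers, finite orders *)

Fixpoint wval (w : word) : nat :=
  if w is b :: w' then b * 2 ^ size w' + wval w' else 0.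

Fixpoint word_of (n i : nat) : word :=
  if n is n'.+1
  then (2 ^ n' <= i) :: word_of n' (i - (2 ^ n' <= i) * 2 ^ n') else [::].

Lemma wval_lt w : wval w < 2 ^ size w.
Proof.
elim: w => //= b w IH; rewrite expnS mul2n -addnn.
by case: b; rewrite ?mul1n ?mul0n; lia.
Qed.

Lemma wval_inj u v : size u = size v -> wval u = wval v -> u = v.
Proof.
elim: u v => [|b u IH] [|c v] //= [suv]; rewrite suv.
have hu := wval_lt u; have hv := wval_lt v; rewrite suv in hu.
by case: b; case: c; rewrite ?mul1n ?mul0n => h; try (exfalso; lia);
  congr cons; apply: IH => //; lia.
Qed.

Lemma size_word_of n i : size (word_of n i) = n.
Proof. by elim: n i => //= n IH i; rewrite IH. Qed.

Lemma word_ofK n i : i < 2 ^ n -> wval (word_of n i) = i.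
Proof.
elim: n i => [|n IH] i /=; first by case: i.
rewrite expnS size_word_of => hi.
by rewrite IH; case: leqP => h; rewrite ?mul1n ?mul0n; lia.
Qed.

Lemma wval_cat u v : wval (u ++ v) = wval u * 2 ^ size v + wval v.
Proof.
elim: u => //= b u ->; rewrite size_cat expnD mulnDl addnA; congr (_ + _ + _).
by rewrite mulnA.
Qed.

Lemma wval0 n : wval (nseq n false) = 0.
Proof. by elim: n. Qed.

Lemma wval1 n : (wval (nseq n true)).+1 = 2 ^ n.
Proof. by elim: n => //= n IH; rewrite size_nseq expnS; lia. Qed.

Lemma wval_eq0 w : wval w = 0 -> w = nseq (size w) false.
Proof. by move=> h; apply: wval_inj; rewrite ?size_nseq // wval0. Qed.

Lemma wval_eq1 w : (wval w).+1 = 2 ^ size w -> w = nseq (size w) true.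
Proof.
by move=> h; apply: wval_inj; rewrite ?size_nseq //; have := wval1 (size w); lia.
Qed.

Lemma lex_leP u v : size u = size v -> lex_le u v <-> wval u <= wval v.
Proof.
rewrite /lex_le; elim: u v => [|b u IH] [|c v] //= [suv].
rewrite lexi_cons suv; have hu := wval_lt u; have hv := wval_lt v.
rewrite suv in hu; have := IH v suv.
by case: b; case: c; rewrite /= ?mul1n ?mul0n => -[h1 h2]; split=> // h;
  first [lia | by rewrite leq_add2l h1 | by apply: h2; rewrite leq_add2l in h
        | exact: h1 | exact: h2].
Qed.

Lemma lex_ltP u v : size u = size v -> lex_lt u v <-> wval u < wval v.
Proof.
move=> suv; rewrite ltn_neqAle /lex_lt lt_neqAle.
have h := lex_leP suv; rewrite /lex_le in h.
split=> /andP [h1 h2]; apply/andP; split; try exact/h.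
  by apply: contraNneq h1 => /(wval_inj suv) ->.
by apply: contraNneq h1 => ->.
Qed.

(* State [None]: equal so far; [Some true]: [u] has branched to the left of
   [v], whence [u] must continue with 1s and [v] with 0s. *)
Definition lsucc_step (s : option bool) (x y : option bool) : option bool :=
  match s, x, y with
  | None, Some b, Some c =>
      if b == c then None else Some c
  | Some true, Some true, Some false => Some true
  | _, _, _ => Some false
  end.

Definition lsucc (u v : word) : bool := run2 lsucc_step None u v == Some true.

Lemma lsuccP u v :
  lsucc u v <-> size u = size v /\ wval v = (wval u).+1.
Proof.
have dead u' v' : run2 lsucc_step (Some false) u' v' = Some false.
  elim: u' v' => [|b u' IH] v' /=; first by elim: v'.
  by rewrite IH.
have carry u' v' : run2 lsucc_step (Some true) u' v' = Some true <->
    [/\ size u' = size v', (wval u').+1 = 2 ^ size u' & wval v' = 0].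
  elim: u' v' => [|b u' IH] [|c v'] //=.
  - split; last by case.
    by have -> : foldl (fun s c => lsucc_step s None (Some c)) (Some false) v' =
      Some false by elim: v'.
  - by case: b; rewrite dead; split=> //; case.
  - have hu := wval_lt u'; have hv := wval_lt v'; have h0 := expn_gt0 2 (size v').
    case: b; case: c => /=; rewrite ?dead ?IH; split=> // -[]; rewrite ?expnS;
    by (try (move=> h1 h2 h3; exfalso; lia)); move=> h1 h2 h3; split; lia.
rewrite /lsucc; elim: u v => [|b u IH] [|c v] //=.
- by split=> // -[].
- have -> : foldl (fun s c => lsucc_step s None (Some c)) (Some false) v =
      Some false by elim: v.
  by split=> // -[].
- by rewrite dead; split=> // -[].
have hu := wval_lt u; have hv := wval_lt v.
case: b; case: c => /=; rewrite ?dead ?IH ?mul1n ?mul0n.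
- by split=> [[h]|[[h]]]; rewrite h => ?; split; lia.
- by split=> // -[[h] h']; exfalso; move: h' hu hv; rewrite h; lia.
- split=> [/eqP/carry [h]|[[h] h']].
    by move: hu hv; rewrite h => *; split; lia.
  by apply/eqP/carry; move: h' hu hv; rewrite h => *; split; lia.
- by split=> [[h]|[[h]]]; rewrite h => ?; split; lia.
Qed.

Lemma lex_succP u v : lex_succ u v <-> lsucc u v.
Proof.
rewrite lsuccP; split=> [[suv huv hn]|[suv huv]].
  split=> //; move/(lex_ltP suv): huv => huv.
  apply/eqP; rewrite eqn_leq huv andbT leqNgt; apply/negP => h.
  have hi : (wval u).+1 < 2 ^ size u by have := wval_lt v; rewrite suv; lia.
  apply: (hn (word_of (size u) (wval u).+1)); first exact: size_word_of.
  by split; apply/lex_ltP; rewrite ?size_word_of // word_ofK.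
split=> //; first by apply/lex_ltP; rewrite // huv.
move=> c hc [/(lex_ltP (esym hc)) h1 /lex_ltP h2].
by have := h2 (etrans hc suv); lia.
Qed.

Lemma PD_lsucc k (f g : k.-tuple word -> word) :
  FP f -> FP g -> PD (fun a => lsucc (f a) (g a)).
Proof. exact: FP_comp2 (FP2_run2 _ _ _). Qed.

Lemma lsucc_prefix (c u v : word) : lsucc (c ++ u) (c ++ v) = lsucc u v.
Proof.
apply/idP/idP => /lsuccP [suv h]; apply/lsuccP.
  rewrite !size_cat in suv; rewrite !wval_cat in h.
  have {}suv : size u = size v by lia.
  by split=> //; rewrite suv in h; lia.
by rewrite !size_cat !wval_cat suv h; split=> //; lia.
Qed.

(** Division by [N]: if consecutive numbers have different quotients, the remainder wraps around
    from [N - 1] to 0. *)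
Lemma carry_out (N x y a b : nat) : a < N -> b < N -> x <> y ->
  y * N + b = (x * N + a).+1 -> a.+1 = N /\ b = 0.
Proof.
move=> ha hb xy h; have [lt_xy|] := ltnP x y.
  have := leq_mul lt_xy (leqnn N); rewrite mulSn; split; lia.
rewrite leq_eqVlt => /orP [/eqP yx|lt_yx]; first by case: xy.
by have := leq_mul lt_yx (leqnn N); rewrite mulSn; split; lia.
Qed.

Lemma split_cat (c a v : word) : size v = size (c ++ a) ->
  exists2 c', size c' = size c & exists2 a', size a' = size a & v = c' ++ a'.
Proof.
rewrite size_cat => h; exists (take (size c) v).
  by rewrite size_takel // h leq_addr.
exists (drop (size c) v); last by rewrite cat_take_drop.
by rewrite size_drop h addKn.
Qed.

(** The words of a given length with prefix [c] form a lexicographic interval, which can be left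
    only from its last word. Dually, [lsucc_blockr]: it can be entered only at its first one. *)
Lemma lsucc_blockl (c a v : word) : size v = size (c ++ a) -> ~~ prefix c v ->
  lsucc (c ++ a) v <-> a = nseq (size a) true /\ lsucc (c ++ nseq (size a) true) v.
Proof.
move=> /split_cat [c' sc [b sb ->]]; rewrite prefixE take_size_cat // => cc'.
split=> [h|[<- //]]; suff ea : a = nseq (size a) true by rewrite -ea.
move/lsuccP: h; rewrite !wval_cat sb => -[_ h]; apply: wval_eq1.
have := wval_lt b; rewrite sb => hb.
apply: (proj1 (carry_out (wval_lt a) hb _ h)) => e.
by move: cc'; rewrite (wval_inj (esym sc) e) eqxx.
Qed.

Lemma lsucc_blockr (c a v : word) : size v = size (c ++ a) -> ~~ prefix c v ->
  lsucc v (c ++ a) <->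
  a = nseq (size a) false /\ lsucc v (c ++ nseq (size a) false).
Proof.
move=> /split_cat [c' sc [b sb ->]]; rewrite prefixE take_size_cat // => cc'.
split=> [h|[<- //]]; suff ea : a = nseq (size a) false by rewrite -ea.
move/lsuccP: h; rewrite !wval_cat sb => -[_ h]; apply: wval_eq0.
have := wval_lt b; rewrite sb => hb.
apply: (proj2 (carry_out hb (wval_lt a) _ h)) => e.
by move: cc'; rewrite (wval_inj sc e) eqxx.
Qed.

(** * Total orders on the words of one length *)

Section OrderIso.
Variables (n : nat) (O : rel word).
Hypotheses (O_total : forall x y, size x = n -> size y = n -> O x y || O y x)
  (O_anti : forall x y, size x = n -> size y = n -> O x y -> O y x -> x = y)
  (O_trans : forall x y z, size x = n -> size y = n -> size z = n ->
     O x y -> O y z -> O x z).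

Definition rank (y : word) : nat :=
  #|[set t : n.-tuple bool | O t y && (tval t != y)]%SET|.

Lemma rank_lt y z :
  size y = n -> size z = n -> O y z -> y <> z -> rank y < rank z.
Proof.
move=> hy hz yz nyz; apply/proper_card/properP; split.
  apply/fintype.subsetP => t; rewrite !inE => /andP [ty nty].
  rewrite (O_trans _ hy hz ty yz) ?size_tuple //=.
  apply: contraNneq nty => tz; apply/eqP; apply: O_anti; rewrite ?size_tuple //.
  by rewrite tz.
have ey : size y == n by apply/eqP.
exists (Tuple ey); rewrite inE /= ?eqxx ?andbF // yz.
by apply/eqP.
Qed.

Lemma rank_le y z : size y = n -> size z = n -> O y z <-> rank y <= rank z.
Proof.
move=> hy hz; split=> [yz|h].
  by have [->|/eqP nyz] := eqVneq y z; last exact: ltnW (rank_lt _ _ yz nyz).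
have [->|/eqP nyz] := eqVneq y z; first by have := O_total hz hz; rewrite orbb.
have /orP [//|zy] := O_total hy hz.
by have := rank_lt hz hy zy (nesym nyz); rewrite ltnNge h.
Qed.

Lemma rank_bound y : size y = n -> rank y < 2 ^ n.
Proof.
move=> hy; have -> : 2 ^ n = #|[set: n.-tuple bool]%SET|.
  by rewrite cardsT card_tuple card_bool.
have ey : size y == n by apply/eqP.
apply/proper_card/properP; split; first exact: finset.subsetT.
by exists (Tuple ey); rewrite ?inE //= eqxx andbF.
Qed.

(** [h] writes in binary the number of strict predecessors. It yields the bijections required by
    CLU#P, and it lets arguments about a finite order be replaced by arithmetic on ranks. *)
Lemma order_iso : exists h : word -> word,
  [/\ set_bij (words n) (words n) h,
     forall y z, size y = n -> size z = n -> O y z <-> lex_le (h y) (h z),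
     forall y z, size y = n -> size z = n ->
       (lsucc (h y) (h z) <-> [/\ O y z, y <> z &
         forall w, size w = n -> O y w -> O w z -> w = y \/ w = z]) &
     (forall y, size y = n -> (forall z, size z = n -> O y z) -> h y = nseq n false) /\
     (forall y, size y = n -> (forall z, size z = n -> O z y) -> h y = nseq n true)].
Proof.
pose h y := word_of n (rank y); exists h.
have sh y : size (h y) = n by exact: size_word_of.
have vh y : size y = n -> wval (h y) = rank y by move=> /rank_bound /word_ofK.
have hO y z : size y = n -> size z = n -> O y z <-> wval (h y) <= wval (h z).
  by move=> hy hz; rewrite !vh //; exact: rank_le.
have hinj y z : size y = n -> size z = n -> h y = h z -> y = z.
  move=> hy hz e; apply: O_anti => //; apply/hO => //; by rewrite e.
have hbij : set_bij (words n) (words n) h.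
  split=> [y hy /=|y z /set_mem hy /set_mem hz|z hz]; first exact: sh.
    exact: hinj.
  have sht (t : n.-tuple bool) : size (h t) == n by rewrite sh.
  pose ht (t : n.-tuple bool) : n.-tuple bool := Tuple (sht t).
  have injt : injective ht.
    move=> t t' /(congr1 val) /= e; apply/val_inj; apply: hinj; rewrite ?size_tuple //.
  have [g gK Kg] := injF_bij injt.
  have ez : size z == n by apply/eqP.
  exists (g (Tuple ez)); first exact: size_tuple.
  by have /(congr1 val) := Kg (Tuple ez).
have surj z : size z = n -> exists2 y, size y = n & h y = z by case: hbij => _ _; apply.
split=> //.
- by move=> y z hy hz; rewrite hO // lex_leP ?sh.
- move=> y z hy hz; rewrite lsuccP !sh; split=> [[_ e]|[yz nyz hn]].
    split.
    + by apply/hO => //; rewrite e.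
    + by move=> yz; move: e; rewrite yz; lia.
    + move=> w hw /hO h1 /hO h2; move: (h1 hy hw) (h2 hw hz).
      rewrite e leq_eqVlt => /orP [/eqP/wval_inj wy _|h3 h4].
        by left; apply: hinj => //; rewrite wy ?sh.
      by right; apply: hinj => //; apply: wval_inj; rewrite ?sh // e; lia.
  have h1 : wval (h y) < wval (h z).
    rewrite ltn_neqAle; apply/andP; split; last exact/hO.
    by apply/eqP => /wval_inj e; apply: nyz; apply: hinj => //; apply: e; rewrite !sh.
  split=> //; apply/eqP; rewrite eqn_leq h1 andbT leqNgt; apply/negP => h2.
  have hb : (wval (h y)).+1 < 2 ^ n by have := wval_lt (h z); rewrite sh; lia.
  have [w hw ew] := surj (word_of n (wval (h y)).+1) (size_word_of _ _).
  have vw : wval (h w) = (wval (h y)).+1 by rewrite ew word_ofK.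
  have [| |e|e] := hn w hw; rewrite ?hO //; try lia.
    by rewrite e in vw; lia.
  by rewrite e in vw; lia.
- split=> y hy hmin.
    have [z hz ez] := surj (nseq n false) (size_nseq _ _).
    have := hmin z hz; rewrite hO // ez wval0 leqn0 => /eqP/wval_eq0.
    by rewrite sh.
  have [z hz ez] := surj (nseq n true) (size_nseq _ _).
  have := hmin z hz; rewrite hO // ez => hle.
  have := wval_lt (h y); have := wval1 n; rewrite sh => h1 h2.
  have := @wval_eq1 (h y); rewrite sh; apply; lia.
Qed.

End OrderIso.

(** * Orders by length, then by a permuted lexicographic key *)

Section KeyOrder.
Variables K K' : word -> word.
Hypotheses (KK' : cancel K K') (K'K : cancel K' K).
Hypothesis sK : forall u, size (K u) = size u.

Definition key_order : rel word := fun u v =>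
  (size u < size v) || (size u == size v) && (wval (K u) <= wval (K v)).

Let sK' u : size (K' u) = size u.
Proof. by rewrite -[in RHS](K'K u) sK. Qed.

Lemma key_order_total : total_order key_order.
Proof.
rewrite /key_order; split=> [u|u v|v u w|u v].
- by rewrite eqxx leqnn orbT.
- move=> /andP [h1 h2]; apply: (can_inj KK'); apply: wval_inj; rewrite ?sK; lia.
- by move=> h1 h2; lia.
- by lia.
Qed.

Lemma key_order_length : length_respecting key_order.
Proof.
move=> u v h; split; first by rewrite /key_order h.
by move=> e; rewrite e ltnn in h.
Qed.

Lemma key_ltP u v : order_lt key_order u v <->
  size u < size v \/ size u = size v /\ wval (K u) < wval (K v).
Proof.
rewrite /order_lt /key_order; split=> [[h nuv]|[h|[h1 h2]]].
- case/orP: h => [->|/andP [/eqP h1 h2]]; first by left.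
  right; split=> //; rewrite ltn_neqAle h2 andbT.
  apply/eqP => /wval_inj e; apply: nuv; apply: (can_inj KK'); apply: e.
  by rewrite !sK.
- by split=> [|e]; [rewrite h|rewrite e ltnn in h].
- by split=> [|e]; [rewrite h1 eqxx (ltnW h2) orbT|rewrite e ltnn in h2].
Qed.

(** The second case is the passage from the last word of one length to the first word of the
    next. *)
Lemma key_adjacentP u v : adjacent key_order u v <->
  lsucc (K u) (K v) \/
  [/\ size v = (size u).+1, K u = nseq (size u) true & K v = nseq (size v) false].
Proof.
have hu := wval_lt (K u); have hv := wval_lt (K v); rewrite !sK in hu hv.
split.
  move=> [/key_ltP huv hn].
  have {}hn z : (size u < size z \/ size u = size z /\ wval (K u) < wval (K z)) ->
      (size z < size v \/ size z = size v /\ wval (K z) < wval (K v)) -> False.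
    by move=> h1 h2; apply: (hn z); split; exact/key_ltP.
  case: huv => [lt_uv|[suv lt_uv]]; last first.
    left; apply/lsuccP; rewrite !sK; split=> //; apply/eqP.
    rewrite eqn_leq lt_uv andbT leqNgt; apply/negP => h.
    have hi : (wval (K u)).+1 < 2 ^ size u by rewrite suv; lia.
    apply: (hn (K' (word_of (size u) (wval (K u)).+1)));
      rewrite sK' size_word_of K'K word_ofK //; right; split=> //.
  right; have svu : size v = (size u).+1.
    apply/eqP; rewrite eqn_leq lt_uv andbT leqNgt; apply/negP => h.
    by apply: (hn (nseq (size u).+1 true)); rewrite size_nseq; left.
  split=> //.
    have := @wval_eq1 (K u); rewrite sK; apply; apply/eqP.
    rewrite eqn_leq hu leqNgt; apply/negP => h.
    apply: (hn (K' (nseq (size u) true))); rewrite sK' size_nseq.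
      right; split=> //; rewrite K'K; have := wval1 (size u); lia.
    by left.
  have := @wval_eq0 (K v); rewrite sK; apply; apply/eqP.
  rewrite -leqn0 leqNgt; apply/negP => h.
  apply: (hn (K' (nseq (size v) false))); rewrite sK' size_nseq; first by left.
  by right; split=> //; rewrite K'K wval0.
case=> [/lsuccP|[svu eu ev]].
  rewrite !sK => -[suv e]; split; first by apply/key_ltP; right; rewrite e.
  by move=> z [/key_ltP h1 /key_ltP h2]; lia.
split; first by apply/key_ltP; left; rewrite svu.
move=> z [/key_ltP h1 /key_ltP h2].
rewrite eu in h1; rewrite ev wval0 in h2.
have := wval1 (size u); have := wval_lt (K z); rewrite sK => h3 h4.
case: h1 => [h1|[h1 h5]]; first by lia.
by move: h3; rewrite -h1 -h4; lia.
Qed.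

End KeyOrder.

(** Each element of the interval other than [l] has its predecessor in the interval, and the two are
    linked by a cluster step. Induction on the rank then connects every element to [l]. *)
Lemma interval_cluster (A : rel word) (M : machine 1) x n (C : set word) l u :
  total_order A -> length_respecting A ->
  paths M [tuple x] = words n -> acc M [tuple x] = C ->
  size l = n -> C l ->
  (forall w, C w <-> [/\ size w = n, A l w & A w u]) ->
  cluster A M x C.
Proof.
move=> [Ar Aa At Ato] Al hp ha sl Cl hC; right; exists l.
have O_total x' y : size x' = n -> size y = n -> A x' y || A y x' by move=> *; exact: Ato.
have O_anti x' y : size x' = n -> size y = n -> A x' y -> A y x' -> x' = y.
  by move=> _ _ h1 h2; apply: Aa; rewrite h1 h2.
have O_trans x' y z : size x' = n -> size y = n -> size z = n ->
    A x' y -> A y z -> A x' z by move=> _ _ _; exact: At.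
have [h [hb hle hs _]] := order_iso O_total O_anti O_trans.
have acc_equiv y z : cluster_equiv A M x y z -> (C y <-> C z).
  rewrite -ha /cluster_equiv; elim=> // {y z}.
  - by move=> y z [].
  - by move=> y z _ ->.
  - by move=> y z w _ -> _ ->.
have sC w : C w -> size w = n by move/hC => [].
split; rewrite ?ha ?hp //.
apply/seteqP; split=> z /=; last by move/acc_equiv <-.
move=> Cz; have [m] := ubnP (wval (h z)); elim: m => // m IH in z Cz *.
rewrite ltnS => hm.
have [->|/eqP nlz] := eqVneq z l; first exact: rst_refl.
have [sz lz zu] := (hC z).1 Cz.
have hz0 : wval (h l) < wval (h z).
  have hbij := hb; case: hbij => hf hi _.
  have shl : size (h l) = n by exact: (hf l).
  have shz : size (h z) = n by exact: (hf z).
  have := (hle l z sl sz).1 lz; rewrite lex_leP ?shl ?shz // leq_eqVlt.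
  case/orP=> // /eqP/wval_inj e; case: nlz; apply: (hi) => //.
  - exact: mem_set.
  - exact: mem_set.
  - by rewrite e // shl shz.
have [y sy ey] : exists2 y, size y = n & h y = word_of n (wval (h z)).-1.
  by case: hb => _ _ hsur; apply: hsur; exact: size_word_of.
have shz : size (h z) = n by case: hb => hf _ _; exact: (hf z).
have shy : size (h y) = n by case: hb => hf _ _; exact: (hf y).
have shl : size (h l) = n by case: hb => hf _ _; exact: (hf l).
have vy : wval (h y) = (wval (h z)).-1.
  by rewrite ey word_ofK //; have := wval_lt (h z); rewrite shz; lia.
have yz : lsucc (h y) (h z) by apply/lsuccP; rewrite shy shz vy; split=> //; lia.
have [Ayz nyz hbt] := (hs y z sy sz).1 yz.
have Cy : C y.
  apply/hC; split=> //; last exact: At zu.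
  by apply/(hle l y sl sy)/lex_leP; rewrite ?shl ?shy // vy; lia.
have ly : cluster_equiv A M x l y by apply: IH => //; lia.
apply: rst_trans ly _; apply: rst_step; split; rewrite ?hp ?ha //=.
left; split=> // w [[yw nyw] [wz nwz]].
(* Adjacency refers to all strings, but as [A] respects lengths, a string between two words of
   length [n] has length [n] as well. *)
have sw : size w = n.
  apply/eqP; rewrite eqn_leq; apply/andP; split; rewrite leqNgt; apply/negP => hw.
  - have [h1 h2] : order_lt A z w by apply: Al; rewrite sz.
    by apply: h2; apply: Aa; rewrite h1.
  - have [h1 h2] : order_lt A w y by apply: Al; rewrite sy.
    by apply: h2; apply: Aa; rewrite h1.
by case: (hbt w sw yw wz) => e; [case: nyw|case: nwz].
Qed.

(** * From CLU#P to CL#P *)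

(** Each letter is announced by a 1, and the end mark is 01. The mark contains both bits, so no
    constant word starts with a code. *)
Fixpoint code (x : word) : word :=
  if x is b :: x' then true :: b :: code x' else [:: false; true].

Fixpoint decode (u : word) : option (word * word) :=
  match u with
  | true :: b :: u' => omap (fun p => (b :: p.1, p.2)) (decode u')
  | false :: true :: u' => Some ([::], u')
  | _ => None
  end.

Lemma codeK x y : decode (code x ++ y) = Some (x, y).
Proof. by elim: x => //= b x ->. Qed.

Lemma decodeP u x y : decode u = Some (x, y) -> u = code x ++ y.
Proof.
have [n] := ubnP (size u); elim: n => // n IH in u x *.
case: u => [|[] [|b u]] //=.
  rewrite ltnS => hu; case E: (decode u) => [[x' y']|] //= [<- ey].
  by rewrite (IH u x') ?E ?ey //; lia.
by case: b => //= _ [<- ->].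
Qed.

Lemma size_code x : size (code x) = (2 * size x).+2.
Proof. by elim: x => //= b x ->; lia. Qed.

(* States of the left-to-right parsers: [Some (false, false)] between two
   letters of the code, [Some (true, b)] after the first bit [b] of a letter,
   [Some (false, true)] behind the code, and [None] after an error. *)
Definition dec_step (s : option (bool * bool)) (c : bool) : option (bool * bool) :=
  match s with
  | Some (false, false) => Some (true, c)
  | Some (true, true) => Some (false, false)
  | Some (true, false) => if c then Some (false, true) else None
  | _ => s
  end.

Definition dec0 : option (bool * bool) := Some (false, false).
Definition dec1 : option (bool * bool) := Some (false, true).

Definition emit_fst (s : option (bool * bool)) (x : option bool) : word :=
  if s == Some (true, true) then seq_of_opt x else [::].

Definition emit_snd (s : option (bool * bool)) (x : option bool) : word :=
  if s == dec1 then seq_of_opt x else [::].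

Definition emit_fill b (s : option (bool * bool)) (x : option bool) : word :=
  if x is Some c then [:: if s == dec1 then b else c] else [::].

(** Projections of [decode] computed in one pass. [cfill] turns a word into the lexicographically
    first or last word of its block. *)
Definition cfst : word -> word := tr1 dec_step emit_fst dec0.
Definition csnd : word -> word := tr1 dec_step emit_snd dec0.
Definition cfill b : word -> word := tr1 dec_step (emit_fill b) dec0.

Lemma cfst_code x y : cfst (code x ++ y) = x.
Proof.
rewrite /cfst; elim: x => [|b x IH] /=; last by rewrite IH.
by elim: y => //= b y ->.
Qed.

Lemma csnd_code x y : csnd (code x ++ y) = y.
Proof.
rewrite /csnd; elim: x => [|b x IH] /=; last by rewrite IH.
by elim: y => //= b y ->.
Qed.

Lemma cfill_code b x y : cfill b (code x ++ y) = code x ++ nseq (size y) b.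
Proof.
rewrite /cfill; elim: x => [|c x IH] /=; last by rewrite IH.
by congr [:: _, _ & _]; elim: y => //= c y ->.
Qed.

Lemma PD_decode k (f : k.-tuple word -> word) :
  FP f -> PD (fun a => decode (f a) != None).
Proof.
move=> hf; have h := FP_tr1 dec_step
  (fun s x => if x is None then [:: s == dec1] else [::]) dec0 hf.
apply: eq_FP h => a; move: (f a) => u.
have done1 w : tr1 dec_step
  (fun s x => if x is None then [:: s == dec1] else [::]) dec1 w = [:: true].
  by elim: w.
have dead w : tr1 dec_step
  (fun s x => if x is None then [:: s == dec1] else [::]) None w = [:: false].
  by elim: w.
have [n] := ubnP (size u); elim: n => // n IH in u *.
case: u => [|[] [|b u]] //=.
  by rewrite ltnS => hu; rewrite IH; [case: (decode u)|lia].
by case: b; rewrite /= ?done1 ?dead.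
Qed.

Lemma set_bij_inv (W : set word) (h : word -> word) : set_bij W W h ->
  exists g, forall y, W y -> [/\ W (h y), W (g y), h (g y) = y & g (h y) = y].
Proof.
move=> [hf hi hs].
have {}hs y : exists z, W y -> W z /\ h z = y.
  have [/hs [z hz e]|hy] := pselect (W y); first by exists z.
  by exists [::].
have [g hg] := choice hs; exists g => y hy.
have Why := hf _ hy; have [Wg hge] := hg y hy; have [Wgh hgh] := hg _ Why.
by split=> //; apply: hi => //; exact: mem_set.
Qed.

(** * Permutations acting on the blocks *)

Section Blocks.
Variable n : word -> nat.
Implicit Types h g : word -> word -> word.

Definition on_blocks h (u : word) : word :=
  if decode u is Some (x, y) then
    if size y == n x then code x ++ h x y else u
  else u.

Definition valid (u : word) : bool :=
  if decode u is Some (x, y) then size y == n x else false.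

Lemma validP u : reflect (exists x y, u = code x ++ y /\ size y = n x) (valid u).
Proof.
rewrite /valid; case E: (decode u) => [[x y]|].
  apply: (iffP eqP) => [h|[x' [y' [eu h]]]]; first by exists x, y; rewrite (decodeP E).
  by move: E; rewrite eu codeK => -[<- <-].
by constructor => -[x [y [eu _]]]; rewrite eu codeK in E.
Qed.

Lemma on_blocks_code h x y : size y = n x -> on_blocks h (code x ++ y) = code x ++ h x y.
Proof. by move=> hy; rewrite /on_blocks codeK hy eqxx. Qed.

Lemma on_blocks_invalid h u : ~~ valid u -> on_blocks h u = u.
Proof.
by rewrite /on_blocks /valid; case: (decode u) => [[x y]|] // /negbTE ->.
Qed.

Lemma on_blocksK h g :
  (forall x y, size y = n x -> size (h x y) = n x) ->
  (forall x y, size y = n x -> g x (h x y) = y) ->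
  cancel (on_blocks h) (on_blocks g).
Proof.
move=> sh gh u; have [/validP [x [y [-> hy]]]|hu] := boolP (valid u).
  by rewrite on_blocks_code // on_blocks_code ?sh // gh.
by rewrite !(on_blocks_invalid _ hu).
Qed.

Lemma size_on_blocks h u :
  (forall x y, size y = n x -> size (h x y) = n x) ->
  size (on_blocks h u) = size u.
Proof.
move=> sh; have [/validP [x [y [-> hy]]]|hu] := boolP (valid u).
  by rewrite on_blocks_code // !size_cat sh ?hy.
by rewrite on_blocks_invalid.
Qed.

Lemma valid_on_blocks h u :
  (forall x y, size y = n x -> size (h x y) = n x) ->
  valid (on_blocks h u) = valid u.
Proof.
move=> sh; have [/validP [x [y [-> hy]]]|hu] := boolP (valid u).
  rewrite on_blocks_code //; apply/validP; exists x, (h x y); by rewrite sh.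
by rewrite on_blocks_invalid // (negbTE hu).
Qed.

(** Hence the permutation fixes the first and the last word of each length, and passing from one
    length to the next involves no block. *)
Lemma valid_nseq b m : valid (nseq m b) = false.
Proof.
apply/validP => -[x [y [e _]]].
have : forall c, c \in code x -> c = b.
  move=> c hc; have : c \in nseq m b by rewrite e mem_cat hc.
  by rewrite mem_nseq => /andP [_ /eqP].
move=> h; have h1 : true = b by apply: h; elim: (x) => //= *; rewrite !inE ?eqxx.
have : false \in code x by elim: (x) => //= c z IH; rewrite !inE IH !orbT.
by move/h; rewrite -h1.
Qed.

Lemma prefix_code_valid x y v : size y = n x -> size v = size (code x ++ y) ->
  prefix (code x) v -> exists2 y', size y' = n x & v = code x ++ y'.
Proof.
move=> hy + /prefixP [y' ev]; rewrite ev !size_cat hy => /addnI h.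
by exists y'.
Qed.

End Blocks.

Lemma code_inj x x' y y' : code x ++ y = code x' ++ y' -> x = x' /\ y = y'.
Proof. by move/(congr1 decode); rewrite !codeK => -[-> ->]. Qed.

(** Provides the clocks of the two new balanced machines, whose paths have lengths of this form. *)
Lemma FP_unary k (f g : k.-tuple word -> word) a b c d : FP f -> FP g ->
  FP (fun args => nseq (a * size (f args) + b * size (g args) + c) d).
Proof.
move=> hf hg.
pose e (s : unit) (x y : option bool) :=
  nseq (isSome x * a + isSome y * b + ~~ (isSome x || isSome y) * c) d.
apply: eq_FP (FP_comp2 (FP2_tr2 (fun _ _ _ => tt) e tt) hf hg) => args.
move: (f args) (g args) => u v.
suff sz : size (tr2 (fun _ _ _ => tt) e (maxn (size u) (size v)) tt u v) =
    a * size u + b * size v + c.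
  rewrite -sz; apply/all_pred1P; move: (maxn _ _) => n.
  by elim: n u v {sz} => [|n IH] u v; rewrite /= ?all_cat ?IH all_pred1_nseq.
elim: u v => [|x u IH] v; last first.
  case: v => [|y v].
    by have := IH [::]; rewrite !maxn0 /= size_cat size_nseq /= => ->; lia.
  rewrite (_ : maxn _ _ = (maxn (size u) (size v)).+1) ?maxnSS //=.
  by rewrite size_cat IH size_nseq /=; lia.
elim: v => [|y v IH]; first by rewrite /= size_nseq /=; lia.
by move: IH; rewrite !max0n /= size_cat size_nseq /= => ->; lia.
Qed.

Lemma PD_pred3 (R : word -> word -> word -> Prop) k (f g h : k.-tuple word -> word) :
  ptime_pred3 R -> FP f -> FP g -> FP h -> PD (fun a => `[< R (f a) (g a) (h a) >]).
Proof.
move=> /FP_dec hR; exact: (@FP_comp3 _ (fun x y z => [:: `[< R x y z >]])).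
Qed.

Lemma PD_imp k (P Q : k.-tuple word -> bool) : PD P -> PD Q -> PD (fun a => P a ==> Q a).
Proof.
move=> hP hQ; apply: PD_ext (PD_or (PD_neg hP) hQ) => a.
by case: (P a).
Qed.

(** * Adjacency in the blockwise order *)

Section Blockwise.
Variables (n : word -> nat) (h g : word -> word -> word) (b t : word -> word).
Variable prec : word -> word -> word -> Prop.
Hypothesis sh : forall x y, size y = n x -> size (h x y) = n x.
Hypothesis sg : forall x y, size y = n x -> size (g x y) = n x.
Hypothesis gh : forall x y, size y = n x -> g x (h x y) = y.
Hypothesis hg : forall x y, size y = n x -> h x (g x y) = y.
Hypothesis sb : forall x, size (b x) = n x.
Hypothesis st : forall x, size (t x) = n x.
Hypothesis hb : forall x, h x (b x) = nseq (n x) false.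
Hypothesis ht : forall x, h x (t x) = nseq (n x) true.
Hypothesis hprec : forall x y z, size y = n x -> size z = n x ->
  (prec x y z <-> lex_succ (h x y) (h x z)).

(** The required length [n x] is read off [b x], which has this length. *)
Definition bw_valid (u : word) : bool :=
  (decode u != None) && (size (csnd u) == size (b (cfst u))).

(** Within one block, [prec] decides. Between blocks, [u] must be the last of its block, where the
    key ends in 1s, and [v] the first of its own, where the key ends in 0s; [cfill] writes down
    these keys without any access to [h]. *)
Definition bw_same (u v : word) : bool :=
  if bw_valid u && bw_valid v && (cfst u == cfst v)
  then `[< prec (cfst u) (csnd u) (csnd v) >]
  else [&& bw_valid u ==> (csnd u == t (cfst u)),
           bw_valid v ==> (csnd v == b (cfst v)) &
           lsucc (if bw_valid u then cfill true u else u)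
                 (if bw_valid v then cfill false v else v)].

(** The last conjunct excludes an empty [v], which [behead] does not shorten. *)
Definition bw_next (u v : word) : bool :=
  [&& u == nseq (size u) true, v == nseq (size v) false,
      size (behead v) == size u & ohead v == Some false].

Definition bw_adjacent (u v : word) : bool :=
  (size u == size v) && bw_same u v || bw_next u v.

Definition bw_order : rel word := key_order (on_blocks n h).

Lemma bw_validE u : bw_valid u = valid n u.
Proof.
rewrite /bw_valid; apply/andP/validP => [[]|[x [y [-> hy]]]].
  case E: (decode u) => [[x y]|] // _; rewrite (decodeP E) cfst_code csnd_code sb.
  by move/eqP => hy; exists x, y.
by rewrite codeK cfst_code csnd_code hy sb.
Qed.

Lemma bw_cancel : cancel (on_blocks n h) (on_blocks n g).
Proof. exact: on_blocksK. Qed.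

Lemma bw_cancel' : cancel (on_blocks n g) (on_blocks n h).
Proof. exact: on_blocksK. Qed.

Lemma size_bw u : size (on_blocks n h u) = size u.
Proof. exact: size_on_blocks. Qed.

Lemma bw_top x y : size y = n x -> h x y = nseq (n x) true <-> y = t x.
Proof.
move=> hy; split=> [e|->]; last exact: ht.
by rewrite -(gh hy) e -ht gh.
Qed.

Lemma bw_bot x y : size y = n x -> h x y = nseq (n x) false <-> y = b x.
Proof.
move=> hy; split=> [e|->]; last exact: hb.
by rewrite -(gh hy) e -hb gh.
Qed.

Lemma bw_leave x y v : size y = n x -> size v = size (code x ++ y) ->
  ~~ prefix (code x) v ->
  lsucc (code x ++ h x y) v <-> y = t x /\ lsucc (cfill true (code x ++ y)) v.
Proof.
move=> hy sv pv; rewrite lsucc_blockl // ?sh ?bw_top //; last first.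
  by rewrite sv !size_cat sh ?hy.
by rewrite cfill_code hy.
Qed.

Lemma bw_enter x y v : size y = n x -> size v = size (code x ++ y) ->
  ~~ prefix (code x) v ->
  lsucc v (code x ++ h x y) <-> y = b x /\ lsucc v (cfill false (code x ++ y)).
Proof.
move=> hy sv pv; rewrite lsucc_blockr // ?sh ?bw_bot //; last first.
  by rewrite sv !size_cat sh ?hy.
by rewrite cfill_code hy.
Qed.

Lemma prefix_code x x' y : x' != x -> ~~ prefix (code x) (code x' ++ y).
Proof.
apply: contra => /prefixP [z /code_inj [-> _]]; by rewrite eqxx.
Qed.

Lemma bw_sameP u v : size u = size v ->
  lsucc (on_blocks n h u) (on_blocks n h v) <-> bw_same u v.
Proof.
move=> suv; rewrite /bw_same !bw_validE.
have [/validP [x [y [eu hy]]]|hu] := boolP (valid n u);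
have [/validP [x' [y' [ev hy']]]|hv] := boolP (valid n v).
- subst u v; rewrite !cfst_code !csnd_code !on_blocks_code //=.
  have [ex|xx'] := eqVneq x x'.
    rewrite -ex in hy' *; rewrite lsucc_prefix -lex_succP -hprec //.
    by split=> /asboolP.
  have s1 : size (code x' ++ h x' y') = size (code x ++ y).
    by rewrite size_cat sh // -hy' -size_cat.
  have s2 : size (cfill true (code x ++ y)) = size (code x' ++ y').
    by rewrite cfill_code size_cat size_nseq -size_cat.
  (* Leaving the block of [u] is settled first, which replaces its key by a filled word; entering
     the block of [v] is then settled relative to that word. *)
  rewrite bw_leave ?prefix_code // 1?eq_sym // bw_enter //; last first.
    by rewrite cfill_code prefix_code.
  split=> [[-> [-> ->]]|/and3P [/eqP -> /eqP -> ->]] //; by rewrite !eqxx.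
- subst u; rewrite cfst_code csnd_code on_blocks_code // on_blocks_invalid //=.
  rewrite bw_leave //; last first.
    apply: contra hv => hp.
    have [y' hy' ->] := prefix_code_valid hy (esym suv) hp.
    by apply/validP; exists x, y'.
  by split=> [[-> ->]|/andP [/eqP -> ->]] //; rewrite eqxx.
- subst v; rewrite cfst_code csnd_code on_blocks_code // on_blocks_invalid //=.
  rewrite bw_enter //; last first.
    apply: contra hu => hp.
    have [y hy ->] := prefix_code_valid hy' suv hp.
    by apply/validP; exists x', y.
  by split=> [[-> ->]|/andP [/eqP -> ->]] //; rewrite eqxx.
- by rewrite !on_blocks_invalid.
Qed.

Lemma bw_const c u m : on_blocks n h u = nseq m c <-> u = nseq m c.
Proof.
split=> e; last by rewrite on_blocks_invalid e ?valid_nseq.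
rewrite -e on_blocks_invalid // -(valid_on_blocks (h := h)) //.
by rewrite e valid_nseq.
Qed.

Lemma bw_adjacentP u v : adjacent bw_order u v <-> bw_adjacent u v.
Proof.
rewrite (key_adjacentP bw_cancel bw_cancel' size_bw) /bw_adjacent.
have nextP : bw_next u v <-> [/\ size v = (size u).+1,
    on_blocks n h u = nseq (size u) true & on_blocks n h v = nseq (size v) false].
  split=> [/and4P [/eqP hu /eqP hv /eqP huv hd]|[huv /bw_const hu /bw_const hv]].
    by split; [rewrite -huv; case: (v) hd|exact/bw_const|exact/bw_const].
  apply/and4P; split; try exact/eqP.
    by rewrite size_behead huv.
  by rewrite hv huv.
split=> [[h1|/nextP ->]|/orP [/andP [/eqP suv h1]|/nextP]]; rewrite ?orbT //.
- have [+ _] := (lsuccP _ _).1 h1; rewrite !size_bw => suv.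
  by rewrite suv eqxx (bw_sameP suv).1.
- by left; apply/bw_sameP.
- by right.
Qed.

End Blockwise.

Lemma ptime_adjacent_bw b t prec :
  FPt b -> FPt t -> ptime_pred3 prec -> ptime_pred2 (bw_adjacent b t prec).
Proof.
move=> /FPtP hb /FPtP ht hprec; apply: dec_FP.
pose u (a : 2.-tuple word) := tnth a (inord 0).
pose v (a : 2.-tuple word) := tnth a (inord 1).
have hu : FP u by exact: FP_tnth. have hv : FP v by exact: FP_tnth.
have hfst f : FP f -> FP (fun a : 2.-tuple word => cfst (f a)) by exact: FP_tr1.
have hsnd f : FP f -> FP (fun a : 2.-tuple word => csnd (f a)) by exact: FP_tr1.
have hfill c f : FP f -> FP (fun a : 2.-tuple word => cfill c (f a)) by exact: FP_tr1.
have hval f : FP f -> PD (fun a : 2.-tuple word => bw_valid b (f a)).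
  move=> hf; apply: PD_and (PD_decode hf) (PD_eqsize (hsnd _ hf) _).
  exact: FP_comp1 hb (hfst _ hf).
have hsame : PD (fun a => bw_same b t prec (u a) (v a)).
  apply: PD_if.
  - apply: PD_and (PD_and (hval _ hu) (hval _ hv)) _.
    exact: PD_eq (hfst _ hu) (hfst _ hv).
  - exact: PD_pred3 hprec (hfst _ hu) (hsnd _ hu) (hsnd _ hv).
  - apply: PD_and (PD_imp (hval _ hu) (PD_eq (hsnd _ hu) (FP_comp1 ht (hfst _ hu)))) _.
    apply: PD_and (PD_imp (hval _ hv) (PD_eq (hsnd _ hv) (FP_comp1 hb (hfst _ hv)))) _.
    apply: PD_lsucc.
      exact: FP_if (hval _ hu) (hfill _ _ hu) hu.
    exact: FP_if (hval _ hv) (hfill _ _ hv) hv.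
have hnext : PD (fun a => bw_next (u a) (v a)).
  apply: PD_and (PD_nseq _ hu) (PD_and (PD_nseq _ hv) (PD_and _ (PD_head _ hv))).
  exact: PD_eqsize (FP_behead hv) hu.
have hadj := PD_or (PD_and (PD_eqsize hu hv) hsame) hnext.
by apply: PD_ext hadj => a; rewrite asboolb.
Qed.

Lemma CLU_sub_CL : CLUsharpP `<=` CLsharpP.
Proof.
move=> f [p [M [b [t [prec [hM hb ht hprec hx]]]]]].
have [h hh] := choice hx.
pose n := plen p.
have hbij x : set_bij (words (n x)) (words (n x)) (h x) by case: (hh x).
have [g hg] := choice (fun x => set_bij_inv (hbij x)).
have sh x y : size y = n x -> size (h x y) = n x by move=> /hg [].
have sg x y : size y = n x -> size (g x y) = n x by move=> /hg [].
have gh x y : size y = n x -> g x (h x y) = y by move=> /hg [].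
have hgK x y : size y = n x -> h x (g x y) = y by move=> /hg [].
have sb x : size (b x) = n x by case: (hh x) => _ [[]].
have st x : size (t x) = n x by case: (hh x) => _ [[]].
have hb0 x : h x (b x) = nseq (n x) false by case: (hh x) => _ [_ []].
have ht1 x : h x (t x) = nseq (n x) true by case: (hh x) => _ [_ []].
have prech x y z : size y = n x -> size z = n x ->
    (prec x y z <-> lex_succ (h x y) (h x z)).
  by case: (hh x) => _ [_ _ H _ _]; exact: H.
have hint x : f x <> 0 -> exists l u, [/\ words (n x) l, words (n x) u &
    acc M [tuple x] =
      [set w | [/\ words (n x) w, lex_le (h x l) (h x w) & lex_le (h x w) (h x u)]]].
  by case: (hh x) => _ [].
have hcard x : acc M [tuple x] #= `I_(f x) by case: (hh x) => _ [].
have sacc x y : acc M [tuple x] y -> size y = n x.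
  move=> hy; have : paths M [tuple x] y by case: hy => k [d [r hd]]; exists k, d, true.
  by rewrite hM.2.
pose p' : {poly nat} := (p + 'X + 'X + 2%:P)%R.
have p'E x : plen p' x = (2 * size x).+2 + n x.
  by rewrite /plen !hornerD !hornerX hornerC /n /plen -!plusE; lia.
have hU := FP_unary 2 1 2 false (FP_tnth (ord0 : 'I_1)) (FP_plen hM).
have [Q hQ accQ] := FP_acc hM.
pose P x w := [&& decode w != None, cfst w == x & Q x (csnd w)].
have [||M' hM' accM'] := @FP_balanced p' _ P hU.
- by move=> x; rewrite p'E !size_nseq !(tnth_nth [::]) /= /n; lia.
- apply: PD_and (PD_decode (FP_tnth _)) _.
  apply: PD_and (PD_eq (FP_tr1 _ _ _ (FP_tnth _)) (FP_tnth _)) _.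
  exact: (FP_comp2 (F := fun x w => [:: Q x w]) hQ (FP_tnth _)
    (FP_tr1 _ _ _ (FP_tnth _))).
have accE x : acc M' [tuple x] = [set code x ++ y | y in acc M [tuple x]].
  rewrite accM'; apply/seteqP; split=> w /=.
    rewrite /P; case E: (decode w) => [[x' y]|]; last by case.
    rewrite (decodeP E) cfst_code csnd_code p'E => -[hs /and3P [_ /eqP ex hq]]; subst x'.
    have sy : size y = n x by move: hs; rewrite size_cat size_code => /addnI.
    by exists y => //; apply/accQ.
  move=> [y hy <-]; have sy := sacc _ _ hy.
  rewrite p'E size_cat size_code sy /P codeK cfst_code csnd_code eqxx /=.
  by split=> //; apply/accQ.
pose A := bw_order n h.
exists p', M', A; split=> //.
- exact: (key_order_total (bw_cancel sh gh) (size_bw sh)).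
- exact: key_order_length.
- have := ptime_adjacent_bw hb ht hprec; congr (ptime_pred2 _).
  apply/funext => u; apply/funext => v; apply/propext; symmetry.
  exact: (bw_adjacentP sh sg gh hgK sb st hb0 ht1 prech).
move=> x; split; last first.
  rewrite accE; apply: card_eq_trans (hcard x); apply: inj_card_eq.
  by move=> y z _ _ /code_inj [].
have [f0|/eqP/hint] := eqVneq (f x) 0.
  left; have := hcard x; rewrite f0 II0 card_eq0 => /eqP acc0.
  by rewrite accE acc0 image_set0.
move=> [l [u [wl wu accI]]].
have [acc0|/set0P [w0 hw0]] := eqVneq (acc M [tuple x]) set0.
  by left; rewrite accE acc0 image_set0.
have vle y z : size y = n x -> size z = n x ->
    (lex_le (h x y) (h x z) <-> wval (h x y) <= wval (h x z)).
  by move=> hy hz; apply: lex_leP; rewrite !sh.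
(* An accepting path lies between the two bounds, so they are in the right order and [l] is itself
   accepting. *)
have lu : wval (h x l) <= wval (h x u).
  move: hw0; rewrite accI => -[sw /vle h1 /vle h2].
  by apply: leq_trans (h1 wl sw) (h2 sw wu).
have accl : acc M [tuple x] l by rewrite accI; split=> //; apply/vle.
apply: (@interval_cluster A M' x (plen p' x) _ (code x ++ l) (code x ++ u)).
- exact: (key_order_total (bw_cancel sh gh) (size_bw sh)).
- exact: key_order_length.
- by rewrite hM'.2.
- by [].
- by rewrite p'E size_cat size_code wl.
- by rewrite accE; exists l.
move=> w; rewrite /A /bw_order /key_order accE p'E.
rewrite !on_blocks_code // !wval_cat !sh //.
split.
  move=> [y hy <-]; have sy := sacc _ _ hy.
  rewrite !on_blocks_code // !wval_cat !sh // !size_cat size_code sy wl wu.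
  rewrite !ltnn !eqxx /= !leq_add2l.
  by move: hy; rewrite accI => -[_ /vle h1 /vle h2]; split; auto.
move=> [sw]; rewrite !size_cat size_code wl wu sw !ltnn eqxx /=.
set kw := on_blocks n h w => h1 h2.
have skw : size kw = size (code x ++ l) by rewrite size_bw // sw size_cat size_code wl.
have [c sc [a sa ekw]] := split_cat skw.
move: h1 h2; rewrite ekw wval_cat sa wl => h1 h2.
have ha := wval_lt a; rewrite sa wl in ha.
have hl := wval_lt (h x l); rewrite sh // in hl.
have hu := wval_lt (h x u); rewrite sh // in hu.
(* A key lying between two keys with prefix [code x] has this prefix too: otherwise the leading
   parts would already decide the comparison the wrong way. *)
have ec : c = code x.
  apply: wval_inj sc _; apply/eqP; rewrite eqn_leq; apply/andP; split.
    rewrite leqNgt; apply/negP => lt; have := leq_mul lt (leqnn (2 ^ n x)).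
    by rewrite mulSn; lia.
  rewrite leqNgt; apply/negP => lt; have := leq_mul lt (leqnn (2 ^ n x)).
  by rewrite mulSn; lia.
rewrite ec !leq_add2l in h1 h2.
(* Validity of a word can be read off its key, since [on_blocks] preserves validity. *)
have /validP [x' [y [ew sy]]] : valid n w.
  rewrite -(valid_on_blocks w sh) -/kw; apply/validP; exists x, a.
  by rewrite ekw ec sa wl.
move: ekw; rewrite /kw ew on_blocks_code // ec => /code_inj [ex ea].
rewrite ex in ea sy *; exists y => //; rewrite accI; split=> //.
  by apply/vle; rewrite // ea.
by apply/vle; rewrite // ea.
Qed.

(** * From CL#P to CLU#P *)

Section LengthOrder.
Variable A : rel word.
Hypotheses (A_ord : total_order A) (A_len : length_respecting A).

Let Ar : reflexive A. Proof. by case: A_ord. Qed.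
Let Aa : antisymmetric A. Proof. by case: A_ord. Qed.
Let At : transitive A. Proof. by case: A_ord. Qed.
Let Ato : total A. Proof. by case: A_ord. Qed.

Lemma order_anti x y : A x y -> A y x -> x = y.
Proof. by move=> h1 h2; apply: Aa; rewrite h1 h2. Qed.

Lemma order_lt_asym x y : A x y -> ~ order_lt A y x.
Proof. by move=> h1 [h2]; apply; exact: order_anti. Qed.

Lemma order_ltNge x y : ~ A x y -> order_lt A y x.
Proof.
move=> h; have /orP [//|h'] := Ato x y.
by split=> // e; apply: h; rewrite e.
Qed.

Lemma order_size x y z :
  size x = size z -> A x y -> A y z -> size y = size z.
Proof.
move=> hxz xy yz; apply/eqP; rewrite eqn_leq; apply/andP; split; rewrite leqNgt.
  by apply/negP => /A_len; exact: order_lt_asym.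
by rewrite -hxz; apply/negP => /A_len; exact: order_lt_asym.
Qed.

Lemma length_iso n : exists h : word -> word,
  [/\ set_bij (words n) (words n) h,
     forall y z, size y = n -> size z = n -> A y z <-> lex_le (h y) (h z) &
     forall y z, size y = n -> size z = n ->
       (lsucc (h y) (h z) <-> [/\ A y z, y <> z &
         forall w, size w = n -> A y w -> A w z -> w = y \/ w = z])].
Proof.
have [|||h [h1 h2 h3 _]] := @order_iso n A; last by exists h.
- by move=> *; exact: Ato.
- by move=> x y _ _; exact: order_anti.
- by move=> x y z _ _ _; exact: At.
Qed.

Definition is_min (a : word) := forall y, size y = size a -> A a y.
Definition is_max (a : word) := forall y, size y = size a -> A y a.

Lemma extremal n (C : set word) : C !=set0 -> (forall y, C y -> size y = n) ->
  (exists2 l, C l & forall y, C y -> A l y) /\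
  (exists2 u, C u & forall y, C y -> A y u).
Proof.
move=> [y0 Cy0] sC; have [h [hb hle _]] := length_iso n.
have sh y : C y -> size (h y) = n by move=> /sC; case: hb => hf _ _ /hf.
pose P k := `[< exists2 y, C y & wval (h y) = k >].
have exP : exists k, P k by exists (wval (h y0)); apply/asboolP; exists y0.
have ubP k : P k -> k <= 2 ^ n.
  by move=> /asboolP [y /sh sy <-]; have := wval_lt (h y); rewrite sy => /ltnW.
split.
  case: (ex_minnP exP) => k /asboolP [l Cl el] hmin; exists l => // y Cy.
  apply/(hle l y (sC _ Cl) (sC _ Cy))/lex_leP; first by rewrite !sh.
  by rewrite el; apply: hmin; apply/asboolP; exists y.
case: (ex_maxnP exP ubP) => k /asboolP [u Cu eu] hmax; exists u => // y Cy.
apply/(hle y u (sC _ Cy) (sC _ Cu))/lex_leP; first by rewrite !sh.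
by rewrite eu; apply: hmax; apply/asboolP; exists y.
Qed.

Lemma has_min n : exists2 a, size a = n & is_min a.
Proof.
have [||[l hl hmin] _] := @extremal n (words n).
- by exists (nseq n true); rewrite /words /= size_nseq.
- by [].
by exists l => // y; rewrite hl => hy; apply: hmin.
Qed.

Lemma has_max n : exists2 a, size a = n & is_max a.
Proof.
have [||_ [l hl hmax]] := @extremal n (words n).
- by exists (nseq n true); rewrite /words /= size_nseq.
- by [].
by exists l => // y; rewrite hl => hy; apply: hmax.
Qed.

Lemma has_next a : ~ is_max a -> exists2 a', size a' = size a & adjacent A a a'.
Proof.
move=> nmax; have [h [hb hle hs]] := length_iso (size a).
have [hf _ hsur] := hb.
have sha : size (h a) = size a by exact: (hf a).
have ha : (wval (h a)).+1 < 2 ^ size a.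
  rewrite ltn_neqAle; have := wval_lt (h a); rewrite sha => ->; rewrite andbT.
  apply/eqP => e; apply: nmax => y sy.
  have shy : size (h y) = size a by exact: (hf y).
  apply/(hle y a sy erefl)/lex_leP; rewrite ?sha //.
  by have := wval_lt (h y); rewrite shy -e.
have [a' sa' ea'] := hsur (word_of (size a) (wval (h a)).+1) (size_word_of _ _).
exists a' => //; have /(hs a a' erefl sa') [h1 h2 h3] : lsucc (h a) (h a').
  by apply/lsuccP; rewrite ea' size_word_of word_ofK.
split=> // w [[aw naw] [wa' nwa']].
have sw : size w = size a by rewrite -sa'; apply: order_size aw wa'.
by case: (h3 w sw aw wa') => e; [case: naw|case: nwa'].
Qed.

(** As [A] respects lengths, a word between [a] and [b] would have the length of one of them, above
    [a] or below [b]. *)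
Lemma edge_max_min a b :
  size b = (size a).+1 -> (adjacent A a b <-> is_max a /\ is_min b).
Proof.
move=> sab; split=> [[ab hn]|[ha hb]].
  split=> y sy; apply: contrapT => /order_ltNge hy; apply: (hn y).
    by split=> //; apply: A_len; rewrite sy sab.
  by split=> //; apply: A_len; rewrite sy sab.
split; first by apply: A_len; rewrite sab.
move=> z [az zb]; have [h|h] := leqP (size z) (size a).
  case: (ltngtP (size z) (size a)) h => // [h _|h _].
    by have /order_lt_asym := (A_len h).1; apply.
  by have /order_lt_asym := ha z h; apply.
have [h'|h'] := leqP (size b) (size z).
  case: (ltngtP (size b) (size z)) h' => // [h' _|h' _].
    by have /order_lt_asym := (A_len h').1; apply.
  by have /order_lt_asym := hb z (esym h'); apply.
by lia.
Qed.

(** An adjacency step cannot jump over [w]. So if [w] were outside the cluster, all elements of the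
    cluster would lie on the same side of [w], contrary to the position of [y] and [z]. *)
Lemma cluster_convex (M : machine 1) x (C : set word) y z w :
  cluster A M x C -> C y -> C z -> A y w -> A w z -> C w.
Proof.
case=> [-> //|[y0 [_ eC _]]]; rewrite eC /= => Cy Cz yw wz.
apply: contrapT => nCw.
(* Membership in the class of [y0] is carried along in the induction, because it keeps the
   intermediate paths different from [w]. *)
have side u v : cluster_equiv A M x u v ->
    (cluster_equiv A M x y0 u <-> cluster_equiv A M x y0 v) /\
    (cluster_equiv A M x y0 u -> (A u w <-> A v w)).
  elim=> {u v}.
  - move=> u v uv; have st : cluster_step A M x u v := uv.
    have huv : cluster_equiv A M x y0 u <-> cluster_equiv A M x y0 v.
      split=> hu; first exact: rst_trans hu (rst_step _ _ _ _ uv).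
      by apply: rst_trans hu _; apply/rst_sym/rst_step.
    split=> // hu; have hv := huv.1 hu.
    have nuw : u <> w by move=> e; apply: nCw; rewrite -e.
    have nvw : v <> w by move=> e; apply: nCw; rewrite -e.
    case: uv => _ _ adj _; case: adj => -[[le ne] hn]; split=> h.
    + apply: contrapT => /order_ltNge h'; exact: (hn w).
    + exact: At le h.
    + exact: At le h.
    + apply: contrapT => /order_ltNge h'; exact: (hn w).
  - by [].
  - by move=> u v _ [h1 h2]; split; [symmetry|move=> /h1 /h2 h; symmetry].
  - by move=> u v t _ [h1 h2] _ [h3 h4]; split; [rewrite h1|move=> hu; rewrite h2 // h4 // -h1].
have yz : cluster_equiv A M x y z by apply: rst_trans Cz; apply: rst_sym.
have zw := ((side y z yz).2 Cy).1 yw.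
by apply: nCw; rewrite -(order_anti zw wz).
Qed.

End LengthOrder.

(** * Paths that encode pairs of words *)

Fixpoint evens (w : word) : word :=
  if w is a :: _ :: w' then a :: evens w' else w.

Fixpoint zip2 (a b : word) : word :=
  match a, b with
  | x :: a', y :: b' => x :: y :: zip2 a' b'
  | _, _ => [::]
  end.

(* [b0 :: b] and [a] are interleaved for finite automata to tell them apart. *)
Definition element (c t1 t2 : bool) (a : word) (b0 : bool) (b : word) : word :=
  [:: c, t1, t2, b0 & zip2 a b].

Definition el_a (w : word) : word := evens (drop 4 w).
(** Starting one place earlier, at [b0], selects the other letters of the interleaving. *)
Definition el_b (w : word) : word := evens (drop 3 w).

Lemma size_zip2 a b : size a = size b -> size (zip2 a b) = 2 * size a.
Proof. by elim: a b => [|x a IH] [|y b] //= [/IH ->]; lia. Qed.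

Lemma evens_zip2 a b : size a = size b -> evens (zip2 a b) = a.
Proof. by elim: a b => [|x a IH] [|y b] //= [/IH ->]. Qed.

Lemma evens_cons_zip2 y a b : size a = size b -> evens (y :: zip2 a b) = y :: b.
Proof. by elim: a b y => [|x a IH] [|z b] y //= [/IH <-]. Qed.

Section Element.
Variables (c t1 t2 : bool) (a : word) (b0 : bool) (b : word).
Hypothesis hab : size a = size b.

Lemma el_a_element : el_a (element c t1 t2 a b0 b) = a.
Proof. by rewrite /el_a /= drop0 evens_zip2. Qed.

Lemma el_b_element : el_b (element c t1 t2 a b0 b) = b0 :: b.
Proof. exact: evens_cons_zip2. Qed.

Lemma size_element : size (element c t1 t2 a b0 b) = 2 * size a + 4.
Proof. by rewrite /= size_zip2 // addn4. Qed.

End Element.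

Variant is_element m (w : word) : Prop :=
  IsElement c t1 t2 a b0 b of size a = m & size b = m & w = element c t1 t2 a b0 b.

Lemma elementP m w : size w = 2 * m + 4 -> is_element m w.
Proof.
case: w => [|c [|t1 [|t2 [|b0 w]]]]; rewrite /= ?addn4 => // -[] hw.
suff [a [b [ha hb ->]]] : exists a b, [/\ size a = m, size b = m & w = zip2 a b].
  exact: (@IsElement m _ c t1 t2 a b0 b).
elim: m w hw => [|m IH] w; first by move=> /size0nil ->; exists [::], [::].
case: w => [|x [|y w]] /= hw; try (exfalso; lia).
have [|a [b [ha hb ->]]] := IH w; first by lia.
by exists (x :: a), (y :: b); rewrite /= ha hb.
Qed.

Lemma FP_evens k (f : k.-tuple word -> word) : FP f -> FP (fun a => evens (f a)).
Proof.
move=> hf; have h := FP_tr1 (fun s _ => ~~ s)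
  (fun s x => if s then [::] else seq_of_opt x) false hf.
apply: eq_FP h => a; move: (f a) => w.
have [n] := ubnP (size w); elim: n => // n IH in w *.
by case: w => [|x [|y w]] //= hw; rewrite IH //; lia.
Qed.

Lemma FP_cons k b (f : k.-tuple word -> word) : FP f -> FP (fun a => b :: f a).
Proof.
move=> hf; have h := FP_tr1 (fun _ _ => true)
  (fun s x => (if s then id else cons b) (seq_of_opt x)) false hf.
apply: eq_FP h => a; case: (f a) => //= c w; congr [:: _, _ & _].
by elim: w => //= d w ->.
Qed.

(** * The new order on paths and its successor relation *)

Section Chain.
Variable A : rel word.

Definition adj (a b : word) : bool := `[< adjacent A a b >].

(* [el_a w] has length [m] and [el_b w] has length [m + 1]: the lower edge is
   looked for among the pairs [(drop 2 (el_b w), el_a w)], except for [m = 0]. *)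
Definition isBot (w : word) : bool :=
  prefix [:: true; false; false] w &&
  ((el_b w == [:: false]) ||
   prefix [:: false; false] (el_b w) && adj (drop 2 (el_b w)) (el_a w)).

(** The second component is fixed to 0s, so that each word [a] is represented by a single path. *)
Definition isReal (w : word) : bool :=
  prefix [:: true; false; true] w && (el_b w == nseq (size (el_b w)) false).

Definition isTop (w : word) : bool :=
  prefix [:: true; true; false] w && adj (el_a w) (el_b w).

Definition isMax (w : word) : bool := w == nseq (size w) true.

(* Junk (0), lower edge (1), elements of the [A]-chain (2), upper edge (3) and
   last path (4), in this order. *)
Definition cls (w : word) : nat :=
  if isBot w then 1 else if isReal w then 2 else if isTop w then 3
  else if isMax w then 4 else 0.

(** With the leading bit as least significant digit, [0g] and [1g] have consecutive ranks. Only [1g]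
    can be special, so between two neighbouring junk paths at most one path is skipped. *)
Definition rank0 (w : word) : nat := 2 * wval (behead w) + head false w.

(** Among the paths of one length, the classes 1, 3 and 4 are singletons, whence [true]. *)
Definition chain : rel word := fun w w' =>
  (cls w < cls w') || (cls w == cls w') &&
  match cls w with
  | 0 => rank0 w <= rank0 w'
  | 2 => A (el_a w) (el_a w')
  | _ => true
  end.

Definition special (w : word) : bool := [|| isBot w, isReal w, isTop w | isMax w].

(** Either from [0g] to [1g], or to [0g'] where [g'] follows [g]; the latter starts from [1g], or
    from [0g] if [1g] is special and thus no junk. *)
Definition next0 (w w' : word) : bool :=
  [&& ~~ special w, ~~ special w' &
   [&& ohead w == Some false, ohead w' == Some true & behead w == behead w'] ||
   [&& ohead w' == Some false, lsucc (behead w) (behead w') &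
       (ohead w == Some true) || special (true :: behead w)]].

(** The last junk path is 01...1, as 1...1 closes the whole order; from there the chain goes to the
    lower edge. *)
Definition next (w w' : word) : bool :=
  next0 w w' ||
  (if isBot w' then
     (ohead w == Some false) && (behead w == nseq (size (behead w)) true)
   else if isReal w' then
     isBot w && (el_a w == el_a w') || isReal w && adj (el_a w) (el_a w')
   else if isTop w' then isReal w && (el_a w == el_a w')
   else isMax w' && isTop w).

Hypotheses (A_ord : total_order A) (A_len : length_respecting A).
Variable m : nat.
Notation W w := (size w = 2 * m + 4).

Lemma adj_max_min a b :
  size b = (size a).+1 -> adj a b <-> is_max A a /\ is_min A b.
Proof.
by move=> sab; rewrite -(edge_max_min A_ord A_len sab); split=> /asboolP.
Qed.

Lemma is_min_uniq a b : size a = size b -> is_min A a -> is_min A b -> a = b.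
Proof. by move=> sab ha hb; apply: (order_anti A_ord); [exact: ha|exact: hb]. Qed.

Lemma is_max_uniq a b : size a = size b -> is_max A a -> is_max A b -> a = b.
Proof. by move=> sab ha hb; apply: (order_anti A_ord); [exact: hb|exact: ha]. Qed.

Lemma isBotP w : W w -> isBot w -> exists a b,
  [/\ w = element true false false a false b, size a = m, size b = m,
      is_min A a & b = [::] \/ exists2 z, b = false :: z & is_max A z].
Proof.
move=> /elementP [c t1 t2 a b0 b ha hb ->].
rewrite /isBot el_a_element ?el_b_element ?ha ?hb //.
case: c; case: t1; case: t2 => //= h.
exists a, b; case/orP: h => [/eqP [-> eb]|].
  split=> //; last by left.
  by rewrite eb in hb; move=> y; rewrite ha -hb => /size0nil ->;
    move: ha; rewrite -hb => /size0nil ->; case: A_ord.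
case: b0 => //=; case: b hb => [|[] z] //= hz; rewrite drop0 prefix0s /=.
have sz : size a = (size z).+1 by rewrite ha hz.
by move/(adj_max_min sz) => [h1 h2]; split=> //; right; exists z.
Qed.

Lemma isRealP w : W w -> isReal w ->
  exists2 a, size a = m & w = element true false true a false (nseq m false).
Proof.
move=> /elementP [c t1 t2 a b0 b ha hb ->].
rewrite /isReal el_b_element ?ha ?hb //=.
case: c; case: t1; case: t2 => //= /eqP; rewrite hb => -[-> ->].
by exists a.
Qed.

Lemma isTopP w : W w -> isTop w -> exists a b0 b,
  [/\ w = element true true false a b0 b, size a = m, size b = m,
      is_max A a & is_min A (b0 :: b)].
Proof.
move=> /elementP [c t1 t2 a b0 b ha hb ->].
rewrite /isTop el_a_element ?el_b_element ?ha ?hb //=.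
case: c; case: t1; case: t2 => //= /adj_max_min [|h1 h2]; first by rewrite /= ha hb.
by exists a, b0, b.
Qed.

Lemma isReal_element a :
  size a = m -> isReal (element true false true a false (nseq m false)).
Proof.
by move=> ha; rewrite /isReal el_b_element ?size_nseq //= size_nseq.
Qed.

Lemma el_a_real a :
  size a = m -> el_a (element true false true a false (nseq m false)) = a.
Proof. by move=> ha; rewrite el_a_element ?size_nseq. Qed.

(** The classes are disjoint, as they begin with 100, 101, 110 and 111 respectively. *)
Lemma clsP w : W w ->
  [/\ isBot w = (cls w == 1), isReal w = (cls w == 2), isTop w = (cls w == 3),
      isMax w = (cls w == 4) & special w = (cls w != 0)].
Proof.
case: w => [|c [|t1 [|t2 w]]]; rewrite /= ?addn4 // => _.
rewrite /special /cls /isMax /isBot /isReal /isTop.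
by case: c; case: t1; case: t2 => //=; do 4 case: ifP => //=.
Qed.

Lemma cls_le4 w : cls w <= 4.
Proof. by rewrite /cls; do 4 case: ifP => _ //. Qed.

Lemma cls_Bot w : W w -> cls w = 1 -> isBot w.
Proof. by move=> /clsP [-> _ _ _ _] ->. Qed.

Lemma cls_Real w : W w -> cls w = 2 -> isReal w.
Proof. by move=> /clsP [_ -> _ _ _] ->. Qed.

Lemma cls_Top w : W w -> cls w = 3 -> isTop w.
Proof. by move=> /clsP [_ _ -> _ _] ->. Qed.

Lemma cls_Max w : W w -> cls w = 4 -> isMax w.
Proof. by move=> /clsP [_ _ _ -> _] ->. Qed.

(** The padding bits of the guessed pair are fixed to 0, and the extremal words themselves are
    unique. *)
Lemma Bot_uniq v w : W v -> W w -> isBot v -> isBot w -> v = w.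
Proof.
move=> hv hw /(isBotP hv) [a [b [-> ha hb mina hb']]].
move=> /(isBotP hw) [c [d [-> hc hd minc hd']]].
rewrite (is_min_uniq _ mina minc) ?ha ?hc //; congr element.
case: hb' hb => [->|[y -> maxy]] hb; case: hd' hd => [->|[z -> maxz]] hd //.
- by rewrite -hb in hd.
- by rewrite -hd in hb.
by rewrite (is_max_uniq _ maxy maxz) //; move: hb hd => /= hb hd; lia.
Qed.

Lemma Top_uniq v w : W v -> W w -> isTop v -> isTop w -> v = w.
Proof.
move=> hv hw /(isTopP hv) [a [b0 [b [-> ha hb maxa minb]]]].
move=> /(isTopP hw) [c [d0 [d [-> hc hd maxc mind]]]].
rewrite (is_max_uniq _ maxa maxc) ?ha ?hc //.
have [] : b0 :: b = d0 :: d by apply: is_min_uniq minb mind; rewrite /= hb hd.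
by move=> -> ->.
Qed.

Lemma Real_uniq v w :
  W v -> W w -> isReal v -> isReal w -> el_a v = el_a w -> v = w.
Proof.
move=> hv hw /(isRealP hv) [a ha ->] /(isRealP hw) [b hb ->].
by rewrite !el_a_real // => ->.
Qed.

Lemma Max_uniq v w : W v -> W w -> isMax v -> isMax w -> v = w.
Proof. by move=> hv hw /eqP -> /eqP ->; rewrite hv hw. Qed.

Lemma rank0_inj v w : W v -> W w -> rank0 v = rank0 w -> v = w.
Proof.
case: v w => [|b v] [|c w]; rewrite /= ?addn4 // => -[hv] [hw].
rewrite /rank0 /= => h; have e : b = c.
  by case: b h; case: c => // h; exfalso; lia.
rewrite e in h *; congr cons; apply: wval_inj; first by rewrite hv hw.
lia.
Qed.

Lemma chain_total v w : chain v w || chain w v.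
Proof.
rewrite /chain; case: (ltngtP (cls v) (cls w)) => //= <-.
have tot : A (el_a v) (el_a w) || A (el_a w) (el_a v) by case: A_ord => _ _ _; apply.
by case: (cls v) => [|[|[|k]]] //=; exact: leq_total.
Qed.

Lemma chain_trans v u w : chain v u -> chain u w -> chain v w.
Proof.
rewrite /chain => /orP [h1|/andP [/eqP e1 h1]] /orP [h2|/andP [/eqP e2 h2]].
- by rewrite (ltn_trans h1 h2).
- by rewrite -e2 h1.
- by rewrite e1 h2.
have tr : A (el_a v) (el_a u) -> A (el_a u) (el_a w) -> A (el_a v) (el_a w).
  by case: A_ord => _ _ tr _; exact: tr.
rewrite -e1 in e2 h2; rewrite -e2 eqxx ltnn /=; case: (cls v) h1 h2 => [|[|[|k]]] //=.
exact: leq_trans.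
Qed.

Lemma chain_anti v w : W v -> W w -> chain v w -> chain w v -> v = w.
Proof.
move=> hv hw; rewrite /chain.
case: (ltngtP (cls v) (cls w)) => //= e; rewrite -e.
have [b1 b2 b3 b4 _] := clsP hv; have [c1 c2 c3 c4 _] := clsP hw.
rewrite -e in c1 c2 c3 c4.
case E: (cls v) => [|[|[|[|[|k]]]]]; rewrite E in b1 b2 b3 b4 c1 c2 c3 c4.
- by move=> h1 h2; apply: rank0_inj => //; lia.
- by move=> *; apply: Bot_uniq.
- by move=> h1 h2; apply: Real_uniq => //; exact: order_anti h1 h2.
- by move=> *; apply: Top_uniq.
- by move=> *; apply: Max_uniq.
by have := cls_le4 v; rewrite E.
Qed.

Lemma chain_cls v w : chain v w -> cls v <= cls w.
Proof. by move=> /orP [/ltnW //|/andP [/eqP -> _]]. Qed.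

Lemma chain_rank0 v w : chain v w -> cls v = 0 -> cls w = 0 -> rank0 v <= rank0 w.
Proof. by move=> + ev ew; rewrite /chain ev ew. Qed.

Lemma chain_real v w : chain v w -> cls v = 2 -> cls w = 2 -> A (el_a v) (el_a w).
Proof. by move=> + ev ew; rewrite /chain ev ew. Qed.

Definition covers (v w : word) : Prop :=
  [/\ chain v w, v <> w & forall u, W u -> chain v u -> chain u w -> u = v \/ u = w].

Lemma cls_head0 w : W w -> ohead w = Some false -> cls w = 0.
Proof.
move=> hw h; have [_ _ _ _ hs] := clsP hw; apply/eqP; rewrite -[_ == _]negbK -hs.
by case: w h {hw hs} => //= b w [->].
Qed.

Lemma cls_special w : W w -> special w = false -> cls w = 0.
Proof. by move=> /clsP [_ _ _ _ ->] /negbFE/eqP. Qed.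

Lemma covers0 v w u : W v -> W w -> W u -> cls v = 0 -> cls w = 0 -> cls u = 0 ->
  chain v u -> chain u w -> rank0 w = (rank0 v).+1 -> u = v \/ u = w.
Proof.
move=> hv hw hu cv cw cu /chain_rank0 h1 /chain_rank0 h2 e.
have {}h1 := h1 cv cu; have {}h2 := h2 cu cw.
have [h|h] := leqP (rank0 u) (rank0 v).
  by left; apply: rank0_inj => //; lia.
by right; apply: rank0_inj => //; lia.
Qed.

Lemma next0_covers v w : W v -> W w -> next0 v w -> covers v w.
Proof.
move=> hv hw /and3P [/negbTE /(cls_special hv) cv /negbTE /(cls_special hw) cw].
have clsu u : chain v u -> chain u w -> cls u = 0.
  by move=> _ /chain_cls; rewrite cw leqn0 => /eqP.
case/orP.
  case: v w hv hw cv cw clsu => [|c v] [|d w] // hv hw cv cw clsu.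
  move=> /and3P [/eqP [ec] /eqP [ed] /eqP /= evw]; subst c d w.
  have rk : rank0 (true :: v) = (rank0 (false :: v)).+1 by rewrite /rank0 /=; lia.
  split=> [| |u hu h1 h2].
  - by rewrite /chain cv cw eqxx rk leqnSn orbT.
  - by [].
  - exact: covers0 hu cv cw (clsu u h1 h2) h1 h2 rk.
case: v w hv hw cv cw clsu => [|c v] [|d w] // hv hw cv cw clsu.
move=> /and3P [/eqP [ed] /lsuccP /= [svw evw]] hc; subst d.
have rk : rank0 (false :: w) = 2 + rank0 (false :: v).
  by rewrite /rank0 /= evw; lia.
have rkc : rank0 (c :: v) = rank0 (false :: v) + c by rewrite /rank0 /=; lia.
have hch : chain (c :: v) (false :: w).
  rewrite /chain cv cw eqxx rk rkc /=; case: (c); lia.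
split=> [//| |u hu h1 h2].
  by move=> [_ e]; move: evw; rewrite e; lia.
have cu := clsu u h1 h2.
case: c hv cv clsu hc rkc hch h1 => /= hv cv clsu hc rkc hch h1.
  by apply: covers0 hu cv cw cu h1 h2 _ => //; lia.
have r1 := chain_rank0 h1 cv cu; have r2 := chain_rank0 h2 cu cw.
have rk1 : rank0 (true :: v) = (rank0 (false :: v)).+1 by rewrite /rank0 /=; lia.
have [h|h] := leqP (rank0 u) (rank0 (false :: v)).
  by left; apply: rank0_inj => //; lia.
have [h'|h'] := leqP (rank0 (false :: w)) (rank0 u).
  by right; apply: rank0_inj => //; lia.
(* The only rank left in between is that of [1v], which by [hc] is special and so not of class 0. *)
have eu : u = true :: v by apply: rank0_inj => //; lia.
have [_ _ _ _] := clsP hu; rewrite cu eu /= => hs.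
by rewrite hs in hc.
Qed.

Lemma next_covers v w : W v -> W w -> next v w -> covers v w.
Proof.
move=> hv hw /orP [|]; first exact: next0_covers.
have [vB vR vT vM _] := clsP hv; have [wB wR wT wM _] := clsP hw.
have range u : chain v u -> chain u w -> cls v <= cls u <= cls w.
  by move=> /chain_cls -> /chain_cls.
have lt_cover : cls v < cls w -> (forall u, W u -> chain v u -> chain u w ->
    u = v \/ u = w) -> covers v w.
  by move=> h hu; split=> // [|e]; [rewrite /chain h|rewrite e ltnn in h].
rewrite wB wR wT wM; case: (eqVneq (cls w) 1) => [cw|_].
  move=> /andP [/eqP h0 /eqP h1]; have cv := cls_head0 hv h0.
  apply: lt_cover => [|u hu h2 h3]; first by rewrite cv cw.
  have := range u h2 h3; rewrite cv cw => hcu.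
  have [cu|cu] := leqP (cls u) 0; last first.
    right; apply: Bot_uniq => //; apply: cls_Bot => //; lia.
  have {hcu}cu : cls u = 0 by lia.
  left; have := chain_rank0 h2 cv cu; rewrite leq_eqVlt => /orP [/eqP e|h4].
    by apply/esym/rank0_inj.
  (* A path with a rank above that of 01...1 can only be 1...1, which is not junk. *)
  suff : isMax u by have [_ _ _ -> _] := clsP hu; rewrite cu.
  case: v u hv hu h0 h1 h4 {h2 h3 cv cu vB vR vT vM range}.
    by [].
  move=> c v [|d u] //= hv hu [->] ev; have hl := wval_lt u.
  have suv : size u = size v by lia.
  rewrite /rank0 /= ev; have := wval1 (size v); rewrite -suv => h5 h4.
  have [ed eu] : d = true /\ wval u = wval (nseq (size u) true).
    by case: d h4 {hu} => /= h4; split=> //; lia.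
  rewrite /isMax ed /=; apply/eqP; congr cons; apply: wval_inj => //.
  by rewrite size_nseq.
case: (eqVneq (cls w) 2) => [cw|_].
  have [b hb ew] := isRealP hw (cls_Real hw cw).
  case/orP=> /andP [].
    (* The lower edge exhibits the [A]-least word of length [m], whose path opens class 2. *)
    rewrite vB => /eqP cv /eqP ea.
    apply: lt_cover => [|u hu h2 h3]; first by rewrite cv cw.
    have := range u h2 h3; rewrite cv cw => hcu.
    have [cu|cu] := leqP (cls u) 1.
      by left; apply: Bot_uniq => //; apply: cls_Bot => //; lia.
    have {hcu}cu : cls u = 2 by lia.
    have hr := cls_Real hu cu; right; apply: Real_uniq => //; first exact: cls_Real.
    apply: (order_anti A_ord); first exact: chain_real.
    have [c hc eu] := isRealP hu hr.
    have [a [d [ev ha hd mina _]]] := isBotP hv (cls_Bot hv cv).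
    move: ea; rewrite ev eu ew !el_a_real // el_a_element ?hd // => <-.
    by apply: mina; rewrite hc ha.
  rewrite vR => /eqP cv /asboolP [[h1 h2] h3].
  split.
  - by rewrite /chain cv cw eqxx h1 orbT.
  - by move=> e; apply: h2; rewrite e.
  - move=> u hu h4 h5; have := range u h4 h5; rewrite cv cw => hcu.
    have {hcu}cu : cls u = 2 by lia.
    have a1 := chain_real h4 cv cu; have a2 := chain_real h5 cu cw.
    have [e|/eqP ne] := eqVneq (el_a u) (el_a v).
      by left; apply: Real_uniq => //; apply: cls_Real.
    have [e|/eqP ne'] := eqVneq (el_a u) (el_a w).
      by right; apply: Real_uniq => //; apply: cls_Real.
    by case: (h3 (el_a u)); split; split=> // e; apply: ne.
case: (eqVneq (cls w) 3) => [cw|_].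
  rewrite vR => /andP [/eqP cv /eqP ea].
  apply: lt_cover => [|u hu h2 h3]; first by rewrite cv cw.
  have := range u h2 h3; rewrite cv cw => hcu.
  have [cu|cu] := leqP (cls u) 2; last first.
    by right; apply: Top_uniq => //; apply: cls_Top => //; lia.
  have {hcu}cu : cls u = 2 by lia.
  have hr := cls_Real hu cu; left; apply: Real_uniq => //; first exact: cls_Real.
  apply: (order_anti A_ord); last exact: chain_real.
  have [c hc eu] := isRealP hu hr.
  have [a [d0 [d [ew ha hd maxa _]]]] := isTopP hw (cls_Top hw cw).
  move: ea; rewrite ew eu el_a_real // el_a_element ?hd // => ->.
  by apply: maxa; rewrite hc ha.
rewrite vT => /andP [/eqP cw /eqP cv].
apply: lt_cover => [|u hu h2 h3]; first by rewrite cv cw.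
have := range u h2 h3; rewrite cv cw => hcu.
have [cu|cu] := leqP (cls u) 3; last first.
  by right; apply: Max_uniq => //; apply: cls_Max => //; lia.
by left; apply: Top_uniq => //; apply: cls_Top => //; lia.
Qed.

Lemma has_Bot : exists2 w, W w & isBot w.
Proof.
have [a ha mina] := has_min A_ord m.
case Em : m => [|k].
  exists (element true false false [::] false [::]) => //.
have [z hz maxz] := has_max A_ord k.
have hab : size a = size (false :: z) by rewrite ha Em /= hz.
exists (element true false false a false (false :: z)).
  by rewrite size_element // ha Em.
rewrite /isBot el_a_element // el_b_element //= prefix0s drop0.
by apply/adj_max_min; rewrite ?ha ?hz.
Qed.

Lemma has_Top a : size a = m -> is_max A a -> exists2 w, W w & isTop w /\ el_a w = a.
Proof.
move=> ha maxa; have [[|b0 b] // [hb] minb] := has_min A_ord m.+1.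
have hab : size a = size b by rewrite ha hb.
exists (element true true false a b0 b); first by rewrite size_element // ha.
rewrite el_a_element //; split=> //.
rewrite /isTop el_a_element // el_b_element //=.
by apply/adj_max_min; rewrite /= ?ha ?hb.
Qed.

Lemma W_real a : size a = m -> W (element true false true a false (nseq m false)).
Proof. by move=> ha; rewrite size_element ?size_nseq ha. Qed.

Lemma has_succ0 v : W v -> cls v = 0 -> exists2 w, W w & next v w.
Proof.
case: v => [|c g]; rewrite /= ?addn4 // => hg cv.
have hv : W (c :: g) by rewrite /= addn4.
have sv : special (c :: g) = false by have [_ _ _ _ ->] := clsP hv; rewrite cv.
have W1 d : W (d :: g) by rewrite /= addn4.
have step0 : (c || special (true :: g)) -> g != nseq (size g) true ->
    exists2 w, size w = (2 * m).+4 & next (c :: g) w.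
  move=> hc hg1; have hlt : (wval g).+1 < 2 ^ size g.
    rewrite ltn_neqAle wval_lt andbT; apply: contraNneq hg1 => /wval_eq1 e.
    by apply/eqP.
  exists (false :: word_of (size g) (wval g).+1); first by rewrite /= size_word_of.
  have hw : W (false :: word_of (size g) (wval g).+1) by rewrite /= size_word_of addn4.
  apply/orP; left; apply/and3P; split; first by rewrite sv.
    by have [_ _ _ _ ->] := clsP hw; rewrite (cls_head0 hw).
  apply/orP; right; apply/and3P; split=> //; last by case: (c) hc.
  by apply/lsuccP; rewrite size_word_of word_ofK.
have ones_max : isMax (true :: nseq (size g) true).
  by rewrite /isMax /= size_nseq.
case: c hv cv sv step0 => hv cv sv step0.
  apply: step0 => //; apply/eqP => e; move: sv.
  by rewrite /special e ones_max !orbT.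
have [s1|/negbTE s1] := boolP (special (true :: g)); last first.
  exists (true :: g) => //; apply/orP; left; apply/and3P; split; rewrite ?sv ?s1 //.
  by rewrite /= eqxx.
have [eg|] := eqVneq g (nseq (size g) true); last by apply: step0; rewrite s1.
have [w hw wB] := has_Bot; exists w; first by rewrite hw addn4.
by apply/orP; right; rewrite wB /= -eg eqxx.
Qed.

Lemma has_succ v : W v -> ~~ isMax v -> exists2 w, W w & next v w.
Proof.
move=> hv; have [vB vR vT vM _] := clsP hv; rewrite vM => nM.
case Ev : (cls v) => [|[|[|[|k]]]]; rewrite Ev in vB vR vT nM.
- exact: has_succ0.
- have [a [b [ev ha hb _ _]]] := isBotP hv vB.
  exists (element true false true a false (nseq m false)); first exact: W_real.
  have [wB wR _ _ _] := clsP (W_real ha).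
  have := isReal_element ha; rewrite wR => /eqP cw.
  apply/orP; right; rewrite ?wB wR cw /= vB el_a_real // ev el_a_element ?hb //.
  by rewrite !eqxx.
- have [a ha ev] := isRealP hv vR.
  have [amax|namax] := pselect (is_max A a).
    have [w hw [wT wa]] := has_Top ha amax; exists w => //.
    have [wB wR wT' _ _] := clsP hw; move: (wT); rewrite wT' => /eqP cw.
    apply/orP; right; rewrite ?wB ?wR wT' cw /= vR wa ev.
    by rewrite el_a_real // !eqxx.
  have [a' sa' aa'] := has_next A_ord A_len namax; rewrite ha in sa'.
  exists (element true false true a' false (nseq m false)); first exact: W_real.
  have [wB wR _ _ _] := clsP (W_real sa').
  have := isReal_element sa'; rewrite wR => /eqP cw.
  apply/orP; right; rewrite ?wB ?wR cw /= vR ev !el_a_real //.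
  by rewrite orbC; apply/orP; left; apply/asboolP.
- exists (nseq (2 * m + 4) true); first exact: size_nseq.
  have hw : W (nseq (2 * m + 4) true) by rewrite size_nseq.
  have wM : isMax (nseq (2 * m + 4) true) by rewrite /isMax size_nseq.
  have [wB wR wT wM' _] := clsP hw; move: (wM); rewrite wM' => /eqP cw.
  by apply/orP; right; rewrite ?wB ?wR ?wT wM' cw /= vT.
- by have := cls_le4 v; rewrite Ev; move: nM; case: (k).
Qed.

(** The converse comes from existence: every path but the last has some [next] path, which covers
    it, and in a total order at most one path covers a given one. *)
Lemma nextP v w : W v -> W w -> (next v w <-> covers v w).
Proof.
move=> hv hw; split; first exact: next_covers.
move=> [vw nvw hbt].
have [vM|nM] := boolP (isMax v).
  have [_ _ _ e _] := clsP hv; rewrite vM in e; have /esym/eqP cv := e.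
  case: nvw; apply: Max_uniq => //; have [_ _ _ -> _] := clsP hw.
  have := chain_cls vw; rewrite cv leq_eqVlt => /orP [/eqP <- //|].
  by rewrite ltnNge cls_le4.
have [u hu nu] := has_succ hv nM; have [vu nvu hbt'] := next_covers hv hu nu.
have /orP [uw|wu] := chain_total u w.
  by have [e|<- //] := hbt u hu vu uw; case: nvu.
by have [e|-> //] := hbt' w hw vw wu; case: nvw.
Qed.

Lemma chain_zeros v : W v -> chain (nseq (2 * m + 4) false) v.
Proof.
move=> hv; have hw : W (nseq (2 * m + 4) false) by rewrite size_nseq.
have c0 : cls (nseq (2 * m + 4) false) = 0 by apply: cls_head0; rewrite // addn4.
rewrite /chain c0; case: (cls v) => //=; rewrite /rank0 addn4 /=.
by rewrite wval0.
Qed.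

Lemma chain_ones v : W v -> chain v (nseq (2 * m + 4) true).
Proof.
move=> hv; have hw : W (nseq (2 * m + 4) true) by rewrite size_nseq.
have [_ _ _ wM _] := clsP hw; have : isMax (nseq (2 * m + 4) true) by rewrite /isMax size_nseq.
rewrite wM => /eqP c4; rewrite /chain c4.
have := cls_le4 v.
by case: (cls v) => [|[|[|[|[|k]]]]].
Qed.

End Chain.


Lemma ptime_next A : ptime_pred2 (adjacent A) -> ptime_pred2 (next A).
Proof.
move=> /FP_dec hA; apply: dec_FP.
have hadj f g : FP f -> FP g -> PD (fun a : 2.-tuple word => adj A (f a) (g a)).
  exact: (FP_comp2 (F := fun x y => [:: `[< adjacent A x y >]])) hA.
pose u (a : 2.-tuple word) := tnth a (inord 0).
pose v (a : 2.-tuple word) := tnth a (inord 1).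
have hu : FP u by exact: FP_tnth. have hv : FP v by exact: FP_tnth.
have ha f : FP f -> FP (fun a : 2.-tuple word => el_a (f a)).
  by move=> hf; exact: FP_evens (FP_drop _ hf).
have hb f : FP f -> FP (fun a : 2.-tuple word => el_b (f a)).
  by move=> hf; exact: FP_evens (FP_drop _ hf).
have hB f : FP f -> PD (fun a : 2.-tuple word => isBot A (f a)).
  move=> hf; apply: PD_and (PD_prefix _ hf) _; apply: PD_or.
    exact: PD_eq (hb _ hf) (FP_const _ hf).
  exact: PD_and (PD_prefix _ (hb _ hf)) (hadj _ _ (FP_drop _ (hb _ hf)) (ha _ hf)).
have hR f : FP f -> PD (fun a : 2.-tuple word => isReal (f a)).
  by move=> hf; exact: PD_and (PD_prefix _ hf) (PD_nseq _ (hb _ hf)).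
have hT f : FP f -> PD (fun a : 2.-tuple word => isTop A (f a)).
  by move=> hf; exact: PD_and (PD_prefix _ hf) (hadj _ _ (ha _ hf) (hb _ hf)).
have hM f : FP f -> PD (fun a : 2.-tuple word => isMax (f a)) by exact: PD_nseq.
have hS f : FP f -> PD (fun a : 2.-tuple word => special A (f a)).
  by move=> hf; exact: PD_or (hB _ hf) (PD_or (hR _ hf) (PD_or (hT _ hf) (hM _ hf))).
have bu := FP_behead hu; have bv := FP_behead hv.
have hN : PD (fun a => next A (u a) (v a)).
  apply: PD_or.
    apply: PD_and (PD_neg (hS _ hu)) (PD_and (PD_neg (hS _ hv)) _); apply: PD_or.
      exact: PD_and (PD_head _ hu) (PD_and (PD_head _ hv) (PD_eq bu bv)).
    apply: PD_and (PD_head _ hv) (PD_and (PD_lsucc bu bv) _).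
    exact: PD_or (PD_head _ hu) (hS _ (FP_cons _ bu)).
  apply: PD_if (hB _ hv) (PD_and (PD_head _ hu) (PD_nseq _ bu)) _.
  apply: PD_if (hR _ hv) _ _.
    apply: PD_or; first exact: PD_and (hB _ hu) (PD_eq (ha _ hu) (ha _ hv)).
    exact: PD_and (hR _ hu) (hadj _ _ (ha _ hu) (ha _ hv)).
  apply: PD_if (hT _ hv) _ _.
    exact: PD_and (hR _ hu) (PD_eq (ha _ hu) (ha _ hv)).
  exact: PD_and (hM _ hv) (hT _ hu).
by apply: PD_ext hN => a; rewrite asboolb.
Qed.

Lemma CL_sub_CLU : CLsharpP `<=` CLUsharpP.
Proof.
move=> f [p [M [A [hM A_ord A_len hA hx]]]].
(* Two interleaved words as long as a path of [M], behind four single bits. *)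
pose p' : {poly nat} := (p + p + 4%:P)%R.
pose m x := plen p x.
have p'E x : plen p' x = 2 * m x + 4.
  by rewrite /plen !hornerD hornerC /m /plen -!plusE; lia.
have hunit d : FP (fun a : 1.-tuple word => nseq (plen p' (tnth a ord0)) d).
  apply: eq_FP (FP_unary 0 2 4 d (FP_tnth (ord0 : 'I_1)) (FP_plen hM)) => a.
  by rewrite size_nseq p'E.
have [Q hQ accQ] := FP_acc hM.
(* Only paths of class 2 accept, so the accepting paths are an [A]-convex part of the chain, in the
   same number as those of [M]. *)
pose P (x w : word) := isReal w && Q x (el_a w).
have [||M' hM' accM'] := @FP_balanced p' _ P (hunit false).
- by move=> x; rewrite size_nseq.
- have hw : FP (fun a : 2.-tuple word => tnth a (inord 1)) by exact: FP_tnth.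
  apply: PD_and.
    exact: PD_and (PD_prefix _ hw) (PD_nseq _ (FP_evens (FP_drop _ hw))).
  exact: (FP_comp2 (F := fun x w => [:: Q x w]) hQ (FP_tnth _)
    (FP_evens (FP_drop _ hw))).
pose real x a := element true false true a false (nseq (m x) false).
have sacc x a : acc M [tuple x] a -> size a = m x.
  move=> ha; have : paths M [tuple x] a by case: ha => k [d [r hd]]; exists k, d, true.
  by rewrite hM.2.
have accE x : acc M' [tuple x] = [set real x a | a in acc M [tuple x]].
  rewrite accM' p'E; apply/seteqP; split=> w /=.
    move=> [hw /andP [hr hq]]; have [a ha ew] := isRealP hw hr.
    rewrite ew el_a_real // in hq; exists a => //; exact/accQ.
  move=> [a ha <-]; have sa := sacc _ _ ha; split; first exact: W_real.
  by rewrite /P isReal_element // el_a_real //; apply/accQ.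
exists p', M', (fun x => nseq (plen p' x) false), (fun x => nseq (plen p' x) true),
  (fun _ => next A).
split=> //.
- by apply/FPtP; exact: hunit.
- by apply/FPtP; exact: hunit.
- have /FP_dec hN := ptime_next hA; apply: dec_FP.
  exact: (FP_comp2 (F := fun y z => [:: `[< next A y z >]])) hN (FP_tnth _) (FP_tnth _).
move=> x; have [clu hcard] := hx x.
have [|||h [hb hle hs [h0 h1]]] := @order_iso (2 * m x + 4) (chain A).
- by move=> *; exact: chain_total.
- by move=> y z hy hz; exact: chain_anti hy hz.
- by move=> y z w _ _ _; exact: chain_trans.
exists h; rewrite !p'E; split=> //; split.
- by rewrite /words /= !size_nseq.
- split; [apply: h0|apply: h1]; rewrite ?size_nseq // => z hz.
    exact: chain_zeros.
  exact: chain_ones.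
- move=> y z hy hz; rewrite lex_succP hs //; exact: (nextP A_ord A_len hy hz).
- move=> /eqP f0; have [acc0|/set0P accN] := eqVneq (acc M [tuple x]) set0.
    have /eqP e : `I_(f x) == set0.
      by rewrite -(@card_eq0 _ word) card_eq_sym -acc0.
    by have : @set0 nat 0 by rewrite -e /= lt0n.
  have [[l hl lmin] [u hu umax]] := extremal A_ord accN (@sacc x).
  have sl := sacc _ _ hl; have su := sacc _ _ hu.
  have cls2 a : size a = m x -> cls A (real x a) = 2.
    move=> sa; have [_ e _ _ _] := clsP A (W_real sa).
    by apply/eqP; rewrite -e isReal_element.
  exists (real x l), (real x u); split; try exact: W_real.
  rewrite accE; apply/seteqP; split=> w /=.
    move=> [a ha <-]; have sa := sacc _ _ ha.
    split; first exact: W_real.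
      apply/hle; try exact: W_real.
      by rewrite /chain !cls2 // !el_a_real //= lmin.
    apply/hle; try exact: W_real.
    by rewrite /chain !cls2 // !el_a_real //= umax.
  move=> [sw /hle h2 /hle h3].
  have {}h2 := h2 (W_real sl) sw; have {}h3 := h3 sw (W_real su).
  have cw : cls A w = 2.
    have := chain_cls h2; have := chain_cls h3; rewrite !cls2 //; lia.
  have [a sa ew] := isRealP sw (cls_Real sw cw).
  exists a => //.
  have := chain_real h2 (cls2 l sl) cw; have := chain_real h3 cw (cls2 u su).
  rewrite ew !el_a_real // => au la.
  exact: (cluster_convex A_ord clu hl hu la au).
- rewrite accE; apply: card_eq_trans hcard; apply: inj_card_eq.
  move=> a b /set_mem /sacc sa /set_mem /sacc sb e.
  by rewrite -(el_a_real sa) -(el_a_real sb); congr el_a.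
Qed.

Theorem theorem3p1 : CLUsharpP = CLsharpP.
Proof. by apply/seteqP; split; [exact: CLU_sub_CL|exact: CL_sub_CLU]. Qed.
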